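(* Let $1<p,q<\infty$ with $\frac1p+\frac1q<1$ and $p>2$, and let $\mu$ be a finite positive Borel measure on $[0,1)$. (i) The operator $\mathcal H_\mu$ is well defined and bounded on $AT^q_p$ if and only if $\mu$ is a $1$-CM. (ii) The operator $\mathcal H_\mu$ is compact on $AT^q_p$ if and only if $\mu$ is a $1$-VCM.
   Context: $\mathbb D$ is the open unit disc of $\mathbb C$, $\mathbb T$ the unit circle, $dA$ the normalized area Lebesgue measure on $\mathbb D$, $|d\xi|$ arc length on $\mathbb T$. For $\xi\in\mathbb T$ put $$\Gamma_{1/2}(\xi)=\{z\in\mathbb D:|z|<1/2\}\cup\bigcup_{|z|<1/2}[z,\xi),$$ where $[z,\xi)$ is the half-open line segment from $z$ to $\xi$. For $1<p,q<\infty$, $AT^q_p$ is the Banach space of analytic functions $f$ on $\mathbb D$ such that $$\|f\|_{AT^q_p}=\left\{\int_{\mathbb T}\left(\int_{\Gamma_{1/2}(\xi)}|f(z)|^p\,\frac{dA(z)}{1-|z|^2}\right)^{q/p}|d\xi|\right\}^{1/q}<\infty.$$ Let $\mu_n=\int_0^1t^n\,d\mu(t)$, $n=0,1,2,\dots$. The generalized Hilbert operator is, for $f(z)=\sum_{k\ge0}a_kz^k$, $$\mathcal H_\mu(f)(z)=\sum_{n=0}^\infty\left(\sum_{k=0}^\infty\mu_{n+k}a_k\right)z^n,\qquad z\in\mathbb D.$$ It is well defined on $AT^q_p$ if for every $f\in AT^q_p$ all the inner series converge and the resulting power series represents an analytic function in $\mathbb D$; bounded (compact) on $AT^q_p$ means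 that it is then a bounded (compact) linear operator from $AT^q_p$ to itself (being compact includes being well defined). A finite positive Borel measure $\mu$ on $[0,1)$ is a $1$-Carleson measure ($1$-CM) if $\sup_{t\in[0,1)}\frac{\mu([t,1))}{1-t}<\infty$, and a $1$-vanishing Carleson measure ($1$-VCM) if $\lim_{t\to1^-}\frac{\mu([t,1))}{1-t}=0$. *)

(* Defs.v *)
(* MathComp-Analysis; the complex plane is R[i] from mathcomp-real-closed. *)
From HB Require Import structures.
From mathcomp Require Import all_boot all_order all_algebra.
From mathcomp Require Import all_classical all_reals all_analysis.
From mathcomp Require Import complex.

Set Implicit Arguments.
Unset Strict Implicit.
Unset Printing Implicit Defensive.

Import Order.TTheory GRing.Theory Num.Theory.
Import numFieldNormedType.Exports.
Import Normc.

Local Open Scope classical_set_scope.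
Local Open Scope ring_scope.
Local Open Scope complex_scope.

(* The topology of R[i] is the one induced by its own modulus. *)
HB.instance Definition _ (R : realType) := NormedModule.copy R[i] R[i]^o.

Definition disc (R : realType) (r : R) : set R[i] := [set z | normc z < r].

(* [derivable f z 1] over the field R[i]: complex differentiability at z.  The
   values of f outside the disc are irrelevant here and in what follows. *)
Definition analytic (R : realType) (f : R[i] -> R[i]) : Prop :=
  forall z, disc 1 z -> derivable f z 1.

Definition power_series (R : realType) (a : nat -> R[i]) (z : R[i]) :
    nat -> R[i] :=
  series (fun k => a k * z ^+ k).

Definition has_expansion (R : realType) (f : R[i] -> R[i]) (a : nat -> R[i])
    : Prop :=
  forall z, disc 1 z -> power_series a z @ \oo --> f z.

(* e^{i t}; arc length on the circle is Lebesgue measure in t in [0, 2 pi]. *)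
Definition cis (R : realType) (t : R) : R[i] := cos t +i* sin t.

Definition halfopen_segment (R : realType) (z xi : R[i]) : set R[i] :=
  [set ((1 - s)%:C * z + s%:C * xi) | s in `[0, 1[].

Definition Gamma_half (R : realType) (xi : R[i]) : set R[i] :=
  disc (2^-1) `|` \bigcup_(z in disc (2^-1)) halfopen_segment z xi.

(* The integral of g over E against dA = dx dy / pi. *)
Definition area_integral (R : realType) (E : set R[i]) (g : R[i] -> \bar R)
    : \bar R :=
  ((pi^-1)%:E * \int[(@lebesgue_measure R \x @lebesgue_measure R)%E]_(w in
     [set w | E (w.1 +i* w.2)]) g (w.1 +i* w.2)%C)%E.

Definition AT_norm (R : realType) (p q : R) (f : R[i] -> R[i]) : \bar R :=
  ((\int[@lebesgue_measure R]_(t in `[0%R, (pi *+ 2)%R])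
      ((area_integral (Gamma_half (cis t))
          (fun z => (normc (f z) `^ p / (1 - normc z ^+ 2))%:E)) `^ (q / p)))
   `^ (q^-1))%E.

Definition AT (R : realType) (p q : R) : set (R[i] -> R[i]) :=
  [set f | analytic f /\ (AT_norm p q f < +oo)%E].

Section hilbert_operator.
Variables (R : realType) (mu : {finite_measure set (measurableTypeR R) -> \bar R}).

Definition moment (n : nat) : R := \int[mu]_(t in `[0, 1[) (t ^+ n).

Definition hilbert_coef_series (a : nat -> R[i]) (n : nat) : nat -> R[i] :=
  series (fun k => (moment (n + k))%:C * a k).

Definition hilbert_coef (a : nat -> R[i]) (n : nat) : R[i] :=
  limn (hilbert_coef_series a n).

(* The function H_mu(f), for f(z) = \sum_k a_k z^k.  The limits are meaningful
   under [hilbert_well_defined]. *)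
Definition hilbert (a : nat -> R[i]) (z : R[i]) : R[i] :=
  limn (power_series (hilbert_coef a) z).

Definition hilbert_well_defined (p q : R) : Prop :=
  forall f a, AT p q f -> has_expansion f a ->
    [/\ forall n, cvgn (hilbert_coef_series a n),
        forall z, disc 1 z -> cvgn (power_series (hilbert_coef a) z)
      & analytic (hilbert a)].

Definition hilbert_maps_AT (p q : R) : Prop :=
  forall f a, AT p q f -> has_expansion f a -> AT p q (hilbert a).

Definition hilbert_bounded (p q : R) : Prop :=
  hilbert_maps_AT p q /\
  exists C : R, forall f a, AT p q f -> has_expansion f a ->
    (AT_norm p q (hilbert a) <= C%:E * AT_norm p q f)%E.

(* Compactness: the image of every bounded sequence of AT has a subsequence
   converging in the norm of AT to an element of AT. *)
Definition hilbert_compact (p q : R) : Prop :=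
  [/\ hilbert_well_defined p q, hilbert_maps_AT p q
    & forall (f : nat -> R[i] -> R[i]) (a : nat -> nat -> R[i]),
        (forall j, AT p q (f j)) ->
        (forall j, has_expansion (f j) (a j)) ->
        (exists M : R, forall j, (AT_norm p q (f j) <= M%:E)%E) ->
        exists (s : nat -> nat) (g : R[i] -> R[i]),
          [/\ {homo s : i j / (i < j)%N}, AT p q g
            & AT_norm p q (fun z => hilbert (a (s j)) z - g z) @[j --> \oo] --> 0%E]].

Definition carleson_ratio (t : R) : \bar R :=
  (mu `[t, 1%R[%classic * ((1 - t)^-1)%:E)%E.

Definition carleson1 : Prop :=
  (ereal_sup [set carleson_ratio t | t in `[0%R, 1%R[] < +oo)%E.

Definition vanishing_carleson1 : Prop :=
  carleson_ratio t @[t --> 1^'-] --> 0%E.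

End hilbert_operator.

(* Main.v *)
(* Everything is measured on the dyadic intervals [1 - 2^-k, 1 - 2^-(k+1)) of the
   radius [0, 1).  Put s = 1/p + 1/q and let F_k be the supremum of |f| on the k-th
   interval.
   - Trace: by the sub-mean value property, |f|^p at a point of the k-th interval
     is controlled by the tent integrals over an arc of length about 2^-k at 1;
     distinct k use disjoint arcs, so sum_k (2^(-ks) F_k)^q <= C ||f||^q.
   - Majorant: if |g(z)| <= sum_k 2^-k c_k / max(2^-k, |1 - z|), a Schur test
     gives ||g||^q <= C sum_k (2^(-ks) c_k)^q; this uses s < 1.
   - Representation: |H f(z)| <= 2 int |f(t)| / |1 - tz| dmu(t), so that H f has such
     a majorant with c_k = 4 rho_k F_k, where rho_k is the Carleson ratio of mu at
     1 - 2^-k.  Exchanging sum and integral is legitimate because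
     sum |a_n| t^n <= D (1 - t)^-tau with tau < 1, by Parseval on circles.
   Hence ||H f||^q <= C sum_k (rho_k 2^(-ks) F_k)^q, which gives boundedness, and
   compactness when rho_k -> 0: a bounded sequence has a subsequence with convergent
   Taylor coefficients, and finitely many k are then handled by uniform
   convergence on compact sets.  The converses test H on
   (1 - b)^(1-s) / (1 - bz) and use the trace inequality at the point b. *)
Require Import Defs.
From HB Require Import structures.
From mathcomp Require Import all_boot all_order all_algebra.
From mathcomp Require Import all_classical all_reals all_analysis.
From mathcomp Require Import measurable_realfun complex ring lra.

Set Implicit Arguments.
Unset Strict Implicit.
Unset Printing Implicit Defensive.

Import Order.TTheory GRing.Theory Num.Theory.
Import numFieldNormedType.Exports.
Import Normc.
Local Open Scope classical_set_scope.
Local Open Scope ring_scope.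

Local Notation Re := complex.Re.
Local Notation Im := complex.Im.

(** Mean values are taken over n-th roots of unity: polynomials of degree below n satisfy the mean
    value identity exactly there, and the error is a Taylor tail. Averaging over a disc, with
    rotation invariance of the plane measure, gives the sub-mean inequality; the same finite means
    give Parseval. The inner integral of the norm is never shown measurable in the angle: the norm
    is only compared with step functions, from below on disjoint arcs and from above on a cover. The
    exponent s is the scaling of the norm: |f(r)| grows at most like (1 - r)^(-s), and 1 / (1 - bz)
    has norm at most of order (1 - b)^(s - 1). The obstacle is the passage from moments to an
    integral: membership in the space controls f, while the exchange needs sum |a_n| t^n.
    Cauchy-Schwarz adds (1 - t)^(-1/2) to the growth of the quadratic mean, which for q >= 2 is (1 -
    r)^(-1/p); the total exponent 1/p + 1/2 is below 1 exactly when p > 2. *)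

Lemma one_sub_mul_sum (R : pzRingType) (x : R) n : (1 - x) * \sum_(k < n) x ^+ k = 1 - x ^+ n.
Proof. by rewrite -opprB mulNr -subrX1 opprB. Qed.

Lemma geometric_sum_le (R : realFieldType) (x : R) n : 0 <= x < 1 -> \sum_(k < n) x ^+ k <= (1 - x)^-1.
Proof.
move=> /andP[x0 x1]; rewrite -[leRHS]mul1r ler_pdivlMr ?subr_gt0// mulrC one_sub_mul_sum.
by rewrite lerBlDr lerDl exprn_ge0.
Qed.

(** * Moduli and power series *)

Section complex_modulus.
Local Open Scope complex_scope.
Variable R : realType.
Implicit Types (z w : R[i]) (x y r : R).

Lemma normc_ge0 z : 0 <= normc z.
Proof. by case: z => a b; exact: sqrtr_ge0. Qed.

Lemma sqr_normcE z : normc z ^+ 2 = Re z ^+ 2 + Im z ^+ 2.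
Proof. by case: z => a b /=; rewrite sqr_sqrtr // addr_ge0 ?sqr_ge0. Qed.

Lemma normc_real x : normc x%:C = `|x|.
Proof. by rewrite /= expr0n addr0 sqrtr_sqr. Qed.

Lemma normc_real_ge0 x : 0 <= x -> normc x%:C = x.
Proof. by move=> x0; rewrite normc_real ger0_norm. Qed.

Lemma normcX z n : normc (z ^+ n) = normc z ^+ n.
Proof.
elim: n => [|n IH]; first by rewrite !expr0 normc1.
by rewrite !exprS normcM IH.
Qed.

Lemma normcBC z w : normc (z - w) = normc (w - z).
Proof. by rewrite -normcN opprB. Qed.

Lemma ler_normcB z w : normc z - normc w <= normc (z - w).
Proof. by rewrite lerBlDr; have := le_normcD (z - w) w; rewrite subrK. Qed.

Lemma normc_tri w z v : normc (z - v) <= normc (z - w) + normc (w - v).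
Proof. by have := le_normcD (z - w) (w - v); rewrite addrA subrK. Qed.

Lemma normc_Re z : `|Re z| <= normc z.
Proof.
rewrite -(ger0_norm (normc_ge0 z)) -ler_sqr ?nnegrE//.
by rewrite !real_normK ?num_real// sqr_normcE lerDl sqr_ge0.
Qed.

Lemma normc_Im z : `|Im z| <= normc z.
Proof.
rewrite -(ger0_norm (normc_ge0 z)) -ler_sqr ?nnegrE//.
by rewrite !real_normK ?num_real// sqr_normcE lerDr sqr_ge0.
Qed.

Lemma normc_le_ReIm z : normc z <= `|Re z| + `|Im z|.
Proof.
rewrite -(ger0_norm (normc_ge0 z)) -ler_sqr ?nnegrE// ?addr_ge0//.
rewrite !real_normK ?num_real// sqr_normcE sqrrD !real_normK ?num_real//.
by rewrite -addrA lerD2l addrC lerDl mulrn_wge0// mulr_ge0.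
Qed.

Lemma normc_sum (I : Type) (s : seq I) (P : pred I) (F : I -> R[i]) :
  normc (\sum_(i <- s | P i) F i) <= \sum_(i <- s | P i) normc (F i).
Proof.
elim/big_ind2: _ => [|u a v b ua vb|//]; first by rewrite normc0.
exact: le_trans (le_normcD _ _) (lerD ua vb).
Qed.

(** The norm of R[i] takes its values in R[i] itself; this moves every convergence question to the
    real line. *)
Lemma cvgcP (u : nat -> R[i]) (l : R[i]) :
  (u @ \oo --> l) <-> (normc (u n - l) @[n --> \oo] --> (0 : R)).
Proof.
split=> [/cvgrPdist_lt H|/cvgrPdist_lt H]; apply/cvgrPdist_lt.
- move=> e e0; have /H : 0 < e%:C by rewrite ltcR.
  apply: filterS => n; rewrite distrC [in X in X -> _]/Num.norm/= ltcR.
  by rewrite sub0r normrN ger0_norm// normc_ge0.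
(* A positive element of R[i] has zero imaginary part, so the radius is real. *)
- move=> [e ei]; rewrite ltcE/= => /andP[/eqP -> e0].
  have /H : 0 < e by [].
  apply: filterS => n; rewrite sub0r normrN ger0_norm ?normc_ge0// => h.
  by rewrite distrC; change ((normc (u n - l))%:C < e%:C); rewrite ltcR.
Qed.

Lemma cvgc_ReIm (u : nat -> R[i]) x y : Re (u n) @[n --> \oo] --> x ->
  Im (u n) @[n --> \oo] --> y -> u @ \oo --> (x +i* y).
Proof.
move=> ux uy; apply/cvgcP.
apply: (@squeeze_cvgr _ _ _ _ (fun=> 0) (fun n => `|Re (u n) - x| + `|Im (u n) - y|)).
- apply: nearW => n; rewrite normc_ge0/= (le_trans (normc_le_ReIm _))//.
  by case: (u n).
- exact: cvg_cst.
- rewrite -[X in _ --> X]addr0; apply: cvgD; apply/norm_cvg0P.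
  + by rewrite -(subrr x); apply: cvgB => //; exact: cvg_cst.
  + by rewrite -(subrr y); apply: cvgB => //; exact: cvg_cst.
Qed.

Lemma Re_sum (I : Type) (s : seq I) (P : pred I) (F : I -> R[i]) :
  Re (\sum_(i <- s | P i) F i) = \sum_(i <- s | P i) Re (F i).
Proof. by apply: big_morph => // -[a b] [c d]. Qed.

Lemma Im_sum (I : Type) (s : seq I) (P : pred I) (F : I -> R[i]) :
  Im (\sum_(i <- s | P i) F i) = \sum_(i <- s | P i) Im (F i).
Proof. by apply: big_morph => // -[a b] [c d]. Qed.

Lemma abs_cvgc_series (a : nat -> R[i]) :
  cvgn (series (fun k => normc (a k))) -> cvgn (series a).
Proof.
move=> ca.
have cRe : cvgn (series (fun k => Re (a k))).
  apply: normed_cvg; apply: series_le_cvg ca => n //=; first exact: normc_ge0.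
  exact: normc_Re.
have cIm : cvgn (series (fun k => Im (a k))).
  apply: normed_cvg; apply: series_le_cvg ca => n //=; first exact: normc_ge0.
  exact: normc_Im.
apply/cvg_ex; eexists; apply: cvgc_ReIm.
- rewrite (_ : (fun n => Re (series a n)) = series (fun k => Re (a k))); first exact: cRe.
  by apply/funext => n; rewrite /series/= Re_sum.
- rewrite (_ : (fun n => Im (series a n)) = series (fun k => Im (a k))); first exact: cIm.
  by apply/funext => n; rewrite /series/= Im_sum.
Qed.

Lemma cvgc_lim (u : nat -> R[i]) (l : R[i]) : u @ \oo --> l -> limn u = l.
Proof. exact: cvg_lim. Qed.

Lemma normc_lim_le (u : nat -> R[i]) (l : R[i]) (b : nat -> R) (B : R) :
  u @ \oo --> l -> b @ \oo --> B -> (\forall n \near \oo, normc (u n) <= b n) ->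
  normc l <= B.
Proof.
move=> /cvgcP ul bB ub.
have : b n + normc (u n - l) @[n --> \oo] --> B + 0 by apply: cvgD.
rewrite addr0 => /cvgP cvb. 
have <- : limn (fun n => b n + normc (u n - l)) = B.
  by apply/cvg_lim => //; rewrite -[X in _ --> X]addr0; apply: cvgD.
apply: limr_ge => //; near=> n.
have : normc (u n) <= b n by near: n.
have := ler_normcB l (u n); rewrite normcBC; lra.
Unshelve. all: by end_near. Qed.

Lemma cvgc_normc (u : nat -> R[i]) (l : R[i]) :
  u @ \oo --> l -> normc (u n) @[n --> \oo] --> normc l.
Proof.
move=> /cvgcP ul; apply/cvgrPdist_lt => e e0.
move/cvgrPdist_lt : ul => /(_ _ e0); apply: filterS => n.
rewrite sub0r normrN ger0_norm ?normc_ge0// => h.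
have h1 := ler_normcB l (u n); have h2 := ler_normcB (u n) l.
by rewrite normcBC in h1; rewrite ltr_norml; apply/andP; split; lra.
Qed.

(* Uniformity comes from the right-hand side, a tail of a real series. *)
Lemma series_tail (a : nat -> R[i]) (b : nat -> R) (l : R[i]) n :
  (forall k, normc (a k) <= b k) -> cvgn (series b) -> series a @ \oo --> l ->
  normc (l - series a n) <= limn (series b) - series b n.
Proof.
move=> ab cb al.
apply: (@normc_lim_le (fun m => series a m - series a n) _
  (fun m => series b m - series b n)).
- by apply: (cvgB al); exact: cvg_cst.
- by apply: (cvgB cb); exact: cvg_cst.
- near=> m; have nm : (n <= m)%N by near: m; exact: nbhs_infty_ge.
  rewrite !sub_series_geq// (le_trans (normc_sum _ _ _))//.
  exact: ler_sum.
Unshelve. all: by end_near. Qed.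

Lemma cvg_series_tail (b : nat -> R) : cvgn (series b) ->
  limn (series b) - series b n @[n --> \oo] --> (0 : R).
Proof.
by move=> cb; rewrite -(subrr (limn (series b))); apply: cvgB; [exact: cvg_cst|exact: cb].
Qed.

End complex_modulus.

Section expansions.
Local Open Scope complex_scope.
Variable R : realType.
Implicit Types (a : nat -> R[i]) (r : R) (z : R[i]).

Definition abs_series a r : nat -> R := series (fun k => normc (a k) * r ^+ k).

(** Abel's lemma: the terms at r are dominated by the geometric series of ratio r / s. *)
Lemma bounded_coef_cvg a (r s B : R) : 0 <= r -> r < s ->
  (forall k, normc (a k) * s ^+ k <= B) -> cvgn (abs_series a r).
Proof.
move=> r0 rs aB.
have s0 : 0 < s by exact: le_lt_trans r0 rs.
have : cvgn (series (geometric B (r / s))).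
  apply: is_cvg_geometric_series.
  by rewrite ger0_norm ?divr_ge0 ?(ltW s0)// ltr_pdivrMr// mul1r.
apply: series_le_cvg => k /=.
- by rewrite mulr_ge0 ?normc_ge0// exprn_ge0.
- rewrite mulr_ge0 ?exprn_ge0 ?(divr_ge0 r0 (ltW s0))//.
  by rewrite (le_trans _ (aB 0%N))// expr0 mulr1 normc_ge0.
- rewrite expr_div_n mulrA ler_pdivlMr ?exprn_gt0// mulrAC.
  by rewrite ler_wpM2r ?exprn_ge0.
Qed.

(** Convergence at the single point s = (r + 1) / 2 bounds the terms there, and Abel's lemma applies
    below s. *)
Lemma expansion_abs_cvg (f : R[i] -> R[i]) a r : has_expansion f a -> 0 <= r < 1 ->
  cvgn (abs_series a r).
Proof.
move=> fa /andP[r0 r1].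
pose s := (r + 1) / 2.
have [rs s1] : r < s /\ s < 1 by rewrite /s; split; lra.
have s0 : 0 <= s by rewrite ltW// (le_lt_trans r0).
have /fa /cvgcP/cvgrPdist_lt/(_ 1 ltr01)[N _ HN] : disc 1 (s%:C : R[i]).
  by rewrite /disc/= expr0n addr0 sqrtr_sqr ger0_norm.
(* Two consecutive partial sums are within 1 of the limit, so their difference has modulus at most
   2; the finitely many earlier terms are added to the bound below. *)
have Hb k : (N <= k)%N -> normc (a k) * s ^+ k <= 2.
  move=> Nk; have := HN _ Nk; have := HN k.+1 (leqW Nk).
  rewrite !sub0r !normrN !ger0_norm ?normc_ge0//=.
  have <- : normc (a k * s%:C ^+ k) = normc (a k) * s ^+ k.
    by rewrite normcM normcX normc_real_ge0.
  have -> : a k * s%:C ^+ k = power_series a s%:C k.+1 - power_series a s%:C k.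
    by rewrite /power_series seriesSB.
  have := normc_tri (f s%:C) (power_series a s%:C k.+1) (power_series a s%:C k).
  by rewrite (normcBC (f _) (power_series _ _ _)); lra.
apply: (@bounded_coef_cvg a r s (2 + \sum_(k < N) normc (a k) * s ^+ k)) => // k.
have [Nk|kN] := leqP N k.
  by rewrite (le_trans (Hb _ Nk))// lerDl sumr_ge0// => i _; rewrite mulr_ge0 ?normc_ge0 ?exprn_ge0.
rewrite (bigD1 (Ordinal kN))//= addrCA lerDl addr_ge0// sumr_ge0// => i _.
by rewrite mulr_ge0 ?normc_ge0 ?exprn_ge0.
Qed.

Lemma normc_term_le a r z k : normc z <= r -> normc (a k * z ^+ k) <= normc (a k) * r ^+ k.
Proof.
by move=> zr; rewrite normcM normcX ler_wpM2l ?normc_ge0// lerXn2r ?nnegrE ?normc_ge0// (le_trans (normc_ge0 z)).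
Qed.

(** The right-hand side does not depend on z, so this is uniform convergence on the closed disc of
    radius r. *)
Lemma expansion_tail (f : R[i] -> R[i]) a r z n : has_expansion f a -> r < 1 ->
  normc z <= r ->
  normc (f z - power_series a z n) <= limn (abs_series a r) - abs_series a r n.
Proof.
move=> fa r1 zr; apply: series_tail.
- by move=> k; exact: normc_term_le.
- by apply: (expansion_abs_cvg fa); rewrite r1 (le_trans (normc_ge0 z)).
- by apply: fa; exact: le_lt_trans zr r1.
Qed.

Lemma expansionB (f g : R[i] -> R[i]) a b : has_expansion f a -> has_expansion g b ->
  has_expansion (fun z => f z - g z) (fun k => a k - b k).
Proof.
move=> fa gb z z1.
rewrite (_ : power_series _ z = power_series a z - power_series b z).
  by apply: cvgB; [exact: fa|exact: gb].
apply/funext => n; rewrite /power_series/series !fctE/= -sumrB.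
by apply: eq_bigr => k _; rewrite mulrBl.
Qed.

End expansions.

(** * Measure-theoretic tools *)

Section step_functions.
Local Open Scope ereal_scope.
Context d (T : measurableType d) (R : realType).
Variable mu : {measure set T -> \bar R}.
Implicit Types (D : set T) (f g : T -> \bar R).

(* No measurability: the integral of a nonnegative function is a supremum over
   the simple functions below it. *)
Lemma ge0_le_integral_nomeas D D' f g : (forall x, D x -> 0 <= f x) ->
  (forall x, D' x -> 0 <= g x) -> (forall x, D x -> D' x /\ f x <= g x) ->
  \int[mu]_(x in D) f x <= \int[mu]_(x in D') g x.
Proof.
move=> f0 g0 fg; rewrite !ge0_integralE//; apply: ge_ereal_sup => _ [h /= hf <-].
apply: ereal_sup_ubound; exists h => // x; apply: (le_trans (hf x)).
rewrite !patchE; case: ifPn => [/set_mem /fg[D'x]|_]; first by rewrite mem_set.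
by case: ifPn => // /set_mem; exact: g0.
Qed.

(** The sets may overlap and the values may be infinite: it is enough that each point lies in one
    set with a large enough value, and a null set may carry +oo. *)
Lemma integral_le_step D f (E : nat -> set T) (v : nat -> \bar R) :
  (forall i, measurable (E i)) -> (forall i, 0 <= v i) ->
  (forall x, D x -> 0 <= f x) ->
  (forall x, D x -> f x <= \sum_(i <oo) v i * (\1_(E i) x)%:E) ->
  \int[mu]_(x in D) f x <= \sum_(i <oo) v i * mu (E i).
Proof.
move=> mE v0 f0 fv.
have v10 i x : 0 <= v i * (\1_(E i) x)%:E by rewrite mule_ge0// lee_fin.
have -> : \sum_(i <oo) v i * mu (E i) =
    \int[mu]_x (\sum_(i <oo) v i * (\1_(E i) x)%:E).
  rewrite integral_nneseries//.
    apply: eq_eseriesr => i _.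
    rewrite ge0_integralZl ?integral_indic ?setIT//.
    by apply/measurable_EFinP; exact: measurable_indic.
  move=> i; apply: emeasurable_funM; first exact: measurable_cst.
  by apply/measurable_EFinP; exact: measurable_indic.
apply: ge0_le_integral_nomeas => //.
- by move=> x _; apply: nneseries_ge0.
- by move=> x Dx; split => //; exact: fv.
Qed.

(** By disjointness at most one indicator is nonzero at each point, so the step function lies below
    [f]. *)
Lemma step_le_integral D f (E : nat -> set T) (v : nat -> \bar R) n :
  (forall i, measurable (E i)) -> (forall i, 0 <= v i) ->
  (forall x, D x -> 0 <= f x) -> trivIset setT E ->
  (forall i x, (i < n)%N -> E i x -> D x /\ v i <= f x) ->
  \sum_(i < n) v i * mu (E i) <= \int[mu]_(x in D) f x.
Proof.
move=> mE v0 f0 tE vf.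
have v10 i x : 0 <= v i * (\1_(E i) x)%:E by rewrite mule_ge0// lee_fin.
have -> : \sum_(i < n) v i * mu (E i) =
    \int[mu]_x (\sum_(i < n) v i * (\1_(E i) x)%:E).
  rewrite ge0_integral_sum//.
    apply: eq_bigr => i _.
    rewrite ge0_integralZl ?integral_indic ?setIT//.
    by apply/measurable_EFinP; exact: measurable_indic.
  move=> i; apply: emeasurable_funM; first exact: measurable_cst.
  by apply/measurable_EFinP; exact: measurable_indic.
rewrite [leRHS]integral_mkcond; apply: ge0_le_integral_nomeas => //.
- by move=> x _; apply: sume_ge0.
- by move=> x _; apply: erestrict_ge0.
- move=> x _; split => //.
  have [[j Ejx]|nE] := pselect (exists j : 'I_n, E j x); last first.
    rewrite big1 ?erestrict_ge0// => i _.
    by rewrite indicE memNset ?mule0// => Eix; apply: nE; exists i.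
  rewrite (bigD1 j)//= big1 ?adde0.
    have [Dx] := vf _ _ (ltn_ord j) Ejx.
    by rewrite patchE mem_set// indicE mem_set// mule1.
  move=> i ij; rewrite indicE memNset ?mule0// => Eix.
  move/eqP : ij; apply; apply/val_inj; apply: (tE i j) => //.
  by exists x.
Qed.

End step_functions.

(** * Translations, shears and rotations of the plane; measurability of open sets *)

Section plane_measure.
Variable R : realType.
Local Notation leb := (@lebesgue_measure R).
Local Notation leb2 := (leb \x leb)%E.
Local Notation RR := (measurableTypeR R * measurableTypeR R)%type.

Lemma measurable_shift (c : R) : measurable_fun setT (fun x : measurableTypeR R => x + c : measurableTypeR R).
Proof. by apply: measurable_funD => //; exact: measurable_cst. Qed.

(** The image of Lebesgue measure under a translation agrees with it on half-open intervals, hence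
    equals it by uniqueness. *)
Lemma ge0_integral_shift (c : R) (f : R -> \bar R) :
  measurable_fun setT f -> (forall x, 0 <= f x)%E ->
  (\int[leb]_x f (x + c)%R = \int[leb]_x f x)%E.
Proof.
move=> mf f0.
have := @ge0_integral_pushforward _ _ _ _ R _ (measurable_shift c) leb setT f measurableT mf (fun x _ => f0 x).
rewrite preimage_setT => <-; apply: eq_measure_integral; first exact: measurable_shift.
move=> ? A mA _; apply/esym/lebesgue_measure_unique => //= _ [[a b]] _ <-.
rewrite /pushforward.
have -> : (fun x => x + c) @^-1` `]a, b]%classic = `]a - c, b - c]%classic.
  by apply/seteqP; split => x /=; rewrite !in_itv/= ltrBlDr lerBrDr.
rewrite !lebesgue_measure_itv/= !lte_fin ltrD2r.
by case: ifP => // _; rewrite -!EFinB; congr (_%:E); ring.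
Qed.

Lemma measurable_shear1 (a : R) : measurable_fun setT (fun w : RR => (w.1 + a * w.2, w.2) : RR).
Proof.
apply: measurable_fun_pair => //=.
by apply: measurable_funD => //=; apply: measurable_funM => //=; exact: measurable_cst.
Qed.

Lemma measurable_shear2 (a : R) : measurable_fun setT (fun w : RR => (w.1, w.2 + a * w.1) : RR).
Proof.
apply: measurable_fun_pair => //=.
by apply: measurable_funD => //=; apply: measurable_funM => //=; exact: measurable_cst.
Qed.

Lemma ge0_integral_shear1 (a : R) (h : RR -> \bar R) :
  measurable_fun setT h -> (forall x, 0 <= h x)%E ->
  (\int[leb2]_w h ((w.1 + a * w.2)%R, w.2) = \int[leb2]_w h w)%E.
Proof.
move=> mh h0.
have ms := measurable_shear1 a.
rewrite fubini_tonelli2; [|exact: (measurableT_comp mh ms)|by move=> w; exact: h0].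
rewrite [RHS]fubini_tonelli2; [|exact: mh|exact: h0]; apply: eq_integral => y _.
rewrite /fubini_G/= (ge0_integral_shift (a * y) (f := fun x => h (x, y)))//.
exact: measurableT_comp mh (pair2_measurable y).
Qed.

Lemma ge0_integral_shear2 (a : R) (h : RR -> \bar R) :
  measurable_fun setT h -> (forall x, 0 <= h x)%E ->
  (\int[leb2]_w h (w.1, (w.2 + a * w.1)%R) = \int[leb2]_w h w)%E.
Proof.
move=> mh h0.
have ms := measurable_shear2 a.
rewrite fubini_tonelli1; [|exact: (measurableT_comp mh ms)|by move=> w; exact: h0].
rewrite [RHS]fubini_tonelli1; [|exact: mh|exact: h0]; apply: eq_integral => x _.
rewrite /fubini_F/= (ge0_integral_shift (a * x) (f := fun y => h (x, y)))//.
exact: measurableT_comp mh (pair1_measurable x).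
Qed.

(* A rotation by an angle other than pi is a product of three shears. *)
Lemma ge0_integral_rotation (c s : R) (h : RR -> \bar R) : c ^+ 2 + s ^+ 2 = 1 -> c != -1 ->
  measurable_fun setT h -> (forall x, 0 <= h x)%E ->
  (\int[leb2]_w h ((c * w.1 - s * w.2)%R, (s * w.1 + c * w.2)%R) = \int[leb2]_w h w)%E.
Proof.
move=> cs cN1 mh h0.
have c1 : 1 + c != 0 by rewrite addrC addr_eq0.
(* With c and s the cosine and sine of an angle, a is minus the tangent of half the angle. *)
pose a := - s / (1 + c).
have as_ : a * s = c - 1.
  rewrite /a mulrAC; apply: (mulIf c1); rewrite divfK//.
  have -> : - s * s = - s ^+ 2 by ring.
  have -> : s ^+ 2 = 1 - c ^+ 2 by rewrite -cs; ring.
  ring.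
have ac : a * (1 + c) = - s by rewrite /a divfK.
rewrite -[RHS](ge0_integral_shear1 a)//.
have mh1 := measurableT_comp mh (measurable_shear1 a).
rewrite -[RHS](ge0_integral_shear2 s)//=.
have mh2 := measurableT_comp mh1 (measurable_shear2 s).
rewrite -[RHS](ge0_integral_shear1 a)//=.
apply: eq_integral => -[x y] _ /=; congr (h (_, _)).
- have -> : x + a * y + a * (y + s * (x + a * y)) = x + a * s * x + (a + a + a * s * a) * y by ring.
  rewrite as_; have -> : a + a + (c - 1) * a = a * (1 + c) by ring.
  by rewrite ac; ring.
- have -> : y + s * (x + a * y) = s * x + (1 + a * s) * y by ring.
  by rewrite as_; ring.
Qed.

Lemma measurable_real_box (x0 y0 e : R) :
  measurable ([set x : measurableTypeR R | `|x - x0| < e] `*` [set y : measurableTypeR R | `|y - y0| < e]).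
Proof.
have mb (u v : R) : measurable [set x : measurableTypeR R | `|x - u| < v].
  rewrite (_ : mkset _ = `](u - v), (u + v)[%classic); first exact: measurable_itv.
  by apply/seteqP; split => x /=; rewrite in_itv/= ltr_distl.
by apply: measurableX; exact: mb.
Qed.

(** Second countability: an open set is the union of the boxes with rational centre and half-side 1
    / (n + 1) that it contains, and these are countably many. *)
Lemma measurable_open_box (O : set RR) :
  (forall w, O w -> exists2 e : R, 0 < e & forall v : RR, `|v.1 - w.1| < e -> `|v.2 - w.2| < e -> O v) ->
  measurable O.
Proof.
move=> Oo.
pose B (k : rat * rat * nat) : set RR :=
  [set x : measurableTypeR R | `|x - ratr k.1.1| < k.2.+1%:R^-1] `*`
  [set y : measurableTypeR R | `|y - ratr k.1.2| < k.2.+1%:R^-1].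
have -> : O = \bigcup_(k in [set: rat * rat * nat]) (if `[< B k `<=` O >] then B k else set0).
  have tri (a b c r e : R) : `|a - c| < r -> `|b - c| < r -> r < e / 2 -> `|a - b| < e.
    rewrite !ltr_norml => /andP[? ?] /andP[? ?] ?; apply/andP; split; lra.
  apply/seteqP; split => [w Ow|w [k _]]; last by case: asboolP => // BO /BO.
  have [e e0 He] := Oo _ Ow.
  have [n ne] : exists n : nat, (n.+1%:R^-1 : R) < e / 2.
    have e2 : 0 < e / 2 by rewrite divr_gt0.
    have [n _ /(_ n (leqnn n))] := near_infty_natSinv_lt (PosNum e2).
    by move=> h; exists n.
  have n0 : (0 : R) < n.+1%:R^-1 by rewrite invr_gt0.
  have rq (x : R) : exists q : rat, `|x - ratr q| < n.+1%:R^-1.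
    have [q] := rat_in_itvoo (ltr_pwDr n0 (lexx (x - n.+1%:R^-1 / 2))).
    rewrite in_itv/= => /andP[q1 q2]; exists q; move: (n.+1%:R^-1 : R) n0 q1 q2 => u n0 q1 q2; rewrite ltr_norml; apply/andP; split; lra.
  have [q1 Hq1] := rq w.1; have [q2 Hq2] := rq w.2.
  exists (q1, q2, n) => //; case: asboolP => [_|]; first by split.
  move=> nBO; exfalso; apply: nBO => v [/= v1 v2]; apply: He.
  - exact: tri v1 Hq1 ne.
  - exact: tri v2 Hq2 ne.
apply: countable_bigcupT_measurable => // k; case: asboolP => // _.
exact: measurable_real_box.
Qed.

Lemma measurable_fun_cont_box (D : set RR) (h : RR -> R) :
  (forall w, D w -> exists2 e : R, 0 < e & forall v : RR, `|v.1 - w.1| < e -> `|v.2 - w.2| < e -> D v) ->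
  (forall w (r : R), D w -> 0 < r -> exists2 e : R, 0 < e & forall v : RR, `|v.1 - w.1| < e -> `|v.2 - w.2| < e -> D v -> `|h v - h w| < r) ->
  measurable_fun D h.
Proof.
move=> oD ch mD; apply: (measurability _ (RGenOInfty.measurableE R)) => //.
move=> /= _ [_ [x ->] <-]; apply: measurable_open_box => w [Dw /=].
rewrite in_itv/= andbT => xw.
have [e1 e10 H1] := oD _ Dw.
have xw0 : 0 < h w - x by rewrite subr_gt0.
have [e2 e20 H2] := ch _ _ Dw xw0.
exists (Num.min e1 e2); first by rewrite lt_min e10.
move=> v; rewrite !lt_min => /andP[a1 a2] /andP[b1 b2].
have Dv := H1 _ a1 b1; split => //=; rewrite in_itv/= andbT.
have := H2 _ a2 b2 Dv; rewrite ltr_norml => /andP[+ _]; lra.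
Qed.

End plane_measure.

(** * Mean values over roots of unity *)

Section power_inequalities.
Variable R : realType.
Implicit Types (p x y : R).

(** The graph of the p-th power lies above its tangent at 1; this is Young's inequality with second
    factor 1. *)
Lemma powR_tangent p x : 1 < p -> 0 <= x -> p * x - (p - 1) <= x `^ p.
Proof.
move=> p1 x0; have p0 : 0 < p by lra.
pose q := (1 - p^-1)^-1.
have ip1 : p^-1 < 1 by rewrite invf_lt1.
have q0 : 0 < q by rewrite invr_gt0 subr_gt0.
have pq : p^-1 + q^-1 = 1 by rewrite /q invrK addrC subrK.
have := conjugate_powR x0 (ler01 : 0 <= 1) p0 q0 pq.
rewrite mulr1 powR1 mul1r /q invrK -(ler_pM2l p0) mulrDr mulrBr divff ?gt_eqF//.
by rewrite mulr1 mulrCA divff ?gt_eqF// mulr1; lra.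
Qed.

(** Sum the tangent inequality at the weighted mean m. The weights are not normalized, which
    produces the factor (sum of the weights)^(p - 1). *)
Lemma jensen_powR p n (w x : 'I_n -> R) : 1 < p -> (forall i, 0 <= w i) -> (forall i, 0 <= x i) ->
  (\sum_i w i * x i) `^ p <= (\sum_i w i) `^ (p - 1) * \sum_i w i * x i `^ p.
Proof.
move=> p1 w0 x0; have p0 : 0 < p by lra.
set a := \sum_i w i * x i; set W := \sum_i w i.
have W0 : 0 <= W by apply: sumr_ge0.
have a0 : 0 <= a by apply: sumr_ge0 => i _; rewrite mulr_ge0.
have S0 : 0 <= \sum_i w i * x i `^ p by apply: sumr_ge0 => i _; rewrite mulr_ge0 ?powR_ge0.
have [->|an0] := eqVneq a 0; first by rewrite powR0 ?gt_eqF// mulr_ge0 ?powR_ge0.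
have ap : 0 < a by rewrite lt_neqAle eq_sym an0.
have Wp : 0 < W.
  rewrite lt_neqAle W0 andbT eq_sym; apply: contra_neq an0 => W00.
  rewrite /a big1// => i _; move/eqP : W00; rewrite psumr_eq0// => /allP/(_ i).
  by rewrite mem_index_enum => /(_ isT)/eqP ->; rewrite mul0r.
pose m := a / W.
have m0 : 0 < m by rewrite divr_gt0.
have key : m `^ p * W <= \sum_i w i * x i `^ p.
  have -> : m `^ p * W = \sum_i w i * (m `^ p * (p * (x i / m) - (p - 1))).
    have -> : \sum_i w i * (m `^ p * (p * (x i / m) - (p - 1))) =
        \sum_i (m `^ p * (p / m) * (w i * x i) - m `^ p * (p - 1) * w i).
      by apply: eq_bigr => i _; ring.
    rewrite sumrB -!mulr_sumr -/a -/W.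
    have -> : m `^ p * (p / m) * a = m `^ p * p * W.
      by rewrite /m; field; rewrite !gt_eqF.
    ring.
  apply: ler_sum => i _; rewrite ler_wpM2l//.
  have xm : 0 <= x i / m by rewrite divr_ge0// ltW.
  have -> : x i `^ p = m `^ p * (x i / m) `^ p.
    by rewrite -powRM ?(ltW m0)// mulrC divfK// gt_eqF.
  by rewrite ler_wpM2l ?powR_ge0// powR_tangent.
have -> : a `^ p = W `^ (p - 1) * (m `^ p * W).
  rewrite mulrCA mulrC -[X in _ * X * _]powRr1// -powRD; last first.
    by rewrite (gt_eqF Wp) implybT.
  by rewrite subrK -powRM ?ltW// /m mulrC divfK// gt_eqF.
by rewrite ler_wpM2l ?powR_ge0.
Qed.

Lemma powR_add_le p x y : 0 < p -> 0 <= x -> 0 <= y -> (x + y) `^ p <= 2 `^ p * (x `^ p + y `^ p).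
Proof.
move=> p0 x0 y0.
wlog xy : x y x0 y0 / x <= y.
  move=> H; have [xy|yx] := leP x y; first exact: H.
  by rewrite addrC [X in _ * X]addrC H// ltW.
rewrite (@le_trans _ _ ((2 * y) `^ p))//.
  by apply: ge0_ler_powR; rewrite ?nnegrE; [exact: ltW|exact: addr_ge0|rewrite mulr_ge0|lra].
by rewrite powRM// ler_wpM2l ?powR_ge0// lerDr powR_ge0.
Qed.

End power_inequalities.

Section roots_of_unity.
Local Open Scope complex_scope.
Variable R : realType.
Implicit Types (t : R) (z w : R[i]).

Lemma cisD t u : cis (t + u) = cis t * cis u.
Proof. by rewrite /cis cosD sinD; congr (_ +i* _); ring. Qed.

Lemma cis0 : cis (0 : R) = 1.
Proof. by rewrite /cis cos0 sin0. Qed.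

Lemma cis_muln t n : cis (t *+ n) = cis t ^+ n.
Proof.
by elim: n => [|n IH]; rewrite ?mulr0n ?cis0 ?expr0// mulrS cisD IH exprS.
Qed.

Lemma normc_cis t : normc (cis t) = 1.
Proof. by rewrite /cis/= cos2Dsin2 sqrtr1. Qed.

Lemma cis_neq1 t : 0 < t < pi *+ 2 -> cis t != 1.
Proof.
move=> /andP[t0 t2]; apply/eqP => -[ct _].
have : 0 < sin (t / 2) by apply: sin_gt0_pi; move: t2; rewrite mulr2n; lra.
have := cos_mulr2n (t / 2); rewrite -[_ *+ 2](_ : t = _); last by rewrite -mulr_natr; field.
rewrite ct cos2sin2 => h s0.
have : 0 < sin (t / 2) ^+ 2 by rewrite exprn_gt0.
move: h; rewrite mulr2n; lra.
Qed.

Definition rootu n j : R[i] := cis (pi *+ 2 * j%:R / n%:R).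

Lemma rootuX n j k : rootu n j ^+ k = rootu n k ^+ j.
Proof.
rewrite /rootu -!cis_muln; congr cis.
by rewrite -[LHS]mulr_natr -[RHS]mulr_natr; ring.
Qed.

Lemma rootu_n n j : (0 < n)%N -> rootu n j ^+ n = 1.
Proof.
move=> n0; rewrite /rootu -cis_muln.
rewrite -[X in cis X]mulr_natr divfK ?pnatr_eq0 -?lt0n//.
by rewrite [X in cis X]mulr_natr cis_muln {1}/cis cos2pi sin2pi expr1n.
Qed.

Lemma rootu_neq1 n k : (0 < k < n)%N -> rootu n k != 1.
Proof.
move=> /andP[k0 kn]; apply: cis_neq1.
have pi0 : 0 < (pi : R) *+ 2 by rewrite pmulrn_lgt0 ?pi_gt0.
have n0 : 0 < n%:R :> R by rewrite ltr0n (ltn_trans k0).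
apply/andP; split; first by rewrite divr_gt0// mulr_gt0// ltr0n.
by rewrite ltr_pdivrMr// ltr_pM2l// ltr_nat.
Qed.

Lemma sum_rootu n k : (0 < k < n)%N -> \sum_(j < n) rootu n j ^+ k = 0.
Proof.
move=> kn; have n0 : (0 < n)%N by case/andP: kn => /ltn_trans; exact.
have := rootu_neq1 kn; rewrite -subr_eq0 => nz.
apply: (mulfI nz); rewrite mulr0.
rewrite (eq_bigr (fun j : 'I_n => rootu n k ^+ j)); last by move=> j _; rewrite rootuX.
by rewrite -subrX1 rootu_n// subrr.
Qed.

(** In the binomial expansion only the zeroth power of the root survives the sum, since all
    exponents are below n. *)
Lemma mean_rootu_pow n k z w : (k < n)%N ->
  \sum_(j < n) (z + rootu n j * w) ^+ k = n%:R * z ^+ k.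
Proof.
move=> kn; under eq_bigr do rewrite exprDn.
rewrite exchange_big big_ord_recl/=.
rewrite [X in _ + X]big1 ?addr0 => [|i _].
  rewrite (eq_bigr (fun=> z ^+ k)) => [|j _]; last by rewrite subn0 expr0 mulr1 bin0.
  by rewrite sumr_const card_ord mulr_natl.
rewrite /bump/= add1n.
rewrite (eq_bigr (fun j : 'I_n => (z ^+ (k - i.+1) * w ^+ i.+1 *+ 'C(k, i.+1)) * rootu n j ^+ i.+1)).
  by rewrite -mulr_sumr sum_rootu ?mulr0//= (leq_ltn_trans _ kn).
by move=> j _; rewrite exprMn mulrnAl; congr (_ *+ _); ring.
Qed.

Lemma mean_rootu_poly n (a : nat -> R[i]) z w :
  \sum_(j < n) power_series a (z + rootu n j * w) n = n%:R * power_series a z n.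
Proof.
rewrite /power_series/series/=.
rewrite exchange_big/= mulr_sumr big_nat [RHS]big_nat.
apply: eq_bigr => k /andP[_ kn].
by rewrite -mulr_sumr mean_rootu_pow// mulrCA.
Qed.

(** The mean value identity is exact for the Taylor polynomial. Its tail is paid twice: once at the
    centre and once, on average, at the n points of the circle. *)
Lemma mean_rootu_le n (f : R[i] -> R[i]) a r z w : (0 < n)%N -> has_expansion f a -> r < 1 ->
  normc z + normc w <= r ->
  normc (f z) <= (limn (abs_series a r) - abs_series a r n) *+ 2 +
    \sum_(j < n) n%:R^-1 * normc (f (z + rootu n j * w)).
Proof.
move=> n0 fa r1 zwr; set T := limn _ - _.
have n0' : (n%:R : R) != 0 by rewrite pnatr_eq0 -lt0n.
have zr : normc z <= r by rewrite (le_trans _ zwr)// lerDl normc_ge0.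
have jr j : normc (z + rootu n j * w) <= r.
  by rewrite (le_trans (le_normcD _ _))// normcM normc_cis mul1r.
have h1 := expansion_tail n fa r1 zr; rewrite -/T in h1.
have h2 : normc (power_series a z n) <= T + \sum_(j < n) n%:R^-1 * normc (f (z + rootu n j * w)).
  have -> : normc (power_series a z n) = n%:R^-1 * normc (\sum_(j < n) power_series a (z + rootu n j * w) n).
    have nn : normc (n%:R : R[i]) = n%:R by rewrite -(rmorph_nat (real_complex R)) normc_real_ge0.
    by rewrite mean_rootu_poly normcM nn mulKf.
  have -> : T = \sum_(j < n) n%:R^-1 * T.
    by rewrite -mulr_sumr sumr_const card_ord -[T *+ n]mulr_natl mulKf.
  rewrite -mulr_sumr -mulr_sumr -mulrDr ler_wpM2l ?invr_ge0//.
  rewrite -big_split/=; apply: le_trans (normc_sum _ _ _) _; apply: ler_sum => j _.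
  have := expansion_tail n fa r1 (jr j); rewrite -/T normcBC.
  have := ler_normcB (power_series a (z + rootu n j * w) n) (f (z + rootu n j * w)); lra.
have := ler_normcB (f z) (power_series a z n); rewrite mulr2n; lra.
Qed.

End roots_of_unity.

Section analytic_functions.
Local Open Scope complex_scope.
Variable R : realType.

Lemma analytic_continuous (f : R[i] -> R[i]) z e : analytic f -> disc 1 z -> 0 < e ->
  exists2 d : R, 0 < d & forall v, normc (v - z) < d -> normc (f v - f z) < e.
Proof.
move=> af /af /derivable1_diffP /differentiable_continuous /cvgrPdist_lt fc e0.
have ec : 0 < e%:C by rewrite ltcR.
have /fc := ec.
move/nbhs_normP => [[d di]] /=; rewrite ltcE/= => /andP[/eqP -> d0] H.
exists d => // v vz.
have := H v; rewrite /ball_/= => H1.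
have : `|z - v| < d%:C by change ((normc (z - v))%:C < d%:C); rewrite ltcR normcBC.
move/H1; rewrite distrC; change (`|f v - f z|) with ((normc (f v - f z))%:C).
by rewrite ltcR.
Qed.

Lemma analyticB (f g : R[i] -> R[i]) : analytic f -> analytic g -> analytic (fun z => f z - g z).
Proof. by move=> af ag z z1; apply: derivableB; [exact: af|exact: ag]. Qed.

End analytic_functions.

(** * The sub-mean value inequality for |f|^p over discs *)

Section submean.
Local Open Scope complex_scope.
Variable R : realType.
Local Notation leb := (@lebesgue_measure R).
Local Notation leb2 := (leb \x leb)%E.
Local Notation RR := (measurableTypeR R * measurableTypeR R)%type.
Implicit Types (z : R[i]) (r : R).

Definition plane_disc z r : set RR := [set w | normc ((w.1 +i* w.2) - z) < r].

Lemma box_dist (v w : RR) (e : R) : `|v.1 - w.1| < e -> `|v.2 - w.2| < e ->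
  normc ((v.1 +i* v.2) - (w.1 +i* w.2)) < e *+ 2.
Proof.
move=> h1 h2; apply: le_lt_trans (normc_le_ReIm _) _ => /=.
by rewrite mulr2n; exact: ltrD.
Qed.

Lemma plane_disc0 r w : plane_disc 0 r w = (normc (w.1 +i* w.2) < r) :> Prop.
Proof. by rewrite /plane_disc /mkset subr0. Qed.

Lemma plane_disc_open z r w : plane_disc z r w -> exists2 e : R, 0 < e &
  forall v : RR, `|v.1 - w.1| < e -> `|v.2 - w.2| < e -> plane_disc z r v.
Proof.
rewrite /plane_disc/= => wr; exists ((r - normc ((w.1 +i* w.2) - z)) / 2).
  by rewrite divr_gt0// subr_gt0.
move=> v h1 h2; have := box_dist h1 h2.
have := normc_tri (w.1 +i* w.2) (v.1 +i* v.2) z; rewrite mulr2n; lra.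
Qed.

Lemma measurable_plane_disc z r : measurable (plane_disc z r).
Proof. by apply: measurable_open_box => w; exact: plane_disc_open. Qed.

Lemma box_measure (x0 y0 e : R) : 0 < e ->
  leb2 ([set x : measurableTypeR R | `|x - x0| < e] `*` [set y : measurableTypeR R | `|y - y0| < e]) =
  ((e *+ 2) ^+ 2)%:E.
Proof.
move=> e0.
have bE (u : R) : [set x : measurableTypeR R | `|x - u| < e] = `](u - e), (u + e)[%classic.
  by apply/seteqP; split => x /=; rewrite in_itv/= ltr_distl.
rewrite !bE product_measure1E; [|exact: measurable_itv|exact: measurable_itv].
have mE (u : R) : leb `](u - e), (u + e)[%classic = (e *+ 2)%:E.
  rewrite lebesgue_measure_itv/= lte_fin ifT; last by lra.
  by rewrite -EFinB; congr _%:E; ring.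
by transitivity ((e *+ 2)%:E * (e *+ 2)%:E)%E; [congr (_ * _)%E; exact: mE|rewrite -EFinM expr2].
Qed.

(** Only the order of magnitude of the area of a disc matters, so circumscribed and inscribed
    squares are enough. *)
Lemma plane_disc_le z r : 0 < r -> (leb2 (plane_disc z r) <= ((r *+ 2) ^+ 2)%:E)%E.
Proof.
move=> r0; rewrite -(box_measure (Re z) (Im z) r0).
apply: le_measure; rewrite ?inE; [exact: measurable_plane_disc|exact: measurable_real_box|].
case: z => x y [u v] /= uv; split => /=.
- exact: le_lt_trans (normc_Re ((u - x) +i* (v - y))) uv.
- exact: le_lt_trans (normc_Im ((u - x) +i* (v - y))) uv.
Qed.

Lemma plane_disc_ge z r : 0 < r -> ((r ^+ 2)%:E <= leb2 (plane_disc z r))%E.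
Proof.
move=> r0; have r2 : 0 < r / 2 by rewrite divr_gt0.
have -> : r ^+ 2 = (r / 2 *+ 2) ^+ 2 by rewrite mulr2n -splitr.
rewrite -(box_measure (Re z) (Im z) r2).
apply: le_measure; rewrite ?inE; [exact: measurable_real_box|exact: measurable_plane_disc|].
move=> w [/= h1 h2]; have := @box_dist w (Re z, Im z) _ h1 h2.
by rewrite mulr2n -splitr; case: z {h1 h2}.
Qed.

Lemma ge0_integral_shift2 (x0 y0 : R) (h : RR -> \bar R) :
  measurable_fun setT h -> (forall x, 0 <= h x)%E ->
  (\int[leb2]_w h ((w.1 + x0)%R, (w.2 + y0)%R) = \int[leb2]_w h w)%E.
Proof.
move=> mh h0.
have ms (u v : R) : measurable_fun setT (fun w : RR => (w.1 + u, w.2 + v) : RR).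
  by apply: measurable_fun_pair => /=; apply: measurable_funD => //; exact: measurable_cst.
have mhs u v := measurableT_comp mh (ms u v).
transitivity (\int[leb2]_w h ((w.1 + x0)%R, w.2))%E.
  have m0 := mhs x0 0.
  have {}m0 : measurable_fun setT (fun w : RR => h ((w.1 + x0)%R, w.2)).
    by apply: eq_measurable_fun m0 => w _ /=; rewrite addr0.
  rewrite fubini_tonelli1; [|exact: (mhs x0 y0)|by move=> w; exact: h0].
  rewrite fubini_tonelli1; [|exact: m0|by move=> w; exact: h0].
  apply: eq_integral => x _.
  rewrite /fubini_F/= (ge0_integral_shift y0 (f := fun y => h ((x + x0)%R, y)))//.
  exact: measurableT_comp mh (pair1_measurable _).
have m0 : measurable_fun setT (fun w : RR => h ((w.1 + x0)%R, w.2)).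
  by apply: eq_measurable_fun (mhs x0 0) => w _ /=; rewrite addr0.
rewrite fubini_tonelli2; [|exact: m0|by move=> w; exact: h0].
rewrite fubini_tonelli2; [|exact: mh|by move=> w; exact: h0].
apply: eq_integral => y _.
rewrite /fubini_G/= (ge0_integral_shift x0 (f := fun x => h (x, y)))//.
exact: measurableT_comp mh (pair2_measurable _).
Qed.

Lemma measurable_rotation (c s : R) :
  measurable_fun setT (fun w : RR => (c * w.1 - s * w.2, s * w.1 + c * w.2) : RR).
Proof.
apply: measurable_fun_pair => /=.
- apply: measurable_funB; apply: measurable_funM => //; exact: measurable_cst.
- apply: measurable_funD; apply: measurable_funM => //; exact: measurable_cst.
Qed.

Lemma ge0_integral_cis (t : R) (h : RR -> \bar R) :
  measurable_fun setT h -> (forall x, 0 <= h x)%E ->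
  (\int[leb2]_w h ((cos t * w.1 - sin t * w.2)%R, (sin t * w.1 + cos t * w.2)%R) = \int[leb2]_w h w)%E.
Proof.
move=> mh h0; have cs := cos2Dsin2 t.
(* The half turn, which the shear factorization excludes, is the quarter turn applied twice. *)
have [c1|c1] := eqVneq (cos t) (-1); last exact: ge0_integral_rotation.
have s0 : sin t = 0.
  by apply/eqP; rewrite -sqrf_eq0; move: cs; rewrite c1 sqrrN expr1n => /eqP; rewrite addrC eq_sym -subr_eq subrr eq_sym.
have cs1 : (0 : R) ^+ 2 + 1 ^+ 2 = 1 by rewrite expr0n expr1n add0r.
have c01 : (0 : R) != -1 by rewrite eq_sym oppr_eq0 oner_eq0.
have m1 := measurableT_comp mh (measurable_rotation 0 1).
rewrite -[RHS](ge0_integral_rotation cs1 c01 mh h0).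
rewrite -[RHS](ge0_integral_rotation cs1 c01 m1); last by move=> w; exact: h0.
apply: eq_integral => w _ /=; rewrite c1 s0; congr (h (_, _)); ring.
Qed.

Lemma measurable_normc_pow (f : R[i] -> R[i]) z r p : 0 < p -> analytic f ->
  (forall w, normc (w - z) < r -> normc w < 1) ->
  measurable_fun (plane_disc z r) (fun w : RR => (normc (f (w.1 +i* w.2)) `^ p)%:E).
Proof.
move=> p0 af zr; apply/measurable_EFinP.
apply: (@measurableT_comp _ _ _ _ _ _ (fun x => x `^ p)).
  exact: measurable_powR.
apply: measurable_fun_cont_box => [w|w e Dw e0]; first exact: plane_disc_open.
have [d d0 H] := analytic_continuous af (zr _ Dw) e0.
exists (d / 2); first by rewrite divr_gt0.
move=> v h1 h2 _; have := box_dist h1 h2; rewrite mulr2n -splitr => /H.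
have := ler_normcB (f (v.1 +i* v.2)) (f (w.1 +i* w.2)).
have := ler_normcB (f (w.1 +i* w.2)) (f (v.1 +i* v.2)).
rewrite (normcBC (f (w.1 +i* w.2))) => ? ? ?; rewrite ltr_norml; apply/andP; split; lra.
Qed.

(** The inequality over n roots of unity is raised to the power p by Jensen and integrated over the
    disc. Each rotated copy has the same integral, so the mean over the roots disappears. The factor
    2^p is the price of splitting off the truncation error, which vanishes as n grows. *)
Lemma submean (f : R[i] -> R[i]) a z r p : 1 < p -> analytic f -> has_expansion f a ->
  0 < r -> normc z + r < 1 ->
  ((normc (f z) `^ p * r ^+ 2)%:E <= (2 `^ p)%:E *
   \int[leb2]_(w in plane_disc z r) (normc (f (w.1 +i* w.2)) `^ p)%:E)%E.
Proof.
move=> p1 af fa r0 zr1.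
have p0 : 0 < p by lra.
have zr w : normc (w - z) < r -> normc w < 1.
  by move=> h; have := le_normcD (w - z) z; rewrite subrK; lra.
have mf := measurable_normc_pow p0 af zr.
set I := (X in (_ <= _ * X)%E).
have I0 : (0 <= I)%E by apply: integral_ge0 => w _; rewrite lee_fin powR_ge0.
(* The integrand moved to the origin and extended by 0, so that rotations about 0 act on it. *)
pose G := (fun w : RR => (normc (f ((w.1 +i* w.2) + z)) `^ p)%:E) \_ (plane_disc 0 r).
pose G1 := (fun w : RR => (normc (f (w.1 +i* w.2)) `^ p)%:E) \_ (plane_disc z r).
have mG1 : measurable_fun setT G1.
  by apply/(measurable_restrictT _ _).1 => //; exact: measurable_plane_disc.
have G10 w : (0 <= G1 w)%E by apply: erestrict_ge0 => ? _; rewrite lee_fin powR_ge0.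
have GE w : G w = G1 ((w.1 + Re z)%R, (w.2 + Im z)%R).
  have zw : (w.1 + Re z) +i* (w.2 + Im z) = (w.1 +i* w.2) + z by case: (z).
  have DE : (w \in plane_disc 0 r) = (((w.1 + Re z, w.2 + Im z) : RR) \in plane_disc z r).
    have DP : (normc ((w.1 +i* w.2) - 0) < r) = (normc (((w.1 + Re z) +i* (w.2 + Im z)) - z) < r).
      by rewrite zw addrK subr0.
    apply/idP/idP => /set_mem h; apply/mem_set.
      by have h1 : normc ((w.1 +i* w.2) - 0) < r := h; rewrite DP in h1; exact: h1.
    have h1 : normc (((w.1 + Re z) +i* (w.2 + Im z)) - z) < r := h.
    by rewrite -DP in h1; exact: h1.
  by rewrite /G /G1 !patchE DE/= zw.
have mG : measurable_fun setT G.
  have ms : measurable_fun setT (fun w : RR => (w.1 + Re z, w.2 + Im z) : RR).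
    by apply: measurable_fun_pair => /=; apply: measurable_funD => //; exact: measurable_cst.
  by apply: eq_measurable_fun (measurableT_comp mG1 ms) => w _; rewrite GE.
have G0 w : (0 <= G w)%E by rewrite GE.
have IE : I = (\int[leb2]_w G w)%E.
  rewrite /I integral_mkcond -/G1 -(ge0_integral_shift2 (Re z) (Im z) mG1 G10).
  by apply: eq_integral => w _; rewrite GE.
set A := leb2 (plane_disc 0 r).
have Afin : A \is a fin_num.
  rewrite ge0_fin_numE ?measure_ge0//.
  by apply: le_lt_trans (plane_disc_le _ r0) _; rewrite ltry.
have Age : ((r ^+ 2)%:E <= A)%E by exact: plane_disc_ge.
set s := (normc z + r); have s0 : 0 <= s by rewrite addr_ge0 ?normc_ge0// ltW.
suff H e : 0 < e -> ((normc (f z) `^ p)%:E * A <= (2 `^ p)%:E * (e%:E + I))%E.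
  apply: (@le_trans _ _ ((normc (f z) `^ p)%:E * A)%E).
    by rewrite EFinM; apply: lee_wpmul2l => //; rewrite lee_fin powR_ge0.
  have [Ioo|Ifin] := eqVneq I +oo%E.
    by rewrite Ioo gt0_muley ?leey// lte_fin powR_gt0.
  have If : I \is a fin_num by rewrite ge0_fin_numE// ltey.
  rewrite -lee_pdivrMl ?powR_gt0//; apply/lee_addgt0Pr => e e0.
  by rewrite lee_pdivrMl ?powR_gt0// addeC; exact: H.
move=> e0.
have A0 : 0 <= fine A by rewrite fine_ge0// measure_ge0.
(* n is taken so large that the truncation error, integrated over the disc, is at most e. *)
have [n n0 Hn] : exists2 n : nat, (0 < n)%N &
    ((limn (abs_series a s) - abs_series a s n) *+ 2) `^ p * fine A <= e.
  have cT : cvgn (abs_series a s) by apply: (expansion_abs_cvg fa); rewrite s0.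
  pose d := (e / (fine A + 1)) `^ p^-1.
  have d0 : 0 < d by rewrite powR_gt0// divr_gt0// ltr_pwDr.
  have d2 : 0 < d / 2 by rewrite divr_gt0.
  have /cvgrPdist_lt/(_ _ d2)[N _ HN] := cvg_series_tail cT.
  exists N.+1 => //; have := HN N.+1 (leqnSn N); rewrite /= sub0r normrN.
  set T := (limn _ - _) => hT.
  have T0 : 0 <= T.
    rewrite subr_ge0; apply: nondecreasing_cvgn_le => //; apply: nondecreasing_series => k _.
    by rewrite mulr_ge0 ?normc_ge0 ?exprn_ge0.
  have half (x y : R) : x < y / 2 -> x *+ 2 <= y by move=> ?; rewrite mulr2n; lra.
  have Td : T *+ 2 <= d by apply: half; rewrite ger0_norm in hT.
  have : (T *+ 2) `^ p <= d `^ p.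
    by apply: ge0_ler_powR; rewrite ?nnegrE; [exact: ltW|exact: mulrn_wge0|exact: ltW|].
  rewrite /d -powRrM mulVf ?gt_eqF// powRr1; last by rewrite divr_ge0 ?ltW// ltr_pwDr.
  move=> h; apply: (@le_trans _ _ (e / (fine A + 1) * fine A)); first by rewrite ler_wpM2r.
  rewrite mulrAC ler_pdivrMr ?ltr_pwDr//; rewrite ler_wpM2l ?ltW//; lra.
set T2 := (_ *+ 2) in Hn.
have T20 : 0 <= T2.
  apply: mulrn_wge0; rewrite subr_ge0; apply: nondecreasing_cvgn_le.
    by apply: nondecreasing_series => k _; rewrite mulr_ge0 ?normc_ge0 ?exprn_ge0.
  by apply: (expansion_abs_cvg fa); rewrite s0.
pose Rj (j : nat) (w : RR) : RR := let t := (pi *+ 2 * j%:R / n%:R) in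
  (cos t * w.1 - sin t * w.2, sin t * w.1 + cos t * w.2).
have pw w : plane_disc 0 r w -> ((normc (f z) `^ p)%:E <=
    (2 `^ p)%:E * ((T2 `^ p)%:E + \sum_(j < n) (n%:R^-1)%:E * G (Rj j w)))%E.
  move=> Dw.
  have wr : normc z + normc (w.1 +i* w.2) <= s by rewrite /s lerD2l ltW// -plane_disc0.
  have jw j : (Rj j w).1 +i* (Rj j w).2 = rootu R n j * (w.1 +i* w.2).
    by congr (_ +i* _); exact: addrC.
  have DR j : plane_disc 0 r (Rj j w).
    by rewrite plane_disc0 jw normcM normc_cis mul1r -plane_disc0.
  have GR j : G (Rj j w) = (normc (f (z + rootu R n j * (w.1 +i* w.2))) `^ p)%:E.
    by rewrite /G patchE mem_set// jw addrC.
  under eq_bigr do rewrite GR -EFinM.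
  rewrite sumEFin -EFinD -EFinM lee_fin.
  have := mean_rootu_le n0 fa zr1 wr; rewrite -/T2 => h.
  have S0 : 0 <= \sum_(j < n) n%:R^-1 * normc (f (z + rootu R n j * (w.1 +i* w.2))).
    by apply: sumr_ge0 => j _; rewrite mulr_ge0 ?normc_ge0.
  apply: (@le_trans _ _ ((T2 + \sum_(j < n) n%:R^-1 * normc (f (z + rootu R n j * (w.1 +i* w.2)))) `^ p)).
    by apply: ge0_ler_powR; rewrite ?nnegrE; [exact: ltW|exact: normc_ge0|exact: addr_ge0|exact: h].
  apply: le_trans (powR_add_le p0 T20 S0) _.
  rewrite ler_wpM2l ?powR_ge0// lerD2l.
  have := @jensen_powR _ p n (fun=> n%:R^-1) (fun j => normc (f (z + rootu R n j * (w.1 +i* w.2)))) p1.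
  rewrite sumr_const card_ord -[n%:R^-1 *+ n]mulr_natr mulVf ?pnatr_eq0 -?lt0n// powR1 mul1r.
  by apply => j; rewrite ?invr_ge0 ?normc_ge0.
have mR j : measurable_fun setT (fun w => G (Rj j w)).
  exact: (measurableT_comp mG (measurable_rotation _ _)).
have mD := measurable_plane_disc 0 r.
have -> : ((normc (f z) `^ p)%:E * A = \int[leb2]_(w in plane_disc 0%R r) (normc (f z) `^ p)%:E)%E.
  by rewrite integral_cst.
have msum : measurable_fun setT (fun w : RR => (\sum_(j < n) (n%:R^-1)%:E * G (Rj j w))%E).
  apply: emeasurable_sum => j; apply: emeasurable_funM; [exact: measurable_cst|exact: mR].
have sum0 w : (0 <= \sum_(j < n) (n%:R^-1)%:E * G (Rj j w))%E.
  by apply: sume_ge0 => j _; rewrite mule_ge0// lee_fin.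
apply: (@le_trans _ _ (\int[leb2]_(w in plane_disc 0%R r) ((2 `^ p)%:E * ((T2 `^ p)%:E + \sum_(j < n) (n%:R^-1)%:E * G (Rj j w))))%E).
  apply: ge0_le_integral_nomeas.
  - by move=> w _; rewrite lee_fin powR_ge0.
  - by move=> w _; rewrite mule_ge0// ?adde_ge0// lee_fin powR_ge0.
  - by move=> w Dw; split => //; exact: pw.
rewrite ge0_integralZl//; last 2 first.
- by apply: emeasurable_funD; [exact: measurable_cst|exact: measurable_funTS].
- by move=> w _; rewrite adde_ge0// lee_fin powR_ge0.
apply: lee_wpmul2l; first by rewrite lee_fin powR_ge0.
rewrite ge0_integralD//; last 2 first.
- by move=> w _; rewrite lee_fin powR_ge0.
- exact: measurable_funTS.
apply: leeD.
  by rewrite integral_cst//= -/A -(fineK Afin) -EFinM lee_fin.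
apply: (@le_trans _ _ (\int[leb2]_w (\sum_(j < n) (n%:R^-1)%:E * G (Rj j w)))%E).
  exact: ge0_le_integral_nomeas.
rewrite ge0_integral_sum//; last 2 first.
- by move=> j; apply: emeasurable_funM; [exact: measurable_cst|exact: mR].
- by move=> j w _; rewrite mule_ge0// lee_fin.
rewrite (eq_bigr (fun=> (n%:R^-1)%:E * I)%E) => [|j _]; last first.
  rewrite ge0_integralZl//.
  by rewrite IE -(ge0_integral_cis (pi *+ 2 * j%:R / n%:R) mG G0).
by rewrite -ge0_sume_distrl// sumEFin sumr_const card_ord -[n%:R^-1 *+ n]mulr_natr mulVf ?mul1e// pnatr_eq0 -lt0n.
Qed.

End submean.

(** * Tent regions *)

Section trigonometric_bounds.
Local Open Scope complex_scope.
Variable R : realType.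
Implicit Types x y t : R.

Lemma sin_le_id x : 0 <= x -> sin x <= x.
Proof.
rewrite le_eqVlt => /predU1P[<-|x0]; first by rewrite sin0.
have [c _] := @MVT R (@sin R) (@cos R) 0 x x0 (fun y _ => is_derive_sin y)
  (continuous_subspaceT (@continuous_sin R)).
by rewrite sin0 !subr0 => ->; rewrite ler_piMl ?(ltW x0) ?cos_le1.
Qed.

Lemma norm_sin_le x : `|sin x| <= `|x|.
Proof.
wlog x0 : x / 0 <= x.
  move=> H; have [/H//|/ltW x0] := leP 0 x.
  by rewrite -normrN -sinN -[leRHS]normrN; apply: H; rewrite oppr_ge0.
have [xpi|xpi] := leP x pi.
  by rewrite !ger0_norm ?sin_ge0_pi ?x0// sin_le_id.
rewrite (le_trans (sin_max _))// ger0_norm//.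
have := @pi_ge2 R; lra.
Qed.

Lemma normc_cisB x y : normc (cis x - cis y) = `|sin ((x - y) / 2)| *+ 2.
Proof.
have h0 : 0 <= `|sin ((x - y) / 2)| *+ 2 by rewrite mulrn_wge0.
apply/eqP; rewrite -(eqrXn2 (ltn0Sn 1) (normc_ge0 _) h0); apply/eqP.
rewrite sqr_normcE /= exprMn_n real_normK ?num_real//.
have hx : (x - y) / 2 *+ 2 = x - y by rewrite mulr2n -splitr.
have := cos_mulr2n ((x - y) / 2); rewrite hx cos2sin2 cosB => h.
have hx1 := cos2Dsin2 x; have hy1 := cos2Dsin2 y.
have -> : (cos x - cos y) ^+ 2 + (sin x - sin y) ^+ 2 =
  (cos x ^+ 2 + sin x ^+ 2) + (cos y ^+ 2 + sin y ^+ 2) - (cos x * cos y + sin x * sin y) *+ 2 by ring.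
by rewrite hx1 hy1 h; ring.
Qed.

Lemma cis_lipschitz x y : normc (cis x - cis y) <= `|x - y|.
Proof.
rewrite normc_cisB; apply: le_trans (_ : `|(x - y) / 2| *+ 2 <= _).
  by rewrite lerMn2r norm_sin_le orbT.
by rewrite normrM [X in _ * X]ger0_norm// mulr2n -splitr.
Qed.

(** A crude Jordan inequality. Up to 1/2 the derivative is at least 1/2; beyond, monotonicity gives
    sin x >= 1/4, and x < 2. *)
Lemma sin_lower x : 0 <= x <= pi / 2 -> x / 8 <= sin x.
Proof.
move=> /andP[x0 x2].
have pih := @pihalf_ge1 R; have pih2 := @pihalf_lt2 R.
(* From 2 cos(1/2)^2 = 1 + cos 1 and cos 1 > 0. *)
have ch : 1 / 2 <= cos (1 / 2 : R).
  have h := cos_mulr2n (1 / 2 : R); rewrite [_ *+ 2]mulr2n -splitr in h.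
  have h1 := @cos1_gt0 R.
  have h2 : 0 <= cos (1 / 2 : R) by apply: cos_ge0_pihalf; apply/andP; split; lra.
  have : (1 / 2) ^+ 2 <= cos (1 / 2 : R) ^+ 2 by move: h; rewrite mulr2n; lra.
  by rewrite ler_sqr ?nnegrE//; lra.
have half y : 0 <= y <= 1 / 2 -> y / 2 <= sin y.
  move=> /andP[y0 y1].
  move: y0; rewrite le_eqVlt => /predU1P[<-|y0]; first by rewrite mul0r sin0.
  have [c] := @MVT R (@sin R) (@cos R) 0 y y0 (fun y _ => is_derive_sin y)
    (continuous_subspaceT (@continuous_sin R)).
  rewrite in_itv/= => /andP[c0 cx]; rewrite sin0 !subr0 => ->.
  have cc : cos (1 / 2) <= cos c.
    by rewrite leNgt ltr_cos ?in_itv/= -?leNgt; [lra|apply/andP; split; lra|apply/andP; split; lra].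
  by rewrite mulrC ler_wpM2r ?(ltW y0)//; lra.
have [x1|x1] := leP x (1 / 2).
  by have := half x; rewrite x0 x1 => /(_ isT); lra.
have := half (1 / 2); rewrite lexx divr_ge0// => /(_ isT) h2.
have : sin (1 / 2) < sin x.
  by rewrite ltr_sin// in_itv/=; apply/andP; split; lra.
lra.
Qed.

End trigonometric_bounds.

Section gamma.
Local Open Scope complex_scope.
Variable R : realType.
Implicit Types (z xi : R[i]).

(** The points (1 - s) w + s xi with |w| < 1/2 fill the disc of radius (1 - s) / 2 around s xi. *)
Lemma Gamma_halfI (s : R) z xi : 0 <= s < 1 -> normc (z - s%:C * xi) < (1 - s) / 2 ->
  Gamma_half xi z.
Proof.
move=> /andP[s0 s1] h; have s1' : 0 < 1 - s by rewrite subr_gt0.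
have cs : (1 - s)%:C != 0 by rewrite eq_complex/= eqxx andbT gt_eqF.
right; exists ((1 - s)%:C^-1 * (z - s%:C * xi)).
  by rewrite /disc /mkset normcM normcV normc_real_ge0 ?(ltW s1')// mulrC ltr_pdivrMr// [X in _ < X]mulrC.
exists s; first by rewrite /= in_itv/= s0.
by rewrite mulVKf// subrK.
Qed.

(** The tent is nontangential: for z = (1 - s) w + s xi one has 1 - |z| >= (1 - s) / 2 and |z - xi|
    <= 3 (1 - s) / 2. *)
Lemma Gamma_halfE z xi : normc xi = 1 -> Gamma_half xi z ->
  normc z < 1 /\ normc (z - xi) <= 3 * (1 - normc z).
Proof.
move=> xi1.
suff H w s : normc w < 2^-1 -> 0 <= s < 1 -> z = (1 - s)%:C * w + s%:C * xi ->
    normc z < 1 /\ normc (z - xi) <= 3 * (1 - normc z).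
  case=> [z2|[w w2 [s]]]; last by rewrite /= in_itv/= => s01 /esym; exact: H.
  apply: (H z 0) => //; first by rewrite lexx ltr01.
  by rewrite subr0 mul1r mul0r addr0.
move=> w2 /andP[s0 s1] ->; have s1' : 0 < 1 - s by rewrite subr_gt0.
have h1 : normc ((1 - s)%:C * w + s%:C * xi) <= (1 - s) * normc w + s.
  apply: le_trans (le_normcD _ _) _.
  by rewrite !normcM xi1 mulr1 !normc_real_ge0// ltW.
have h2 : normc ((1 - s)%:C * w + s%:C * xi - xi) <= (1 - s) * (normc w + 1).
  have -> : (1 - s)%:C * w + s%:C * xi - xi = (1 - s)%:C * (w - xi).
    by rewrite rmorphB/= rmorph1; ring.
  rewrite normcM normc_real_ge0 ?(ltW s1')// ler_wpM2l ?(ltW s1')//.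
  by apply: le_trans (le_normcD _ _) _; rewrite normcN xi1.
have h3 : (1 - s) * normc w <= (1 - s) * 2^-1 by rewrite ler_wpM2l// ltW.
split; first lra.
apply: le_trans h2 _; rewrite mulrDr; lra.
Qed.

End gamma.

(** * Lower bounds of the norm by values in tents over arcs *)

Section lower_bounds.
Local Open Scope complex_scope.
Variables (R : realType) (p q : R).
Hypotheses (p1 : 1 < p) (q1 : 1 < q).
Local Notation leb := (@lebesgue_measure R).
Local Notation leb2 := (leb \x leb)%E.
Implicit Types (f : R[i] -> R[i]).

Let p0 : 0 < p. Proof. exact: lt_trans ltr01 p1. Qed.
Let q0 : 0 < q. Proof. exact: lt_trans ltr01 q1. Qed.

Definition tent_integral f (t : R) : \bar R :=
  area_integral (Gamma_half (cis t))
    (fun z => (normc (f z) `^ p / (1 - normc z ^+ 2))%:E).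

Lemma density_ge0 f t z : Gamma_half (cis t) z ->
  0 <= normc (f z) `^ p / (1 - normc z ^+ 2).
Proof.
move=> /(Gamma_halfE (normc_cis t))[z1 _].
rewrite divr_ge0 ?powR_ge0// subr_ge0 -(expr1n _ 2).
by rewrite ler_sqr ?nnegrE ?normc_ge0// ltW.
Qed.

Lemma tent_integral_ge0 f t : (0 <= tent_integral f t)%E.
Proof.
rewrite /tent_integral /area_integral mule_ge0//.
  by rewrite lee_fin invr_ge0 pi_ge0.
by apply: integral_ge0 => w /= /density_ge0 h; rewrite lee_fin.
Qed.

Lemma AT_normqE f : (AT_norm p q f `^ q =
  \int[leb]_(t in `[0%R, (pi *+ 2)%R]) (tent_integral f t `^ (q / p)))%E.
Proof.
rewrite /AT_norm -poweRrM mulVf ?(gt_eqF q0)// poweRe1//.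
by apply: integral_ge0 => t _; exact: poweR_ge0.
Qed.

Lemma AT_norm_ge0 f : (0 <= AT_norm p q f)%E.
Proof. exact: poweR_ge0. Qed.

Lemma AT_norm_step f (E : nat -> set R) (v : nat -> R) n :
  (forall i, measurable (E i)) -> (forall i, 0 <= v i) -> trivIset setT E ->
  (forall i t, (i < n)%N -> E i t -> 0 <= t <= pi *+ 2 /\ ((v i)%:E <= tent_integral f t)%E) ->
  (\sum_(i < n) (v i `^ (q / p))%:E * leb (E i) <= AT_norm p q f `^ q)%E.
Proof.
move=> mE v0 tE H; rewrite AT_normqE.
apply: (@step_le_integral _ _ _ leb _ _ E (fun i => (v i `^ (q / p))%:E)) => //.
- by move=> i; rewrite lee_fin powR_ge0.
- by move=> t _; exact: poweR_ge0.
- move=> i t n_i Eit; have [t2 vt] := H _ _ n_i Eit.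
  split; first by rewrite /= in_itv/=.
  rewrite -poweR_EFin; apply: gt0_ler_poweR => //.
  + by rewrite divr_ge0 ?(ltW p0) ?(ltW q0).
  + by rewrite in_itv/= lee_fin v0 leey.
  + by rewrite in_itv/= tent_integral_ge0 leey.
Qed.

(** Turning the vertex by at most (1 - r) / 4 leaves room for a disc of that radius inside the disc
    of radius (1 - r) / 2 contained in the tent. On it 1 - |z| <= 5 (1 - r) / 4 and 1 + |z| <= 2,
    whence the density is at least 2 / (5 (1 - r)). *)
Lemma tent_integral_disc f r t0 t : analytic f -> 0 <= r < 1 -> `|t - t0| <= (1 - r) / 4 ->
  ((2 / (5 * pi) / (1 - r))%:E * \int[leb2]_(w in plane_disc (r%:C * cis t0)%R ((1 - r) / 4)%R)
     (normc (f (w.1 +i* w.2)) `^ p)%:E <= tent_integral f t)%E.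
Proof.
move=> af /andP[r0 r1] tt0.
have r1' : 0 < 1 - r by rewrite subr_gt0.
have nz : normc (r%:C * cis t0) = r by rewrite normcM normc_cis mulr1 normc_real_ge0.
have zr w : normc (w - r%:C * cis t0) < (1 - r) / 4 ->
    r - (1 - r) / 4 < normc w /\ normc w < 1.
  move=> h; have := le_normcD (w - r%:C * cis t0) (r%:C * cis t0).
  have := ler_normcB (r%:C * cis t0) w; rewrite nz subrK normcBC => h1 h2.
  by split; lra.
rewrite /tent_integral /area_integral.
have -> : 2 / (5 * pi) / (1 - r) = (pi^-1 * (2 / 5 / (1 - r)) : R).
  have gen (x y : R) : x != 0 -> y != 0 -> 2 / (5 * x) / y = x^-1 * (2 / 5 / y).
    by move=> x0 y0; field; rewrite x0 y0.
  by apply: gen; rewrite gt_eqF ?pi_gt0.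
rewrite EFinM -muleA; apply: lee_wpmul2l; first by rewrite lee_fin invr_ge0 pi_ge0.
have c0 : 0 <= 2 / 5 / (1 - r) by rewrite !divr_ge0// ltW.
rewrite -ge0_integralZl//; last 3 first.
- exact: measurable_plane_disc.
- by apply: measurable_normc_pow => // w /zr[].
- by move=> w _; rewrite lee_fin powR_ge0.
apply: ge0_le_integral_nomeas.
- by move=> w _; rewrite -EFinM lee_fin mulr_ge0// powR_ge0.
- by move=> w /= /density_ge0 h; rewrite lee_fin.
move=> w Dw; set z := w.1 +i* w.2.
have zD : normc (z - r%:C * cis t0) < (1 - r) / 4 := Dw.
have [z1 z2] := zr _ zD.
split.
- apply: (@Gamma_halfI _ r); first by rewrite r0.
  apply: le_lt_trans (normc_tri (r%:C * cis t0) _ _) _.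
  have : normc (r%:C * cis t0 - r%:C * cis t) <= `|t - t0|.
    rewrite -mulrBr normcM normc_real_ge0// distrC.
    apply: le_trans (_ : 1 * `|t0 - t| <= _); last by rewrite mul1r.
    by apply: ler_pM => //; [exact: normc_ge0|exact: ltW|exact: cis_lipschitz].
  lra.
- rewrite -EFinM lee_fin mulrC ler_wpM2l ?powR_ge0//.
  rewrite -[2 / 5]invf_div -invfM lef_pV2 ?posrE; last 2 first.
  + by rewrite mulr_gt0// ?divr_gt0.
  + by rewrite subr_gt0 -(expr1n _ 2) ltr_sqr ?nnegrE ?normc_ge0.
  rewrite -[X in X - _](expr1n _ 2) subr_sqr.
  have : (1 - normc z) * (1 + normc z) <= (5 / 4 * (1 - r)) * 2.
    have gen (x : R) : r - (1 - r) / 4 < x -> x < 1 -> 0 <= x ->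
        (1 - x) * (1 + x) <= (5 / 4 * (1 - r)) * 2.
      by move=> ? ? ?; apply: ler_pM; lra.
    exact: gen z1 z2 (normc_ge0 z).
  lra.
Qed.

(** 2 / (5 pi) is the density bound with the normalization of area, 1/16 comes from the squared
    radius ((1 - r) / 4)^2, and 2^p from the sub-mean inequality. *)
Definition point_const : R := 2 / (5 * pi) / (16 * 2 `^ p).

Lemma point_const_gt0 : 0 < point_const.
Proof. by rewrite /point_const !divr_gt0// ?mulr_gt0 ?pi_gt0 ?powR_gt0. Qed.

Lemma tent_integral_point f a r t0 t : analytic f -> has_expansion f a -> 0 <= r < 1 ->
  `|t - t0| <= (1 - r) / 4 ->
  ((point_const * normc (f (r%:C * cis t0)) `^ p * (1 - r))%:E <= tent_integral f t)%E.
Proof.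
move=> af fa r01 tt0; have /andP[r0 r1] := r01.
have r1' : 0 < 1 - r by rewrite subr_gt0.
apply: le_trans (tent_integral_disc af r01 tt0).
have nz : normc (r%:C * cis t0) = r by rewrite normcM normc_cis mulr1 normc_real_ge0.
have r4 : 0 < (1 - r) / 4 by rewrite divr_gt0.
have zr1 : normc (r%:C * cis t0) + (1 - r) / 4 < 1 by rewrite nz; lra.
have := submean p1 af fa r4 zr1; set I := (X in (_ <= _ * X)%E) => sm.
have -> : point_const * normc (f (r%:C * cis t0)) `^ p * (1 - r) =
    (2 / (5 * pi) / (1 - r)) * ((2 `^ p)^-1 * (normc (f (r%:C * cis t0)) `^ p * ((1 - r) / 4) ^+ 2)).
  have p2 : (0 : R) < 2 `^ p by rewrite powR_gt0.
  have gen (x y u v : R) : x != 0 -> y != 0 -> u != 0 ->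
      2 / (5 * x) / (16 * u) * v * y = 2 / (5 * x) / y * (u^-1 * (v * (y / 4) ^+ 2)).
    by move=> x0 y0 u0; field; rewrite x0 y0 u0.
  by apply: gen; rewrite gt_eqF ?pi_gt0.
rewrite EFinM; apply: lee_wpmul2l.
  by rewrite lee_fin !divr_ge0 ?mulr_ge0 ?pi_ge0// ltW.
by rewrite EFinM lee_pdivrMl ?powR_gt0.
Qed.

End lower_bounds.

Ltac nneg := repeat first [ done | assumption | by apply: ltW | exact: powR_ge0 | exact: pi_ge0 | exact: normc_ge0
  | exact: exprn_ge0 | apply: mulr_ge0 | apply: addr_ge0 | apply: divr_ge0
  | apply: exprn_ge0 | rewrite invr_ge0 | apply: ltW ].

Lemma powR_le_cancel (R : realType) (r x y : R) : 0 < r -> 0 <= x -> 0 <= y ->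
  x `^ r <= y `^ r -> x <= y.
Proof.
move=> r0 x0 y0; rewrite leNgt => /negP h; rewrite leNgt; apply/negP => yx; apply: h.
exact: gt0_ltr_powR.
Qed.

Lemma powR_exp_le (R : realType) (y u v : R) : 0 < y -> y <= 1 -> u <= v -> y `^ (- u) <= y `^ (- v).
Proof.
move=> y0 y1 uv.
have E w : y `^ (- w) = (y^-1) `^ w by rewrite -powR_inv1 ?ltW// -powRrM mulN1r.
by rewrite !E; apply: ler_powR => //; rewrite invf_ge1.
Qed.

(** * Growth of coefficients *)

Section parseval.
Local Open Scope complex_scope.
Variable R : realType.
Implicit Types (a : nat -> R[i]) (r : R).

Lemma sqr_normc_conj (z : R[i]) : ((normc z ^+ 2)%:C = z * z^*)%C.
Proof. by rewrite -sqr_normc rmorphXn. Qed.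

Lemma rootu_conj n j : rootu R n j * (rootu R n j)^*%C = 1.
Proof. by rewrite -sqr_normc_conj normc_cis expr1n. Qed.

Lemma sum_rootu_conj n k l : (k < n)%N -> (l < n)%N ->
  \sum_(j < n) rootu R n j ^+ k * ((rootu R n j) ^+ l)^*%C = if k == l then n%:R else 0.
Proof.
wlog kl : k l / (l <= k)%N => [H kn ln|kn ln].
  have [lk|kl] := leqP l k; first exact: H.
  have := H _ _ (ltnW kl) ln kn => /(congr1 (@conjc R)).
  rewrite raddf_sum/= eq_sym; case: ifP => _ E.
  - rewrite -[RHS](conjc_nat R) -E; apply: eq_bigr => j _.
    by rewrite rmorphM/= conjcK mulrC.
  - rewrite -[RHS](conjc0 R) -E; apply: eq_bigr => j _.
    by rewrite rmorphM/= conjcK mulrC.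
rewrite (eq_bigr (fun j : 'I_n => rootu R n j ^+ (k - l))); last first.
  move=> j _; rewrite rmorphXn/= -{1}(subnK kl) exprD -mulrA -exprMn rootu_conj.
  by rewrite expr1n mulr1.
case: eqVneq => [->|nkl].
  by rewrite subnn (eq_bigr (fun=> 1)) ?sumr_const ?card_ord// => j _; rewrite expr0.
apply: sum_rootu; rewrite subn_gt0 ltn_neqAle eq_sym nkl kl/=.
by rewrite (leq_ltn_trans (leq_subr _ _)).
Qed.

Lemma parseval_rootu n a r :
  \sum_(j < n) normc (power_series a (r%:C * rootu R n j) n) ^+ 2 =
  n%:R * \sum_(k < n) (normc (a k) * r ^+ k) ^+ 2.
Proof.
apply: (@complexI R); rewrite rmorphM/= rmorph_nat !raddf_sum/=.
under eq_bigr do rewrite sqr_normc_conj /power_series/series/= big_mkord rmorph_sum/= big_distrlr/=.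
rewrite exchange_big/= mulr_sumr; apply: eq_bigr => k _.
rewrite exchange_big/= (bigD1 k)//= [X in _ + X]big1 ?addr0.
- have -> : \sum_(j < n) a k * (r%:C * rootu R n j) ^+ k * (a k * (r%:C * rootu R n j) ^+ k)^*%C =
    (a k * (a k)^*%C * (r%:C ^+ k * (r%:C ^+ k)^*%C)) * \sum_(j < n) rootu R n j ^+ k * ((rootu R n j) ^+ k)^*%C.
    rewrite mulr_sumr; apply: eq_bigr => j _.
    by rewrite exprMn !rmorphM/=; ring.
  rewrite sum_rootu_conj// eqxx mulrC; congr (_ * _).
  by rewrite -!sqr_normc_conj normcX normc_real -normrX real_normK ?num_real// -rmorphM/= -exprMn.
- move=> l lk.
  have -> : \sum_(j < n) a k * (r%:C * rootu R n j) ^+ k * (a l * (r%:C * rootu R n j) ^+ l)^*%C =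
    (a k * (a l)^*%C * (r%:C ^+ k * (r%:C ^+ l)^*%C)) * \sum_(j < n) rootu R n j ^+ k * ((rootu R n j) ^+ l)^*%C.
    rewrite mulr_sumr; apply: eq_bigr => j _.
    by rewrite !exprMn !rmorphM/=; ring.
  by rewrite sum_rootu_conj// ifN ?mulr0// eq_sym.
Qed.

(* The factor 2 absorbs the truncation error. *)
Lemma bessel_rootu (f : R[i] -> R[i]) a r (B : R) (N : nat) : has_expansion f a -> 0 <= r < 1 ->
  (forall n, (N <= n)%N -> \sum_(j < n) normc (f (r%:C * rootu R n j)) ^+ 2 <= n%:R * B) ->
  forall K, \sum_(k < K) (normc (a k) * r ^+ k) ^+ 2 <= 2 * B.
Proof.
move=> fa /andP[r0 r1] HB K.
have cT : cvgn (abs_series a r) by apply: (expansion_abs_cvg fa); rewrite r0.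
apply/ler_addgt0Pr => e e0.
have d0 : 0 < Num.min 1 (e / 2) by rewrite lt_min ltr01 divr_gt0.
have /cvgrPdist_lt/(_ _ d0)[n0 _ Hn0] := cvg_series_tail cT.
pose n := maxn (maxn N K) (maxn n0 1).
have Nn : (N <= n)%N by rewrite /n !leq_max leqnn.
have Kn : (K <= n)%N by rewrite /n !leq_max leqnn !orbT.
have n0n : (n0 <= n)%N by rewrite /n !leq_max leqnn !orbT.
have n1 : (0 < n)%N by rewrite /n !leq_max ltn0Sn !orbT.
have nR : (0 : R) < n%:R by rewrite ltr0n.
have := Hn0 n n0n; rewrite /= sub0r normrN; set T := limn _ - _ => hT.
apply: (@le_trans _ _ (\sum_(k < n) (normc (a k) * r ^+ k) ^+ 2)).
  rewrite -(big_mkord xpredT (fun k => (normc (a k) * r ^+ k) ^+ 2)).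
  rewrite -(big_mkord xpredT (fun k => (normc (a k) * r ^+ k) ^+ 2)).
  by rewrite (big_cat_nat (leq0n K) Kn)/= lerDl sumr_ge0// => i _; exact: sqr_ge0.
rewrite -(ler_pM2l nR) -parseval_rootu.
apply: (@le_trans _ _ (\sum_(j < n) (2 * normc (f (r%:C * rootu R n j)) ^+ 2 + e))).
  apply: ler_sum => j _.
  have zr : normc (r%:C * rootu R n j) <= r by rewrite normcM normc_cis mulr1 normc_real_ge0.
  have := expansion_tail n fa r1 zr; rewrite -/(abs_series _ _) -/T normcBC => h1.
  have := ler_normcB (power_series a (r%:C * rootu R n j) n) (f (r%:C * rootu R n j)).
  move: h1 hT; rewrite lt_min => h1 /andP[hT1 hT2] h2.
  have T1 := ler_norm T.
  have gen (x y u v : R) : 0 <= x -> 0 <= y -> x <= y + u -> 0 <= u -> u <= 1 -> u <= v / 2 -> x ^+ 2 <= 2 * y ^+ 2 + v.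
    move=> x0 y0 xyu u0 u1 uv.
    have : x ^+ 2 <= (y + u) ^+ 2 by rewrite ler_sqr ?nnegrE// addr_ge0.
    have : 0 <= (y - u) ^+ 2 by exact: sqr_ge0.
    have : u ^+ 2 <= u by rewrite expr2 ler_piMr.
    rewrite !expr2; nra.
  apply: (gen _ _ `|T|); rewrite ?normc_ge0//; [|exact: ltW|exact: ltW].
  lra.
rewrite big_split/= -mulr_sumr sumr_const card_ord -[X in _ + X]mulr_natl mulrDr lerD2r.
by rewrite mulrCA ler_pM2l// HB.
Qed.

End parseval.

Section growth.
Local Open Scope complex_scope.
Variables (R : realType) (p q : R).
Hypotheses (p1 : 1 < p) (q1 : 1 < q).
Local Notation leb := (@lebesgue_measure R).
Implicit Types (f : R[i] -> R[i]).
Local Notation c0 := (point_const p).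

Let p0 : 0 < p. Proof. exact: lt_trans ltr01 p1. Qed.
Let q0 : 0 < q. Proof. exact: lt_trans ltr01 q1. Qed.
Let c00 : 0 < c0. Proof. exact: point_const_gt0. Qed.

Lemma point_powR (x y : R) : 0 <= x -> 0 <= y ->
  (c0 * x `^ p * y) `^ (q / p) = c0 `^ (q / p) * (x `^ q * y `^ (q / p)).
Proof.
move=> x0 y0; rewrite powRM; [|by nneg|by nneg]; rewrite powRM; [|by nneg|by nneg].
by rewrite -powRrM mulrCA divff ?gt_eqF// mulr1 mulrA.
Qed.

(** The tents over an arc of length (1 - r) / 4 at t0 all see the point r e^(i t0); the 4 in the
    bound is that arc length. *)
Lemma point_growth f a M r t0 : analytic f -> has_expansion f a ->
  (AT_norm p q f `^ q <= M%:E)%E -> 0 <= r < 1 -> 0 <= t0 <= pi *+ 2 ->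
  normc (f (r%:C * cis t0)) `^ q * (1 - r) `^ (q / p + 1) <= 4 / c0 `^ (q / p) * M.
Proof.
move=> af fa fM r01 /andP[t00 t02]; have /andP[r0 r1] := r01.
have y0 : 0 < 1 - r by rewrite subr_gt0.
set x := normc _; have x0 : 0 <= x := normc_ge0 _.
(* The arc is placed to the right or to the left of t0 so that it stays inside [0, 2 pi]. *)
pose t1 := if t0 <= pi then t0 else t0 - (1 - r) / 4.
pose E (i : nat) : set R := if i is 0%N then `[t1, t1 + (1 - r) / 4[%classic else set0.
pose v (i : nat) := c0 * x `^ p * (1 - r).
have v0 i : 0 <= v i by rewrite /v; nneg.
have pi2 := @pi_ge2 R.
have := @AT_norm_step _ _ _ p1 q1 f E v 1 _ v0 _ _.
rewrite big_ord_recl big_ord0 adde0 /= => H.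
have {}H : ((v 0 `^ (q / p))%:E * leb `[t1, (t1 + (1 - r) / 4)%R[ <= AT_norm p q f `^ q)%E.
  apply: H.
  - by case => [|i]; rewrite /E; [exact: measurable_itv|exact: measurable0].
  - apply/trivIsetP => -[|i] [|j] _ _ //= _; rewrite ?setI0 ?set0I//.
  - move=> [|//] t _; rewrite /= in_itv/= => /andP[h1 h2].
    have tt : `|t - t0| <= (1 - r) / 4 /\ 0 <= t <= pi *+ 2.
      by move: h1 h2; rewrite /t1 mulr2n in t02 *; case: (leP t0 pi) => h h1 h2;
       (split; [rewrite ler_norml; apply/andP; split; lra|apply/andP; split; lra]).
    by case: tt => tt t02'; split => //; exact: (tent_integral_point p1 af fa r01 tt).
move: H; rewrite lebesgue_measure_itv/= lte_fin ltrDl divr_gt0// -EFinB addrAC subrr add0r.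
move=> /le_trans/(_ fM); rewrite -EFinM lee_fin /v point_powR// ?(ltW y0)//.
have yq : 0 < (1 - r) `^ (q / p) by rewrite powR_gt0.
have cq : 0 < c0 `^ (q / p) by rewrite powR_gt0.
rewrite powRD; last by rewrite (gt_eqF y0) implybT.
rewrite powRr1 ?(ltW y0)//.
move: (x `^ q) ((1 - r) `^ (q / p)) (c0 `^ (q / p)) cq (1 - r) => X Y Z Z0 y h.
rewrite mulrAC ler_pdivlMr//; lra.
Qed.

(** A discrete q-mean on the circle of radius r: the n arcs between consecutive roots tile [0, 2
    pi), and each is short enough for all its tents to see its own root. *)
Lemma circle_growth f a M r n : analytic f -> has_expansion f a ->
  (AT_norm p q f `^ q <= M%:E)%E -> 0 <= r < 1 -> (0 < n)%N -> pi *+ 2 / n%:R <= (1 - r) / 4 ->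
  \sum_(j < n) normc (f (r%:C * rootu R n j)) `^ q * (1 - r) `^ (q / p) <= n%:R * (M / c0 `^ (q / p)).
Proof.
move=> af fa fM r01 n0 nr; have /andP[r0 r1] := r01.
have y0 : 0 < 1 - r by rewrite subr_gt0.
have nR : (0 : R) < n%:R by rewrite ltr0n.
have pi0 := @pi_gt0 R.
have pi20 : 0 < (pi : R) *+ 2 by rewrite pmulrn_lgt0.
pose th (j : nat) : R := pi *+ 2 * j%:R / n%:R.
have thS j : th j.+1 = th j + pi *+ 2 / n%:R.
  by rewrite /th -natr1; ring.
have thm i j : (i <= j)%N -> th i <= th j.
  by move=> ij; rewrite /th ler_pM2r ?invr_gt0// ler_pM2l ?ler_nat//.
pose E j : set R := `[th j, th j.+1[%classic.
pose v j := c0 * normc (f (r%:C * rootu R n j)) `^ p * (1 - r).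
have v0 i : 0 <= v i by rewrite /v; nneg.
have := @AT_norm_step _ _ _ p1 q1 f E v n _ v0 _ _ => H.
have {}H : (\sum_(i < n) (v i `^ (q / p))%:E * leb (E i) <= AT_norm p q f `^ q)%E.
  apply: H.
  - by move=> i; exact: measurable_itv.
  - move=> i j _ _ [x []]; rewrite /E/= !in_itv/= => /andP[i1 i2] /andP[j1 j2].
    case: (ltngtP i j) => // ij.
    + by exfalso; have := thm _ _ ij; lra.
    + by exfalso; have := thm _ _ ij; lra.
  - move=> i t ni; rewrite /E/= in_itv/= => /andP[h1 h2].
    split.
      have h3 := thm _ _ ni; have := thm 0%N i isT.
      have -> : th 0%N = 0 by rewrite /th mulr0 mul0r.
      have -> : pi *+ 2 = th n by rewrite /th mulfK// gt_eqF.
      move=> h4; apply/andP; split; lra.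
    apply: (tent_integral_point p1 af fa r01) => //; rewrite -/(th i).
    rewrite thS in h2; rewrite ler_norml; apply/andP; split; lra.
move: H => /le_trans/(_ fM).
rewrite (eq_bigr (fun j : 'I_n => (c0 `^ (q / p) * (pi *+ 2 / n%:R) * (normc (f (r%:C * rootu R n j)) `^ q * (1 - r) `^ (q / p)))%:E)); last first.
  move=> j _; rewrite lebesgue_measure_itv/= lte_fin thS ltrDl divr_gt0//.
  rewrite -EFinB addrAC subrr add0r -EFinM /v point_powR ?normc_ge0 ?(ltW y0)//.
  by congr _%:E; ring.
rewrite sumEFin lee_fin -mulr_sumr.
have cq : 0 < c0 `^ (q / p) by rewrite powR_gt0.
set S := \sum_(_ < _) _.
have S0 : 0 <= S by apply: sumr_ge0 => j _; rewrite mulr_ge0 ?powR_ge0.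
move=> h; rewrite mulrA ler_pdivlMr// mulrC -ler_pdivrMl// mulrC.
apply: le_trans h.
have -> : c0 `^ (q / p) * (pi *+ 2 / n%:R) * S = c0 `^ (q / p) * S / n%:R * (pi *+ 2) by ring.
have pi2 := @pi_ge2 R.
have -> : n%:R^-1 * (S * c0 `^ (q / p)) = c0 `^ (q / p) * S / n%:R by ring.
apply: ler_peMr; first by rewrite divr_ge0 ?mulr_ge0 ?(ltW cq).
by rewrite mulr2n; lra.
Qed.

Hypothesis s1 : p^-1 + q^-1 < 1.
Hypothesis p2 : 2 < p.

(** The growth exponent of the squared quadratic mean: 2/p comes from comparison with the q-mean
    when q >= 2, and 2s - 1 from interpolation with the pointwise growth when q < 2. *)
Definition mean2_exp : R := Num.max (2 / p) (2 * (p^-1 + q^-1) - 1).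

(* [2 / p < 1] is the only use of [2 < p]. *)
Lemma mean2_exp_bound : 0 <= mean2_exp < 1.
Proof.
rewrite /mean2_exp le_max gt_max divr_ge0 ?(ltW p0)//=.
rewrite ltr_pdivrMr// mul1r p2/=.
by move: s1; move: (p^-1 + q^-1) => s; lra.
Qed.

Lemma mean2_growth M : 0 <= M -> exists2 D : R, 0 <= D &
  forall f a r n, analytic f -> has_expansion f a -> (AT_norm p q f `^ q <= M%:E)%E ->
  0 <= r < 1 -> (0 < n)%N -> pi *+ 2 / n%:R <= (1 - r) / 4 ->
  \sum_(j < n) normc (f (r%:C * rootu R n j)) ^+ 2 <= n%:R * (D * (1 - r) `^ (- mean2_exp)).
Proof.
move=> M0; pose A := M / c0 `^ (q / p).
have A0 : 0 <= A by rewrite divr_ge0// powR_ge0.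
pose B := (4 / c0 `^ (q / p) * M).
have B0 : 0 <= B by rewrite mulr_ge0// divr_ge0// powR_ge0.
exists (1 + A + A * B `^ ((2 - q) / q)).
  by nneg.
move=> f a r n af fa fM r01 n0 nr; have /andP[r0 r1] := r01.
have y0 : 0 < 1 - r by rewrite subr_gt0.
have y1 : 1 - r <= 1 by rewrite lerBlDr lerDl.
have yexp (u v : R) : u <= v -> (1 - r) `^ (- u) <= (1 - r) `^ (- v).
  exact: powR_exp_le.
have HA := circle_growth af fa fM r01 n0 nr; rewrite -/A in HA.
set y := 1 - r in y0 y1 HA yexp *.
have yp u : 0 < y `^ u by rewrite powR_gt0.
have yD u v : y `^ (u + v) = y `^ u * y `^ v by rewrite powRD// (gt_eqF y0) implybT.
have yN u : y `^ u * y `^ (- u) = 1 by rewrite -yD subrr powRr0.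
have nR : (0 : R) < n%:R by rewrite ltr0n.
have D1 : 0 <= A * B `^ ((2 - q) / q) by rewrite mulr_ge0 ?powR_ge0.
have [q2|q2] := leP 2 q.
(* For q >= 2, with u = |f| (1 - r)^(1/p), one has u^2 <= 1 + u^q. *)
- apply: (@le_trans _ _ (\sum_(j < n) y `^ (- (2 / p)) * (1 + normc (f (r%:C * rootu R n j)) `^ q * y `^ (q / p)))).
    apply: ler_sum => j _; set x := normc _; have x0 : 0 <= x := normc_ge0 _.
    have -> : x ^+ 2 = y `^ (- (2 / p)) * (x * y `^ p^-1) ^+ 2.
      have e2 : (y `^ p^-1) ^+ 2 = y `^ (2 / p).
        by rewrite -powR_mulrn ?powR_ge0// -powRrM mulrC.
      by rewrite exprMn e2 mulrCA [X in _ * X]mulrC yN mulr1.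
    have -> : x `^ q * y `^ (q / p) = (x * y `^ p^-1) `^ q.
      by rewrite powRM ?powR_ge0// -powRrM [p^-1 * q]mulrC.
    set u := x * _; have u0 : 0 <= u by rewrite mulr_ge0 ?powR_ge0.
    rewrite ler_wpM2l ?powR_ge0//.
    have [u1|u1] := leP u 1.
      apply: (@le_trans _ _ 1); first by rewrite expr_le1.
      by rewrite lerDl powR_ge0.
    rewrite -powR_mulrn//; apply: (@le_trans _ _ (u `^ q)); last by rewrite lerDr.
    by apply: ler_powR => //; exact: ltW.
  rewrite -mulr_sumr big_split/= sumr_const card_ord.
  apply: (@le_trans _ _ (y `^ (- (2 / p)) * (n%:R + n%:R * A))).
    by rewrite ler_wpM2l ?powR_ge0// lerD2l.
  have -> : y `^ (- (2 / p)) * (n%:R + n%:R * A) = n%:R * ((1 + A) * y `^ (- (2 / p))) by ring.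
  rewrite ler_wpM2l ?(ltW nR)//; apply: ler_pM; rewrite ?addr_ge0 ?powR_ge0//.
    by rewrite lerDl.
  by apply: yexp; rewrite /mean2_exp le_max lexx.
(* For q < 2, write |f|^2 = |f|^(2 - q) |f|^q and bound the first factor by the pointwise growth;
   the exponents add up to s (2 - q) + q/p = 2s - 1. *)
- pose s := p^-1 + q^-1.
  have HB (j : 'I_n) : normc (f (r%:C * rootu R n j)) ^+ 2 <= B `^ ((2 - q) / q) * y `^ (- (s * (2 - q))) * normc (f (r%:C * rootu R n j)) `^ q.
    set x := normc _; have x0 : 0 <= x := normc_ge0 _.
    have [->|xn0] := eqVneq x 0; first by rewrite expr0n/=; nneg.
    have th0 : 0 <= (pi : R) *+ 2 * j%:R / n%:R <= (pi : R) *+ 2.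
      have pi0 : 0 <= (pi : R) *+ 2 by rewrite mulrn_wge0// pi_ge0.
      apply/andP; split; first by nneg.
      by rewrite -mulrA ler_piMr// ler_pdivrMr// mul1r ler_nat ltnW.
    have := point_growth af fa fM r01 th0; rewrite -/y -/B -/(rootu R n j) -/x => hB.
    have qp : q / p + 1 = q * s by rewrite /s; field; rewrite !gt_eqF.
    have hx : x `^ q <= B * y `^ (- (q * s)).
      by rewrite -(ler_pM2r (yp (q / p + 1))) qp -mulrA [y `^ (- _) * _]mulrC yN mulr1 -qp.
    have q20 : 0 <= (2 - q) / q by rewrite divr_ge0 ?(ltW q0)// subr_ge0 ltW.
    have : (x `^ q) `^ ((2 - q) / q) <= (B * y `^ (- (q * s))) `^ ((2 - q) / q).
      by apply: ge0_ler_powR; rewrite ?nnegrE//; nneg.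
    rewrite powRM; [|by nneg|by nneg]; rewrite -!powRrM.
    have -> : q * ((2 - q) / q) = 2 - q by field; rewrite gt_eqF.
    have -> : - (q * s) * ((2 - q) / q) = - (s * (2 - q)) by field; rewrite gt_eqF.
    move=> h; rewrite -powR_mulrn//.
    have -> : x `^ 2%:R = x `^ (2 - q) * x `^ q.
      by rewrite -powRD ?subrK// xn0 implybT.
    by rewrite ler_wpM2r ?powR_ge0.
  apply: le_trans (ler_sum _ (fun j _ => HB j)) _.
  rewrite -mulr_sumr.
  have HA' : \sum_(j < n) normc (f (r%:C * rootu R n j)) `^ q <= n%:R * A * y `^ (- (q / p)).
    rewrite -(ler_pM2r (yp (q / p))) mulr_suml; apply: le_trans HA _.
    by rewrite -[X in _ <= X]mulrA [X in _ <= _ * X]mulrC yN mulr1.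
  apply: (@le_trans _ _ (B `^ ((2 - q) / q) * y `^ (- (s * (2 - q))) * (n%:R * A * y `^ (- (q / p))))).
    by rewrite ler_wpM2l ?mulr_ge0 ?powR_ge0.
  have -> : B `^ ((2 - q) / q) * y `^ (- (s * (2 - q))) * (n%:R * A * y `^ (- (q / p))) =
     n%:R * (A * B `^ ((2 - q) / q) * y `^ (- (2 * s - 1))).
    have -> : - (2 * s - 1) = - (s * (2 - q)) + - (q / p).
      by rewrite /s; field; rewrite !gt_eqF.
    by rewrite yD; ring.
  rewrite ler_wpM2l ?(ltW nR)//; apply: ler_pM; rewrite ?powR_ge0//.
    by rewrite lerDr addr_ge0.
  by apply: yexp; rewrite /mean2_exp le_max lexx orbT.
Qed.

Definition coef_exp : R := (mean2_exp + 1) / 2.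

Lemma coef_exp_bound : 0 < coef_exp < 1.
Proof. by have := mean2_exp_bound; rewrite /coef_exp => /andP[? ?]; apply/andP; split; lra. Qed.

(** Cauchy-Schwarz on the circle of radius r = (1 + t) / 2, between the squares of |a_k| r^k,
    controlled by Parseval, and the geometric series in t / r. The constant depends on the norm
    bound alone, which compactness will use. *)
Lemma coef_growth M : 0 <= M -> exists2 D : R, 0 <= D &
  forall f a t K, analytic f -> has_expansion f a -> (AT_norm p q f `^ q <= M%:E)%E ->
  0 <= t < 1 -> \sum_(k < K) normc (a k) * t ^+ k <= D * (1 - t) `^ (- coef_exp).
Proof.
move=> M0; have [D D0 HD] := mean2_growth M0.
exists ((2 * D + 1) / 2 * 2^-1 `^ (- coef_exp)); first by nneg.
move=> f a t K af fa fM /andP[t0 t1].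
pose r := (1 + t) / 2.
have r01 : 0 <= r < 1 by rewrite /r; apply/andP; split; lra.
have /andP[r0 r1] := r01.
have rh : 1 / 2 <= r by rewrite /r; lra.
have rp : 0 < r by lra.
pose y := 1 - r.
have y0 : 0 < y by rewrite subr_gt0.
have yt : 1 - t = 2 * y by rewrite /y /r; lra.
have pi2 : 0 < (pi : R) *+ 2 by rewrite pmulrn_lgt0 ?pi_gt0.
pose x := pi *+ 2 / (y / 4).
have x0 : 0 < x by rewrite !divr_gt0.
have [N HN] : exists N : nat, x <= N%:R.
  exists (Num.truncn x).+1; exact/ltW/truncnS_gt.
have HB n : (N.+1 <= n)%N -> \sum_(j < n) normc (f (r%:C * rootu R n j)) ^+ 2 <= n%:R * (D * y `^ (- mean2_exp)).
  move=> Nn; have n0 : (0 < n)%N by exact: leq_trans Nn.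
  apply: (HD _ _ _ _ af fa fM r01 n0).
  rewrite ler_pdivrMr ?ltr0n// -/y mulrC -ler_pdivrMr ?divr_gt0// -/x.
  by rewrite (le_trans HN)// ler_nat ltnW.
have := bessel_rootu fa r01 HB K; set L := \sum_(_ < _) _ => hL.
(* The weight in 2uv <= lam u^2 + v^2 / lam that balances y^(-[mean2_exp]) against 1 / y. *)
pose lam := y `^ ((mean2_exp - 1) / 2).
have l0 : 0 < lam by rewrite powR_gt0.
have tr1 : t / r < 1 by rewrite ltr_pdivrMr// mul1r /r; lra.
have tr0 : 0 <= t / r by nneg.
have geo : \sum_(k < K) (t / r) ^+ k <= y^-1.
  have h : 0 < 1 - t / r by rewrite subr_gt0.
  have := one_sub_mul_sum (t / r) K.
  have g0 : 0 <= \sum_(k < K) (t / r) ^+ k by apply: sumr_ge0 => k _; nneg.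
  have e0 : 0 <= (t / r) ^+ K by nneg.
  (* This is t <= r^2, that is (1 - r)^2 >= 0, because t = 2r - 1. *)
  have hy : y <= 1 - t / r.
    rewrite /y lerD2l lerN2 ler_pdivrMr//.
    have : 0 <= (1 - r) ^+ 2 by exact: sqr_ge0.
    have : t = 2 * r - 1 by rewrite /r; lra.
    by move=> ->; rewrite expr2; nra.
  move=> E; rewrite -(ler_pM2l y0) mulfV ?gt_eqF//.
  have : y * \sum_(k < K) (t / r) ^+ k <= (1 - t / r) * \sum_(k < K) (t / r) ^+ k by rewrite ler_wpM2r.
  by rewrite E; lra.
have : \sum_(k < K) normc (a k) * t ^+ k <= (lam * L + lam^-1 * y^-1) / 2.
  apply: (@le_trans _ _ ((lam * L + lam^-1 * \sum_(k < K) (t / r) ^+ k) / 2)); last first.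
    by rewrite ler_pM2r// lerD2l ler_pM2l ?invr_gt0.
  rewrite /L !mulr_sumr -big_split/= mulr_suml; apply: ler_sum => k _.
  have -> : normc (a k) * t ^+ k = (normc (a k) * r ^+ k) * (t / r) ^+ k.
    by rewrite -mulrA -exprMn mulrCA divff ?gt_eqF// mulr1.
  set u := normc (a k) * r ^+ k; set v := (t / r) ^+ k.
  have u0 : 0 <= u by rewrite /u; nneg.
  have v0 : 0 <= v by rewrite /v; nneg.
  have v1 : v <= 1 by rewrite /v exprn_ile1// ltW.
  have vv : v ^+ 2 <= v by rewrite expr2 ler_piMr.
  have : 0 <= lam^-1 * (lam * u - v) ^+ 2 by rewrite mulr_ge0 ?sqr_ge0// invr_ge0 ltW.
  have -> : lam^-1 * (lam * u - v) ^+ 2 = lam * u ^+ 2 - 2 * (u * v) + lam^-1 * v ^+ 2.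
    by field; rewrite gt_eqF.
  have : lam^-1 * v ^+ 2 <= lam^-1 * v by rewrite ler_wpM2l// invr_ge0 ltW.
  lra.
move=> /le_trans; apply.
have yD u v : y `^ (u + v) = y `^ u * y `^ v by rewrite powRD// (gt_eqF y0) implybT.
have E1 : lam * y `^ (- mean2_exp) = y `^ (- coef_exp).
  by rewrite /lam -yD; congr (_ `^ _); rewrite /coef_exp; lra.
have E2 : lam^-1 * y^-1 = y `^ (- coef_exp).
  rewrite /lam -powRN -(powR_inv1 (ltW y0)) -yD; congr (_ `^ _); rewrite /coef_exp; lra.
have E3 : 2^-1 `^ (- coef_exp) * (1 - t) `^ (- coef_exp) = y `^ (- coef_exp).
  by rewrite yt -powRM ?invr_ge0 ?mulr_ge0 ?(ltW y0)// mulKf.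
rewrite -mulrA E3 E2.
have : lam * L <= 2 * D * y `^ (- coef_exp).
  by rewrite -E1 mulrA [X in _ <= X](_ : _ = lam * (2 * (D * y `^ (- mean2_exp)))) ?ler_pM2l//; ring.
by move: (y `^ (- coef_exp)) (lam * L) => Y Z; lra.
Qed.

End growth.

Lemma eq_ler (R : numDomainType) (x y : R) : x = y -> x <= y.
Proof. by move=> ->. Qed.

(** * The trace on the radius *)

Section dyadic.
Local Open Scope complex_scope.
Variable R : realType.
Implicit Types (f : R[i] -> R[i]) (a : nat -> R[i]).

Definition dy (k : nat) : R := 2^-1 ^+ k.

Lemma dy_gt0 k : 0 < dy k. Proof. by rewrite exprn_gt0// invr_gt0. Qed.

Lemma dyS k : dy k.+1 = dy k / 2. Proof. by rewrite /dy exprSr. Qed.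

Lemma dy_le1 k : dy k <= 1. Proof. by rewrite exprn_ile1 ?invr_ge0 ?invf_le1 ?ler1n. Qed.

Lemma dy_le i j : (i <= j)%N -> dy j <= dy i.
Proof. by move=> ij; apply: ler_wiXn2l => //; rewrite ?invr_ge0 ?invf_le1 ?ler1n. Qed.

Lemma dy_lt i j : (i < j)%N -> dy j < dy i.
Proof.
move=> ij; apply: le_lt_trans (dy_le ij) _; rewrite dyS.
by have := dy_gt0 i; lra.
Qed.

Lemma dyD i j : dy (i + j) = dy i * dy j. Proof. exact: exprD. Qed.

Lemma dyB i j : (i <= j)%N -> dy (j - i) = dy j / dy i.
Proof.
by move=> ij; rewrite -{2}(subnK ij) dyD mulfK// gt_eqF// dy_gt0.
Qed.

Lemma dy_small (x : R) : 0 < x -> exists k, dy k < x.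
Proof.
move=> x0; have h : `|2^-1 : R| < 1 by rewrite ger0_norm ?invr_ge0// invf_lt1// ltr1n.
have /cvgrPdist_lt/(_ _ x0)[k _ /(_ k (leqnn k))] := cvg_expr h.
by rewrite /= sub0r normrN ger0_norm ?(ltW (dy_gt0 k))// => ?; exists k.
Qed.

Lemma dy_scale (x : R) : 0 < x -> x <= 1 -> exists k, dy k.+1 < x <= dy k.
Proof.
move=> x0 x1.
have [k kx] := dy_small x0.
elim: k kx => [|k IH] kx; first by move: kx; rewrite /dy expr0; lra.
have [h|h] := ltP (dy k) x; first exact: IH.
by exists k; rewrite kx h.
Qed.

Definition dyadic (k : nat) : set R := `[1 - dy k, 1 - dy k.+1[%classic.

Lemma dyadicE k t : dyadic k t <-> 1 - dy k <= t < 1 - dy k.+1.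
Proof. by rewrite /dyadic/= in_itv. Qed.

Lemma dyadic_lower k : dyadic k (1 - dy k).
Proof. by apply/dyadicE; rewrite lexx ltrD2l ltrN2 dy_lt. Qed.

Lemma dyadic_bounds k t : dyadic k t -> [/\ 0 <= t, t < 1, dy k / 2 < 1 - t & 1 - t <= dy k].
Proof.
move=> /dyadicE /andP[h1 h2]; have := dy_le1 k; have := dy_gt0 k.+1; rewrite dyS in h2 *.
by move=> ? ?; split; lra.
Qed.

Lemma dyadic_cover t : 0 <= t < 1 -> exists k, dyadic k t.
Proof.
move=> /andP[t0 t1]; have [||k /andP[h1 h2]] := @dy_scale (1 - t); [lra|lra|].
by exists k; apply/dyadicE; apply/andP; split; lra.
Qed.

Definition dysup f k : R := sup [set normc (f t%:C) | t in dyadic k].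

Lemma dysup_has_sup f a k : has_expansion f a ->
  has_sup [set normc (f t%:C) | t in dyadic k].
Proof.
move=> fa; split.
  by exists (normc (f (1 - dy k)%:C)); exists (1 - dy k) => //; exact: dyadic_lower.
have r1 : 1 - dy k.+1 < 1 by have := dy_gt0 k.+1; lra.
exists (limn (abs_series a (1 - dy k.+1))) => _ [t kt <-].
have [t0 _ _ _] := dyadic_bounds kt.
have tr : normc (t%:C : R[i]) <= 1 - dy k.+1.
  by rewrite normc_real_ge0//; move/dyadicE : kt => /andP[_ /ltW].
have := expansion_tail 0 fa r1 tr.
by rewrite /power_series /abs_series/series/= !big_geq// !subr0.
Qed.

Lemma dysup_ub f a k t : has_expansion f a -> dyadic k t -> normc (f t%:C) <= dysup f k.
Proof.
move=> fa kt; have [_ hub] := dysup_has_sup k fa.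
by apply: (ub_le_sup hub); exists t.
Qed.

Lemma dysup_le f k (x : R) : (forall t, dyadic k t -> normc (f t%:C) <= x) -> dysup f k <= x.
Proof.
move=> H; apply: ge_sup; last by move=> _ [t kt <-]; exact: H.
by exists (normc (f (1 - dy k)%:C)); exists (1 - dy k) => //; exact: dyadic_lower.
Qed.

Lemma dysup_ge0 f a k : has_expansion f a -> 0 <= dysup f k.
Proof. by move=> fa; apply: le_trans (dysup_ub fa (dyadic_lower k)); exact: normc_ge0. Qed.

End dyadic.

Arguments dy {R} k.
Arguments dyadic {R} k.

Section trace.
Local Open Scope complex_scope.
Variables (R : realType) (p q : R).
Hypotheses (p1 : 1 < p) (q1 : 1 < q).
Local Notation leb := (@lebesgue_measure R).
Implicit Types (f : R[i] -> R[i]).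
Local Notation c0 := (point_const p).
Local Notation s := (p^-1 + q^-1).

Let p0 : 0 < p. Proof. exact: lt_trans ltr01 p1. Qed.
Let q0 : 0 < q. Proof. exact: lt_trans ltr01 q1. Qed.
Let c00 : 0 < c0. Proof. exact: point_const_gt0. Qed.

(** Point values grow at most like (1 - t)^(-s); the weight cancels exactly this growth. *)
Definition dytrace f k : R := dy k `^ s * dysup f k.

(** 16 is the inverse of the relative length of the k-th arc, dy k / 16; c0 is halved because 1 - u
    > dy k / 2 on the k-th interval. *)
Definition trace_const : R := (16 / (c0 / 2) `^ (q / p)).

Lemma trace_const_gt0 : 0 < trace_const.
Proof. by rewrite divr_gt0// powR_gt0// divr_gt0. Qed.

Lemma trace_le f a n : analytic f -> has_expansion f a ->
  ((\sum_(k < n) dytrace f k `^ q)%:E <= trace_const%:E * AT_norm p q f `^ q)%E.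
Proof.
move=> af fa.
(* These angles are below dy k / 8 < (1 - u) / 4 for every u of the k-th interval, so each tent sees
   the whole interval. *)
pose E (k : nat) : set R := `[dy k.+4, dy k.+3[%classic.
have m0 k : 0 <= dysup f k := dysup_ge0 k fa.
have d0 k : 0 < dy k :> R := dy_gt0 R k.
pose v k : R := c0 / 2 * dysup f k `^ p * dy k.
have v0 k : 0 <= v k by rewrite /v; nneg.
have := @AT_norm_step _ _ _ p1 q1 f E v n _ v0 _ _ => H.
have {}H : (\sum_(i < n) (v i `^ (q / p))%:E * leb (E i) <= AT_norm p q f `^ q)%E.
  apply: H.
  - by move=> i; exact: measurable_itv.
  - move=> i j _ _ [x []]; rewrite /E/= !in_itv/= => /andP[i1 i2] /andP[j1 j2].
    case: (ltngtP i j) => // ij; exfalso.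
    + have : dy j.+3 <= dy i.+4 :> R by apply: dy_le; rewrite !ltnS.
      lra.
    + have : dy i.+3 <= dy j.+4 :> R by apply: dy_le; rewrite !ltnS.
      lra.
  - move=> k t _; rewrite /E/= in_itv/= => /andP[h1 h2].
    have e4 := d0 k.+4; have pi2 := @pi_ge2 R; have d1 := dy_le1 R k.+3.
    split; first by rewrite mulr2n; apply/andP; split; lra.
    have t8 : t <= dy k / 8 by move: h2; rewrite !dyS; lra.
    have pt u : dyadic k u -> ((c0 * normc (f u%:C) `^ p * (dy k / 2))%:E <= tent_integral p f t)%E.
      move=> /dyadic_bounds[u0 u1 u2 u3].
      have u01 : 0 <= u < 1 by rewrite u0 u1.
      have tt : `|t - 0| <= (1 - u) / 4 by rewrite subr0 ger0_norm; lra.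
      have := tent_integral_point p1 af fa u01 tt; rewrite cis0 mulr1; apply: le_trans.
      by rewrite lee_fin ler_wpM2l ?(ltW u2)//; nneg.
    have : (0 <= tent_integral p f t)%E by exact: tent_integral_ge0.
    case: (tent_integral p f t) pt => [x pt x0|pt _|//]; last by rewrite leey.
    rewrite lee_fin in x0; rewrite lee_fin /v.
    have cd : 0 < c0 * (dy k / 2) by rewrite mulr_gt0// divr_gt0.
    (* The bound holds for each point under the same tent, so it passes to the supremum once the
       p-th root is taken. *)
    have : dysup f k <= (x / (c0 * (dy k / 2))) `^ p^-1.
      apply: dysup_le => u /pt; rewrite lee_fin => h.
      have : (normc (f u%:C) `^ p) `^ p^-1 <= (x / (c0 * (dy k / 2))) `^ p^-1.
        apply: ge0_ler_powR; rewrite ?nnegrE; [by nneg|by nneg|by nneg; exact: ltW|].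
        by rewrite ler_pdivlMr//; lra.
      by rewrite -powRrM divff ?gt_eqF// powRr1// normc_ge0.
    move=> h; have : dysup f k `^ p <= ((x / (c0 * (dy k / 2))) `^ p^-1) `^ p.
      by apply: ge0_ler_powR; rewrite ?nnegrE ?powR_ge0// ltW.
    rewrite -powRrM mulVf ?gt_eqF// powRr1; last by rewrite divr_ge0// ltW.
    by rewrite ler_pdivlMr//; lra.
have cq : 0 < (c0 / 2) `^ (q / p) by rewrite powR_gt0// divr_gt0.
suff hS : (((c0 / 2) `^ (q / p) / 16 * \sum_(k < n) dytrace f k `^ q)%:E <= AT_norm p q f `^ q)%E.
  apply: le_trans (lee_wpmul2l _ hS); last by rewrite lee_fin (ltW trace_const_gt0).
  rewrite -EFinM lee_fin mulrA /trace_const mulrA divfK ?(gt_eqF cq)//.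
  by rewrite divff// mul1r.
apply: le_trans H; rewrite mulr_sumr -sumEFin; apply: lee_sum => k _.
rewrite lebesgue_measure_itv/= lte_fin dy_lt// -EFinB -EFinM lee_fin.
rewrite /v [X in _ <= X * _]powRM; [|by nneg|by nneg].
rewrite [X in _ <= X * _ * _]powRM; [|by nneg|by nneg].
rewrite -powRrM.
have -> : p * (q / p) = q by field; rewrite gt_eqF.
rewrite /dytrace [X in _ * X <= _]powRM; [|by nneg|by nneg]; rewrite -powRrM.
have -> : s * q = q / p + 1 by field; rewrite !gt_eqF.
rewrite powRD; last by rewrite (gt_eqF (d0 k)) implybT.
rewrite powRr1 ?(ltW (d0 k))//.
have -> : dy k.+3 - dy k.+4 = dy k / 16 :> R by rewrite !dyS; field.
by apply: eq_ler; ring.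
Qed.

Lemma trace_term f a k t : analytic f -> has_expansion f a -> dyadic k t ->
  (((dy k `^ s * normc (f t%:C)) `^ q)%:E <= trace_const%:E * AT_norm p q f `^ q)%E.
Proof.
move=> af fa kt; apply: le_trans (trace_le k.+1 af fa).
rewrite lee_fin big_ord_recr/=; apply: le_trans (_ : dytrace f k `^ q <= _).
  apply: ge0_ler_powR; rewrite ?nnegrE; [exact: ltW| | |].
  - by nneg.
  - by rewrite /dytrace mulr_ge0 ?powR_ge0// (dysup_ge0 k fa).
  - by rewrite ler_wpM2l ?powR_ge0// (dysup_ub fa kt).
by rewrite lerDr sumr_ge0// => i _; exact: powR_ge0.
Qed.

(** The terms of a convergent series tend to 0. This holds for one fixed function, and is set
    against the uniform lower bound for the test functions when compactness is assumed. *)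
Lemma trace_cvg0 f a : analytic f -> has_expansion f a -> (AT_norm p q f < +oo)%E ->
  dytrace f k @[k --> \oo] --> (0 : R).
Proof.
move=> af fa fin.
have t0 k : 0 <= dytrace f k by rewrite /dytrace mulr_ge0 ?powR_ge0// (dysup_ge0 k fa).
have fn : (AT_norm p q f `^ q)%E \is a fin_num.
  by rewrite ge0_fin_numE ?poweR_ge0// poweR_lty.
have cv : cvgn (series (fun k => dytrace f k `^ q)).
  apply: nondecreasing_is_cvgn.
    by apply: nondecreasing_series => k *; exact: powR_ge0.
  exists (trace_const * fine (AT_norm p q f `^ q)%E) => _ [n _ <-].
  have := trace_le n af fa; rewrite -(fineK fn) -EFinM lee_fin.
  by rewrite /series/= big_mkord.
have /cvgrPdist_lt c0' := cvg_series_cvg_0 cv.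
apply/cvgrPdist_lt => e e0.
have eq0 : 0 < e `^ q by rewrite powR_gt0.
have := c0' _ eq0; apply: filterS => k.
rewrite !sub0r !normrN !ger0_norm ?powR_ge0// => h.
by rewrite ltNge; apply: contraTN h => h; rewrite -leNgt; apply: ge0_ler_powR; rewrite ?nnegrE// ltW.
Qed.

End trace.

(** * Norms of dyadically majorized functions *)

Section ereal_series.
Local Open Scope ereal_scope.
Variable R : realType.
Implicit Types (x y : \bar R) (r : R).

Lemma lee_poweR x y r : (0 <= r)%R -> 0 <= x -> x <= y -> x `^ r <= y `^ r.
Proof.
move=> r0 x0 xy; apply: gt0_ler_poweR => //; rewrite in_itv/= ?leey ?x0//.
by rewrite (le_trans x0 xy).
Qed.

Lemma poweRK x r : (0 < r)%R -> 0 <= x -> (x `^ r^-1) `^ r = x.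
Proof. by move=> r0 x0; rewrite -poweRrM mulVf ?gt_eqF// poweRe1. Qed.

Lemma poweRVK x r : (0 < r)%R -> 0 <= x -> (x `^ r) `^ r^-1 = x.
Proof. by move=> r0 x0; rewrite -poweRrM divff ?gt_eqF// poweRe1. Qed.

Lemma lee_poweR_inv x y r : (0 < r)%R -> 0 <= x -> 0 <= y -> x `^ r <= y -> x <= y `^ r^-1.
Proof.
move=> r0 x0 y0 h; rewrite -[leLHS](poweRVK r0 x0); apply: lee_poweR => //.
- by rewrite invr_ge0 ltW.
- exact: poweR_ge0.
Qed.

Lemma nneseries_le (u : nat -> \bar R) y : (forall k, 0 <= u k) ->
  (forall n, \sum_(k < n) u k <= y) -> \sum_(k <oo) u k <= y.
Proof.
move=> u0 uy; apply: lime_le; first by apply: is_cvg_nneseries.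
by apply: nearW => n; rewrite big_mkord.
Qed.

Lemma le_nneseries_part (u : nat -> \bar R) n : (forall k, 0 <= u k) ->
  \sum_(k < n) u k <= \sum_(k <oo) u k.
Proof.
by move=> u0; rewrite -(big_mkord xpredT u); apply: nneseries_lim_ge.
Qed.

Lemma le_nneseries_term (u : nat -> \bar R) n : (forall k, 0 <= u k) ->
  u n <= \sum_(k <oo) u k.
Proof.
move=> u0; apply: le_trans (le_nneseries_part n.+1 u0).
by rewrite big_ord_recr/= leeDr// sume_ge0.
Qed.

Lemma powR_subadd (x y r : R) : (0 < r <= 1)%R -> (0 <= x)%R -> (0 <= y)%R ->
  ((x + y) `^ r <= x `^ r + y `^ r)%R.
Proof.
move=> /andP[r0 r1] x0 y0.
have [xy0|xyn] := eqVneq (x + y)%R 0%R.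
  by rewrite xy0 powR0 ?gt_eqF// addr_ge0 ?powR_ge0.
have xyp : (0 < x + y)%R by rewrite lt_neqAle eq_sym xyn addr_ge0.
(* The share of u in the sum lies in [0, 1], so raising it to a power r <= 1 can only increase
   it. *)
have key (u : R) : (0 <= u)%R -> (u <= x + y)%R -> (u / (x + y) * (x + y) `^ r <= u `^ r)%R.
  move=> u0 uxy; have t0 : (0 <= u / (x + y))%R by rewrite divr_ge0// ltW.
  have t1 : (u / (x + y) <= 1)%R by rewrite ler_pdivrMr// mul1r.
  have -> : (u `^ r = (u / (x + y)) `^ r * (x + y) `^ r)%R.
    by rewrite -powRM ?(ltW xyp)// divfK.
  rewrite ler_wpM2r ?powR_ge0//.
  have [->|tn0] := eqVneq (u / (x + y))%R 0%R; first exact: powR_ge0.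
  have tp : (0 < u / (x + y))%R by rewrite lt_neqAle eq_sym tn0.
  have := @powR_exp_le R (u / (x + y))%R (-1)%R (- r)%R tp t1.
  by rewrite !opprK powRr1//; apply; rewrite lerN2.
have hx := key x x0; have hy := key y y0.
have : (x / (x + y) * (x + y) `^ r + y / (x + y) * (x + y) `^ r = (x + y) `^ r)%R.
  by rewrite -mulrDl -mulrDl divff// mul1r.
have := hx; have := hy; rewrite lerDl lerDr => /(_ x0) h1 /(_ y0) h2 <-.
by rewrite addrC [X in (_ <= X)%R]addrC; exact: lerD.
Qed.

Lemma poweR_subadd x y r : (0 < r <= 1)%R -> 0 <= x -> 0 <= y ->
  (x + y) `^ r <= x `^ r + y `^ r.
Proof.
move=> r01; have /andP[r0 r1] := r01.
case: x => [x| |]; case: y => [y| |]//= x0 y0.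
- by rewrite !lee_fin in x0 y0; rewrite lee_fin powR_subadd.
- by rewrite gt_eqF//= leey.
- by rewrite gt_eqF//= leey.
- by rewrite gt_eqF//= leey.
Qed.

Lemma nneseries_poweR (u : nat -> \bar R) r : (0 < r <= 1)%R -> (forall k, 0 <= u k) ->
  (\sum_(k <oo) u k) `^ r <= \sum_(k <oo) u k `^ r.
Proof.
move=> r01 u0; have /andP[r0 r1] := r01.
have S0 : 0 <= \sum_(k <oo) u k `^ r by apply: nneseries_ge0 => k _ _; exact: poweR_ge0.
rewrite -[leRHS](poweRK r0 S0); apply: lee_poweR; [exact: ltW|exact: nneseries_ge0|].
apply: nneseries_le => // n.
apply: lee_poweR_inv => //; first by apply: sume_ge0.
apply: le_trans (le_nneseries_part n (fun k => poweR_ge0 (u k) r)).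
elim: n => [|n IH]; first by rewrite !big_ord0 poweR0r ?gt_eqF.
rewrite !big_ord_recr/=; apply: le_trans (poweR_subadd r01 _ _) _ => //.
  by apply: sume_ge0.
by rewrite leeD2r.
Qed.

(** Jensen in each row with the weights [K i k] gives C^(q - 1); exchanging the sums and using the
    columns gives the last factor C. *)
Lemma schur_test (K : nat -> nat -> R) (b : nat -> R) (q C : R) : (1 < q)%R -> (0 <= C)%R ->
  (forall i k, 0 <= K i k)%R -> (forall k, 0 <= b k)%R ->
  (forall i, \sum_(k <oo) (K i k)%:E <= C%:E) -> (forall k, \sum_(i <oo) (K i k)%:E <= C%:E) ->
  \sum_(i <oo) (\sum_(k <oo) (K i k * b k)%:E) `^ q <= (C `^ q)%:E * \sum_(k <oo) (b k `^ q)%:E.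
Proof.
move=> q1 C0 K0 b0 rows cols.
have q0 : (0 < q)%R by exact: lt_trans q1.
have Kb0 i k : 0 <= (K i k * b k `^ q)%:E by rewrite lee_fin mulr_ge0 ?powR_ge0.
have step i : (\sum_(k <oo) (K i k * b k)%:E) `^ q <= (C `^ (q - 1))%:E * \sum_(k <oo) (K i k * b k `^ q)%:E.
  have S0 : 0 <= (C `^ (q - 1))%:E * \sum_(k <oo) (K i k * b k `^ q)%:E.
    by rewrite mule_ge0// ?lee_fin ?powR_ge0// nneseries_ge0.
  rewrite -[leRHS](poweRK q0 S0); apply: lee_poweR; [exact: ltW| |].
    by apply: nneseries_ge0 => k _ _; rewrite lee_fin mulr_ge0.
  apply: nneseries_le => [k|n]; first by rewrite lee_fin mulr_ge0.
  apply: lee_poweR_inv => //; first by apply: sume_ge0 => k _; rewrite lee_fin mulr_ge0.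
  rewrite sumEFin poweR_EFin.
  apply: le_trans (lee_wpmul2l _ (le_nneseries_part n (Kb0 i))); last by rewrite lee_fin powR_ge0.
  rewrite sumEFin -EFinM lee_fin.
  have := @jensen_powR R q n (fun k => K i k) (fun k => b k) q1 (fun k => K0 i k) (fun k => b0 k).
  move=> /le_trans; apply; rewrite ler_wpM2r//.
    by apply: sumr_ge0 => k _; rewrite mulr_ge0 ?powR_ge0.
  apply: ge0_ler_powR; rewrite ?nnegrE ?subr_ge0 ?(ltW q1)//.
    by apply: sumr_ge0.
  have := le_trans (le_nneseries_part n (fun k => (K0 i k : 0 <= (K i k)%:E))) (rows i).
  by rewrite sumEFin lee_fin.
apply: (@le_trans _ _ (\sum_(i <oo) (C `^ (q - 1))%:E * \sum_(k <oo) (K i k * b k `^ q)%:E)).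
  by apply: lee_nneseries => i *; [exact: poweR_ge0|exact: step].
rewrite nneseriesZl; last by move=> i _; exact: nneseries_ge0.
rewrite nneseries_interchange//.
apply: (@le_trans _ _ ((C `^ (q - 1))%:E * \sum_(k <oo) C%:E * (b k `^ q)%:E)).
  apply: lee_wpmul2l; first by rewrite lee_fin powR_ge0.
  apply: lee_nneseries => k *; first by apply: nneseries_ge0.
  under eq_eseriesr do rewrite mulrC EFinM.
  rewrite nneseriesZl; last by move=> i _; rewrite lee_fin.
  by rewrite muleC lee_wpmul2r// lee_fin powR_ge0.
rewrite nneseriesZl; last by move=> i _; rewrite lee_fin powR_ge0.
rewrite muleA -EFinM.
have [->|Cn0] := eqVneq C 0%R; first by rewrite mulr0 powR0 ?gt_eqF.
rewrite -[X in (_ * X)%R]powRr1// -powRD ?subrK//.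
by rewrite Cn0 implybT.
Qed.

(** With truncated subtraction the exponent is |n - m|. *)
Lemma two_sided_geometric (rho : R) n N : (0 < rho)%R -> (rho < 1)%R ->
  (\sum_(m < N) rho ^+ ((n - m) + (m - n)) <= 2 / (1 - rho))%R.
Proof.
move=> r0 r1; have r1' : (0 < 1 - rho)%R by rewrite subr_gt0.
rewrite ler_pdivlMr// mulrC.
(* An upper bound for (1 - rho) times the partial sum that telescopes, increasing up to n and then
   approaching 1 + rho. *)
pose phi m : R := (if (m <= n)%N then rho ^+ (n.+1 - m) else 1 + rho - rho ^+ (m - n))%R.
have H : ((1 - rho) * \sum_(m < N) rho ^+ ((n - m) + (m - n)) <= phi N)%R.
  elim: N => [|N IH].
    by rewrite big_ord0 mulr0 /phi leq0n exprn_ge0// ltW.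
  rewrite big_ord_recr/= mulrDr; apply: le_trans (lerD IH (lexx _)) _.
  rewrite /phi; have [Nn|nN] := ltnP N n.
    have z : (N - n)%N = 0%N by apply/eqP; rewrite subn_eq0 ltnW.
    rewrite (ltnW Nn) z addn0 subSn ?(ltnW Nn)//.
    by rewrite subSS exprS; apply: eq_ler; ring.
  have [eN|nN'] := eqVneq N n.
    by rewrite eN leqnn subnn addn0 expr0 subSnn expr1; lra.
  have nN2 : (n < N)%N by rewrite ltn_neqAle eq_sym nN'.
  have z : (n - N)%N = 0%N by apply/eqP; rewrite subn_eq0 ltnW.
  rewrite leqNgt nN2/= z add0n.
  by rewrite subSn ?(ltnW nN2)// exprS; apply: eq_ler; ring.
apply: le_trans H _; rewrite /phi; case: ifP => _.
  by apply: (@le_trans _ _ 1%R); [rewrite exprn_ile1// ltW|lra].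
have : (0 <= rho ^+ (N - n))%R by rewrite exprn_ge0// ltW.
lra.
Qed.

(** The sum is dominated by the term m = n: for m <= n the term is dy m^(al - be), for m > n it
    decays like dy m^al, so it falls off geometrically on both sides with ratio at most 2^(-min(al,
    be - al)). *)
Lemma dyadic_kernel_sum (al be : R) : (0 < al)%R -> (al < be)%R -> exists2 C : R, (0 <= C)%R &
  forall n, \sum_(m <oo) ((dy m `^ al / dy (minn m n) `^ be)%R)%:E <= (C * (dy n `^ (be - al))^-1)%:E.
Proof.
move=> al0 albe.
have d0 m : (0 < dy m :> R)%R := dy_gt0 R m.
pose e := (Num.min al (be - al))%R.
have e0 : (0 < e)%R by rewrite /e lt_min al0 subr_gt0.
pose rho : R := (2^-1 `^ e)%R.
have r0 : (0 < rho)%R by rewrite powR_gt0// invr_gt0.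
have r1 : (rho < 1)%R.
  have : (2^-1 `^ e < 1 `^ e :> R)%R.
    by apply: gt0_ltr_powR; rewrite ?nnegrE ?invr_ge0// invf_lt1// ltr1n.
  by rewrite powR1.
exists (2 / (1 - rho))%R; first by rewrite divr_ge0// subr_ge0 ltW.
move=> n; apply: nneseries_le => [m|N]; first by rewrite lee_fin divr_ge0 ?powR_ge0.
rewrite sumEFin lee_fin.
apply: (@le_trans _ _ (\sum_(m < N) rho ^+ ((n - m) + (m - n)) * (dy n `^ (be - al))^-1)%R); last first.
  by rewrite -mulr_suml ler_wpM2r ?invr_ge0 ?powR_ge0// two_sided_geometric.
apply: ler_sum => m _.
rewrite ler_pdivlMr ?powR_gt0//.
have dyp k (u : R) : (e <= u)%R -> (dy k `^ u <= rho ^+ k)%R.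
  move=> eu; have -> : (rho ^+ k = dy k `^ e)%R.
    elim: k => [|k IH]; first by rewrite /dy !expr0 powR1.
    by rewrite exprS IH dyS powRM ?(ltW (d0 k)) ?invr_ge0// mulrC.
  have := @powR_exp_le R (dy k) (- u) (- e) (d0 k) (dy_le1 R k).
  by rewrite !opprK; apply; rewrite lerN2.
have bea : (0 <= be - al)%R by rewrite subr_ge0 ltW.
have dD u v k : (dy k `^ (u + v) = dy k `^ u * dy k `^ v :> R)%R.
  by rewrite powRD// (gt_eqF (d0 k)) implybT.
have [mn|nm] := leqP m n.
- have -> : ((n - m) + (m - n) = n - m)%N by apply/eqP; rewrite -[X in _ == X]addn0 eqn_add2l subn_eq0.
  apply: le_trans (_ : (dy (n - m) `^ (be - al) <= _)%R); last by apply: dyp; rewrite /e ge_min lexx orbT.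
  rewrite dyB// powRM ?(ltW (d0 _)) ?invr_ge0 ?(ltW (d0 _))//.
  have -> : ((dy m)^-1 `^ (be - al) = (dy m `^ (be - al))^-1 :> R)%R.
    by rewrite -powRN -powR_inv1 ?(ltW (d0 _))// -powRrM mulN1r.
  have -> : (dy m `^ be = dy m `^ (be - al) * dy m `^ al :> R)%R by rewrite -dD subrK.
  apply: eq_ler; field; rewrite !gt_eqF// ?powR_gt0//.
- have -> : ((n - m) + (m - n) = m - n)%N by apply/eqP; rewrite -[X in _ == X]add0n eqn_add2r subn_eq0 ltnW.
  apply: le_trans (_ : (dy (m - n) `^ al <= _)%R); last by apply: dyp; rewrite /e ge_min lexx.
  rewrite dyB ?(ltnW nm)// powRM ?(ltW (d0 _)) ?invr_ge0 ?(ltW (d0 _))//.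
  have -> : ((dy n)^-1 `^ al = (dy n `^ al)^-1 :> R)%R.
    by rewrite -powRN -powR_inv1 ?(ltW (d0 _))// -powRrM mulN1r.
  have -> : (dy n `^ be = dy n `^ (be - al) * dy n `^ al :> R)%R by rewrite -dD subrK.
  apply: eq_ler; field; rewrite !gt_eqF// ?powR_gt0//.
Qed.

End ereal_series.

Section upper_bound.
Local Open Scope complex_scope.
Variables (R : realType) (p : R).
Hypothesis p1 : 1 < p.
Local Notation leb := (@lebesgue_measure R).
Local Notation leb2 := (leb \x leb)%E.
Variable c : nat -> R.
Hypothesis c0 : forall k, 0 <= c k.

Let p0 : 0 < p. Proof. exact: lt_trans ltr01 p1. Qed.
Let d0 k : 0 < dy k :> R. Proof. exact: dy_gt0. Qed.

Let cd k : 0 <= dy k * c k. Proof. by rewrite mulr_ge0 ?(ltW (d0 k)). Qed.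

(* The profile at distance [2 ^- n] from the point 1. *)
Definition profile (n : nat) : \bar R := (\sum_(k <oo) (dy k * c k / dy (minn k n))%:E)%E.

Definition majorant (x : R) : \bar R :=
  (\sum_(k <oo) (dy k * c k / Num.max (dy k) x)%:E)%E.

(** A model for the tent integral with vertex at distance about 2^-i from 1. At distance about 2^-m
    from the vertex the area is of order dy m^2, the density of order 1 / dy m, and |1 - z| at least
    of order dy (min i m). *)
Definition profile_sum (i : nat) : \bar R :=
  (\sum_(m <oo) (dy m)%:E * profile (minn i m) `^ p)%E.

Lemma profile_ge0 n : (0 <= profile n)%E.
Proof. by apply: nneseries_ge0 => k *; rewrite lee_fin divr_ge0 ?cd ?(ltW (d0 _)). Qed.

Lemma profile_sum_ge0 n : (0 <= profile_sum n)%E.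
Proof.
by apply: nneseries_ge0 => k *; rewrite mule_ge0 ?poweR_ge0// lee_fin ltW.
Qed.

Lemma majorant_profile x n : dy n / 4 <= x -> (majorant x <= 4%:E * profile n)%E.
Proof.
move=> nx; rewrite /profile -nneseriesZl; last first.
  by move=> k *; rewrite lee_fin divr_ge0 ?cd ?(ltW (d0 _)).
apply: lee_nneseries => [k *|k *].
  by rewrite lee_fin divr_ge0 ?cd// le_max (ltW (d0 k)).
rewrite -EFinM lee_fin mulrCA ler_wpM2l ?mulr_ge0 ?(ltW (d0 k))//.
rewrite -[4]invrK -invfM lef_pV2 ?posrE; last 2 first.
- by rewrite lt_max d0.
- by rewrite mulr_gt0// invr_gt0.
have h : dy (minn k n) <= Num.max (dy k) (dy n) :> R.
  by case: (leqP k n) => _; rewrite le_max lexx ?orbT.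
have := h; rewrite !le_max => /orP[h1|h1].
- by apply/orP; left; have := d0 k; lra.
- by apply/orP; right; lra.
Qed.

(** The tent is covered by discs about its vertex. 4^p comes from the comparison with [profile], and
    108 = 3 * 36 from the density 3 / dy m and the area bound 36 dy m^2. *)
Lemma tent_integral_le (g : R[i] -> R[i]) (t : R) (i : nat) :
  (forall z, disc 1 z -> ((normc (g z))%:E <= majorant (normc (1 - z)%R))%E) ->
  dy i < normc (1 - cis t)%R ->
  (tent_integral p g t <= (4 `^ p * 108)%:E * profile_sum i)%E.
Proof.
move=> gG di; set xi := cis t; have xi1 : normc xi = 1 := normc_cis t.
rewrite /tent_integral /area_integral.
set I := (\int[_]_(_ in _) _)%E.
have I0 : (0 <= I)%E.
  by apply: integral_ge0 => w /= /density_ge0 h; rewrite lee_fin.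
apply: (@le_trans _ _ I).
  rewrite -[leRHS]mul1e; apply: lee_wpmul2r => //.
  by rewrite lee_fin invf_le1 ?pi_gt0// (le_trans _ (@pi_ge2 R))// ler1n.
pose E m := plane_disc xi (3 * dy m).
pose v m := ((4 `^ p * (3 / dy m))%:E * profile (minn i m) `^ p)%E.
have v0 m : (0 <= v m)%E by rewrite mule_ge0 ?poweR_ge0// lee_fin; have h := d0 m; nneg.
apply: (@le_trans _ _ (\sum_(m <oo) v m * leb2 (E m))%E).
  apply: integral_le_step => //.
  - by move=> m; exact: measurable_plane_disc.
  - by move=> w /= /density_ge0 h; rewrite lee_fin.
  - move=> w /=; set z := w.1 +i* w.2 => Gz.
    have [z1 zx] := Gamma_halfE xi1 Gz.
    have zx0 : 0 < normc (z - xi).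
      rewrite lt_neqAle normc_ge0 andbT eq_sym; apply/eqP => /eq0_normc/eqP.
      by rewrite subr_eq0 => /eqP zE; move: z1; rewrite zE xi1 ltxx.
    have zx2 : normc (z - xi) / 2 <= 1.
      by have := le_normcD z (- xi); rewrite normcN xi1; lra.
    have zx20 : 0 < normc (z - xi) / 2 by rewrite divr_gt0.
    have [m /andP[m1 m2]] := dy_scale zx20 zx2.
    have mE : E m w.
      by rewrite /E /plane_disc /mkset -/z; have := d0 m; lra.
    apply: le_trans (le_nneseries_term m _); last first.
      by move=> k; rewrite mule_ge0// lee_fin.
    rewrite indicE mem_set// mule1 /v.
    have h1z : normc (z - xi) / 3 <= normc (1 - z)%R.
      have := ler_normcB (1 : R[i]) z; rewrite normc1 => h.
      by apply: le_trans h; lra.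
    (* Nontangentiality gives |z - xi| <= 3 |1 - z|: inside its tent, z cannot be much closer to 1
       than the vertex is. *)
    have hd : normc (1 - xi)%R <= 4 * normc (1 - z)%R.
      have := normc_tri z (1 : R[i]) xi; lra.
    have hmin : dy (minn i m) / 4 <= normc (1 - z)%R.
      rewrite dyS in m1.
      by case: (leqP i m) => _; lra.
    have := le_trans (gG z z1) (majorant_profile hmin).
    set P := profile _ => hP.
    have den : (1 - normc z ^+ 2)^-1 <= 3 / dy m.
      rewrite -[3]invrK -invfM lef_pV2 ?posrE; last 2 first.
      + by rewrite subr_gt0 -(expr1n _ 2) ltr_sqr ?nnegrE ?normc_ge0.
      + by rewrite mulr_gt0// invr_gt0.
      have n0 := normc_ge0 z.
      have gen (x : R) : 0 <= x -> x < 1 -> 1 - x <= 1 - x ^+ 2.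
        by move=> x0 x1; rewrite lerD2l lerN2 expr2 ler_piMr// ltW.
      have := gen _ n0 z1; rewrite dyS in m1.
      by apply: le_trans; have := d0 m; lra.
    have h1 : ((normc (g z) `^ p)%:E <= (4 `^ p)%:E * P `^ p)%E.
      rewrite -poweR_EFin -[X in (_ <= X * _)%E]poweR_EFin -poweRM ?lee_fin ?profile_ge0//.
      by apply: lee_poweR => //; [exact: ltW|rewrite lee_fin normc_ge0].
    have -> : ((4 `^ p * (3 / dy m))%:E * P `^ p = ((4 `^ p)%:E * P `^ p) * (3 / dy m)%:E)%E.
      by rewrite EFinM muleAC.
    rewrite EFinM; apply: lee_pmul => //.
    - by rewrite lee_fin powR_ge0.
    - rewrite lee_fin invr_ge0 subr_ge0 -(expr1n _ 2) ler_sqr ?nnegrE ?normc_ge0//.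
      exact: ltW.
rewrite /profile_sum -nneseriesZl; last first.
  by move=> m *; rewrite mule_ge0 ?poweR_ge0// lee_fin ltW.
apply: lee_nneseries => m *; first by rewrite mule_ge0.
have m3 : 0 < 3 * dy m :> R by rewrite mulr_gt0.
apply: le_trans (lee_wpmul2l (v0 m) (plane_disc_le xi m3)) _.
rewrite /v muleAC -EFinM muleA -EFinM; apply: lee_wpmul2r; first exact: poweR_ge0.
by rewrite lee_fin; apply: eq_ler; field; rewrite gt_eqF.
Qed.

(** The arc around 1 appears at both ends of [0, 2 pi]; 16 comes from sin (t / 2) >= t / 16. *)
Lemma arc_measure (i : nat) : exists2 E : set R, measurable E &
  [/\ (leb E <= (32 * dy i)%:E)%E &
  forall t, 0 <= t <= pi *+ 2 -> normc (1 - cis t)%R <= dy i *+ 2 -> E t].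
Proof.
have i16 : 0 < 16 * dy i :> R by rewrite mulr_gt0.
exists (`[0, 16 * dy i] `|` `[pi *+ 2 - 16 * dy i, pi *+ 2])%classic.
  by apply: measurableU; exact: measurable_itv.
split.
  apply: le_trans (measureU2 _ _ _) _; [exact: measurable_itv|exact: measurable_itv|].
  have m1 : (leb `[0%R, (16 * dy i)%R]%classic <= (16 * dy i)%:E)%E.
    by rewrite lebesgue_measure_itv/= lte_fin i16 -EFinB subr0.
  have m2 : (leb `[(pi *+ 2 - 16 * dy i)%R, (pi *+ 2)%R]%classic <= (16 * dy i)%:E)%E.
    rewrite lebesgue_measure_itv/= lte_fin ltrBlDr ltrDl i16 -EFinB lee_fin; lra.
  have -> : (32 * dy i)%:E = ((16 * dy i)%:E + (16 * dy i)%:E)%E :> \bar R.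
    by rewrite -EFinD; congr _%:E; lra.
  exact: leeD m1 m2.
move=> t /andP[t0 t2]; rewrite -{1}cis0 normc_cisB add0r.
have -> : - t / 2 = - (t / 2) by rewrite mulNr.
rewrite sinN normrN lerMn2r/= => h.
have {h} h := le_trans (ler_norm _) h.
have pi2 := @pi_ge2 R.
have [tp|tp] := leP t pi.
- left; rewrite /= in_itv/= t0/=.
  have := @sin_lower R (t / 2); rewrite divr_ge0// ler_pM2r// tp => /(_ isT).
  lra.
- right; rewrite /= in_itv/= t2 andbT.
  have := @sin_lower R ((pi *+ 2 - t) / 2).
  have -> : (pi *+ 2 - t) / 2 = pi - t / 2 by rewrite mulr2n; lra.
  rewrite sinB sinpi cospi mul0r mulN1r opprK add0r.
  have -> : 0 <= pi - t / 2 <= pi / 2 by rewrite mulr2n in t2; apply/andP; split; lra.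
  move=> /(_ isT) h2; rewrite mulr2n; lra.
Qed.

End upper_bound.

Section upper_bound_norm.
Local Open Scope complex_scope.
Variables (R : realType) (p q : R).
Hypotheses (p1 : 1 < p) (q1 : 1 < q) (s1 : p^-1 + q^-1 < 1).
Local Notation leb := (@lebesgue_measure R).
Local Notation s := (p^-1 + q^-1).

Let p0 : 0 < p. Proof. exact: lt_trans ltr01 p1. Qed.
Let q0 : 0 < q. Proof. exact: lt_trans ltr01 q1. Qed.
Let d0 k : 0 < dy k :> R. Proof. exact: dy_gt0. Qed.
Local Notation ell := (1 - p^-1).

(* [dy k `^ s * c k] is transported from the scales of the majorant to those of the arc. *)
Lemma profile_sum_le : exists2 C : R, 0 <= C & forall (c : nat -> R) i,
  (forall k, 0 <= c k) ->
  (profile_sum p c i `^ p^-1 <= C%:E * \sum_(k <oo) (dy k `^ (1 - s) / dy (minn i k) `^ ell * (dy k `^ s * c k))%:E)%E.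
Proof.
have ip0 : 0 < p^-1 by rewrite invr_gt0.
have ip1 : p^-1 < 1 by rewrite invf_lt1.
have [C C0 HC] := dyadic_kernel_sum ip0 ip1.
exists C => // c i c0.
have cd k : 0 <= dy k * c k by rewrite mulr_ge0 ?(ltW (d0 k)).
(* Since 1/p <= 1 the root enters the sum over m, and the expression becomes linear in c; the sum
   over m is then a dyadic kernel with exponents 1/p and 1. *)
apply: le_trans (nneseries_poweR _ _) _; first by rewrite ip0 ltW.
  by move=> m; rewrite mule_ge0 ?poweR_ge0// lee_fin ltW.
have E m : (((dy m)%:E * profile c (minn i m) `^ p) `^ p^-1 =
    \sum_(k <oo) ((dy m `^ p^-1 / dy (minn m (minn i k)) `^ 1) * (dy k * c k))%:E)%E.
  rewrite poweRM ?lee_fin ?(ltW (d0 m)) ?poweR_ge0// poweRVK ?profile_ge0//.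
  rewrite poweR_EFin /profile -nneseriesZl; last first.
    by move=> k *; rewrite lee_fin divr_ge0 ?cd ?(ltW (d0 _)).
  apply: eq_eseriesr => k _; rewrite -EFinM; congr _%:E.
  by rewrite powRr1 ?(ltW (d0 _))// [minn k _](minnA k) [minn _ m]minnC [minn k i]minnC; ring.
rewrite (eq_eseriesr (fun m _ => E m)) nneseries_interchange; last first.
  by move=> m k; rewrite lee_fin mulr_ge0 ?cd// divr_ge0 ?powR_ge0.
rewrite -nneseriesZl; last first.
  by move=> k *; rewrite lee_fin; have := c0 k => ck; nneg.
apply: lee_nneseries => k *.
  by apply: nneseries_ge0 => m *; rewrite lee_fin mulr_ge0 ?cd// divr_ge0 ?powR_ge0.
under eq_eseriesr do rewrite mulrC EFinM.
rewrite nneseriesZl; last by move=> m *; rewrite lee_fin divr_ge0 ?powR_ge0.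
apply: le_trans (lee_wpmul2l _ (HC (minn i k))) _; first by rewrite lee_fin cd.
rewrite -!EFinM lee_fin; apply: eq_ler.
have -> : dy k `^ (1 - s) / dy (minn i k) `^ ell * (dy k `^ s * c k) =
   (dy k `^ (1 - s) * dy k `^ s) / dy (minn i k) `^ ell * c k by ring.
rewrite -powRD; last by rewrite (gt_eqF (d0 k)) implybT.
rewrite subrK powRr1 ?(ltW (d0 _))//; ring.
Qed.

(** A Schur test on the kernel K i k = dy i^(1/q) dy k^(1 - s) / dy (min i k)^(1 - 1/p). The factor
    outside each row or column sum cancels the power left by [dyadic_kernel_sum]; positivity of 1 -
    s for the rows and 1/q < 1 - 1/p for the columns both say s < 1. *)
Lemma profile_sum_lq : exists2 C : R, 0 <= C & forall c : nat -> R,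
  (forall k, 0 <= c k) ->
  (\sum_(i <oo) (dy i)%:E * profile_sum p c i `^ (q / p) <=
     C%:E * \sum_(k <oo) ((dy k `^ s * c k) `^ q)%:E)%E.
Proof.
have iq0 : 0 < q^-1 by rewrite invr_gt0.
have [C1 C10 H1] := profile_sum_le.
have s0 : 0 < 1 - s by rewrite subr_gt0.
have es : 1 - s < ell by rewrite ltrD2l ltrN2 ltrDl.
have eq_ : q^-1 < ell by move: s1; lra.
have [C2 C20 H2] := dyadic_kernel_sum s0 es.
have [C3 C30 H3] := dyadic_kernel_sum iq0 eq_.
pose C := C2 + C3.
have C00 : 0 <= C by rewrite addr_ge0.
pose K i k := dy i `^ q^-1 * (dy k `^ (1 - s) / dy (minn i k) `^ ell) : R.
have K0 i k : 0 <= K i k by rewrite /K; nneg.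
exists (C1 `^ q * C `^ q); first by nneg.
have rows i : (\sum_(k <oo) (K i k)%:E <= C%:E)%E.
  under eq_eseriesr do rewrite /K EFinM minnC.
  rewrite nneseriesZl; last by move=> *; rewrite lee_fin; nneg.
  apply: le_trans (lee_wpmul2l _ (H2 i)) _; first by rewrite lee_fin powR_ge0.
  rewrite -EFinM lee_fin.
  have -> : ell - (1 - s) = q^-1 by lra.
  by rewrite mulrCA divff ?gt_eqF ?powR_gt0// mulr1 /C lerDl.
have cols k : (\sum_(i <oo) (K i k)%:E <= C%:E)%E.
  have E i : (K i k)%:E = ((dy k `^ (1 - s))%:E * (dy i `^ q^-1 / dy (minn i k) `^ ell)%:E)%E.
    by rewrite /K -EFinM mulrCA.
  rewrite (eq_eseriesr (fun i _ => E i)).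
  rewrite nneseriesZl; last by move=> *; rewrite lee_fin; nneg.
  apply: le_trans (lee_wpmul2l _ (H3 k)) _; first by rewrite lee_fin powR_ge0.
  rewrite -EFinM lee_fin.
  have -> : ell - q^-1 = 1 - s by lra.
  by rewrite mulrCA divff ?gt_eqF ?powR_gt0// mulr1 /C lerDr.
move=> c c0.
have b0 k : 0 <= dy k `^ s * c k by have := c0 k => ck; nneg.
have := schur_test q1 C00 K0 b0 rows cols => hS.
rewrite EFinM -muleA.
apply: le_trans (lee_wpmul2l _ hS); last by rewrite lee_fin powR_ge0.
rewrite -nneseriesZl; last by move=> *; exact: poweR_ge0.
apply: lee_nneseries => i *; first by rewrite mule_ge0 ?poweR_ge0// lee_fin ltW.
have -> : ((dy i)%:E * profile_sum p c i `^ (q / p) = ((dy i `^ q^-1)%:E * profile_sum p c i `^ p^-1) `^ q)%E.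
  rewrite poweRM ?lee_fin ?powR_ge0 ?poweR_ge0// poweR_EFin -powRrM mulVf ?gt_eqF//.
  by rewrite powRr1 ?(ltW (d0 i))// -poweRrM mulrC.
rewrite -[X in (_ <= X * _)%E]poweR_EFin -poweRM ?lee_fin//; last first.
  by apply: nneseries_ge0 => k *; rewrite lee_fin mulr_ge0.
apply: lee_poweR; [exact: ltW|by rewrite mule_ge0 ?poweR_ge0// lee_fin powR_ge0|].
apply: le_trans (lee_wpmul2l _ (H1 c i c0)) _; first by rewrite lee_fin powR_ge0.
rewrite muleCA; apply: lee_wpmul2l; first by rewrite lee_fin.
rewrite -nneseriesZl; last by move=> k *; rewrite lee_fin; have := c0 k => ck; nneg.
apply: lee_nneseries => k *.
  by rewrite -EFinM lee_fin; have := c0 k => ck; nneg.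
by rewrite -EFinM lee_fin; apply: eq_ler; rewrite /K; ring.
Qed.

Lemma AT_norm_majorant : exists2 C : R, 0 <= C &
  forall (c : nat -> R) (g : R[i] -> R[i]), (forall k, 0 <= c k) ->
  (forall z, disc 1 z -> ((normc (g z))%:E <= majorant c (normc (1 - z)%R))%E) ->
  (AT_norm p q g `^ q <= C%:E * \sum_(k <oo) ((dy k `^ s * c k) `^ q)%:E)%E.
Proof.
have qp0 : 0 <= q / p by rewrite divr_ge0 ?(ltW p0) ?(ltW q0).
have [C C0 HC] := profile_sum_lq.
pose K := (4 `^ p * 108) `^ (q / p) * 32 : R.
have K0 : 0 <= K by rewrite mulr_ge0 ?powR_ge0.
exists (K * C); first by rewrite mulr_ge0.
move=> c g c0 gG.
have HE0 i : exists E : set R, measurable E /\ (leb E <= (32 * dy i)%:E)%E /\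
    forall t, 0 <= t <= pi *+ 2 -> normc (1 - cis t)%R <= dy i *+ 2 -> E t.
  by have [E mE [E1 E2]] := @arc_measure R i; exists E.
have [E HE] := choice HE0.
pose v i := (((4 `^ p * 108)%:E * profile_sum p c i) `^ (q / p))%E.
(* At t = 0 and t = 2 pi the vertex is 1 itself and belongs to no dyadic scale; index 0 gives this
   null set the value +oo, and the scales are shifted by one. *)
pose E' i : set R := if i is j.+1 then E j else [set 0; pi *+ 2].
pose v' i : \bar R := if i is j.+1 then v j else +oo%E.
have v0 i : (0 <= v i)%E by exact: poweR_ge0.
have v'0 i : (0 <= v' i)%E by case: i => [|i]; rewrite /= ?leey.
have mE' i : measurable (E' i).
  by case: i => [|i] /=; [exact: measurableU|exact: (HE i).1].
have E'0 : leb (E' 0%N) = 0%E.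
  apply/eqP; rewrite eq_le measure_ge0 andbT.
  apply: le_trans (measureU2 _ _ _) _ => //.
  have h (x : R) : (leb [set x] <= 0)%E by rewrite lebesgue_measure_set1.
  by rewrite -[leRHS](adde0 0%E); exact: leeD (h _) (h _).
rewrite AT_normqE//.
apply: (@le_trans _ _ (\sum_(i <oo) v' i * leb (E' i))%E).
  apply: integral_le_step => //.
  - by move=> t _; exact: poweR_ge0.
  - move=> t; rewrite /= in_itv/= => /andP[t0 t2].
    have vE0 k : (0 <= v' k * (\1_(E' k) t)%:E)%E by rewrite mule_ge0// lee_fin.
    have [Et|nEt] := pselect (E' 0%N t).
      apply: le_trans (le_nneseries_term 0 vE0).
      by rewrite indicE mem_set// mule1 leey.
    have tt : 0 < t < pi *+ 2.
      apply/andP; split; rewrite lt_neqAle ?t0 ?t2 andbT; apply/eqP => e; apply: nEt.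
        by left; rewrite /= e.
      by right.
    have d1 : 0 < normc (1 - cis t)%R / 2.
      rewrite divr_gt0// lt_neqAle normc_ge0 andbT eq_sym; apply/eqP => /eq0_normc/eqP.
      by rewrite subr_eq0 eq_sym (negbTE (cis_neq1 tt)).
    have d2 : normc (1 - cis t)%R / 2 <= 1.
      by have := le_normcD (1 : R[i]) (- cis t); rewrite normcN normc1 normc_cis; lra.
    have [i /andP[i1 i2]] := dy_scale d1 d2.
    have [_ [_ HEi]] := HE i.
    have Eit : E i t by apply: HEi; rewrite ?t0 ?t2// mulr2n; lra.
    apply: le_trans (le_nneseries_term i.+1 vE0).
    rewrite /= indicE mem_set// mule1; apply: lee_poweR => //.
      exact: tent_integral_ge0.
    by apply: tent_integral_le => //; rewrite dyS in i1; lra.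
have sum0 : (0 <= \sum_(i <oo) (dy i)%:E * profile_sum p c i `^ (q / p))%E.
  by apply: nneseries_ge0 => i *; rewrite mule_ge0 ?poweR_ge0// lee_fin ltW.
rewrite EFinM -muleA.
apply: le_trans (lee_wpmul2l _ (HC c c0)); last by rewrite lee_fin.
rewrite -nneseriesZl; last by move=> i *; rewrite mule_ge0 ?poweR_ge0// lee_fin ltW.
apply: nneseries_le => [k|n]; first by rewrite mule_ge0.
have u0 i : (0 <= K%:E * ((dy i)%:E * profile_sum p c i `^ (q / p)))%E.
  by rewrite !mule_ge0 ?poweR_ge0// lee_fin// ltW.
case: n => [|n]; first by rewrite big_ord0 nneseries_ge0.
rewrite big_ord_recl /= E'0 mule0 add0e.
apply: le_trans (le_nneseries_part n u0).
apply: lee_sum => i _; rewrite add0n.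
apply: le_trans (lee_wpmul2l (v0 i) (HE i).2.1) _.
rewrite /v poweRM ?lee_fin ?mulr_ge0 ?powR_ge0 ?profile_sum_ge0// poweR_EFin /K.
set P := (profile_sum _ _ _ `^ _)%E.
have -> : (((4 `^ p * 108) `^ (q / p))%:E * P * (32 * dy i)%:E =
   ((4 `^ p * 108) `^ (q / p) * (32 * dy i))%:E * P)%E by rewrite muleAC -EFinM.
by rewrite muleA -EFinM mulrA.
Qed.

End upper_bound_norm.

(** * The Hilbert operator *)

Section power_series_analytic.
Local Open Scope complex_scope.
Variable R : realType.
Implicit Types (c : nat -> R[i]) (z h : R[i]) (t r B : R).

Lemma natr_mul_expr_le t n : 0 <= t < 1 -> n%:R * t ^+ n <= (1 - t)^-1.
Proof.
move=> t01; have /andP[t0 t1] := t01; apply: le_trans (geometric_sum_le n t01).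
rewrite mulrC mulr_natr -[n in X in X <= _]card_ord -sumr_const.
apply: ler_sum => k _; apply: ler_wiXn2l; rewrite ?t0 ?(ltW t1)//.
by rewrite card_ord ltnW.
Qed.

(** With t = (1 + r) / 2 one has r < t^2, and n^2 t^(2n) is bounded, being the square of n t^n. *)
Lemma cvg_sqr_mul_expr r : 0 <= r < 1 -> cvgn (series (fun n => n%:R ^+ 2 * r ^+ n)).
Proof.
move=> /andP[r0 r1]; pose t := (1 + r) / 2.
have [t0 [t1 rt]] : 0 <= t /\ t < 1 /\ r < t ^+ 2.
  have h : 0 < (1 - r) ^+ 2 by rewrite exprn_gt0 ?subr_gt0.
  rewrite /t; split; [lra|split; [lra|]].
  by rewrite -subr_gt0; have -> : ((1 + r) / 2) ^+ 2 - r = (1 - r) ^+ 2 / 4; [field|rewrite divr_gt0].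
have -> : (fun n => n%:R ^+ 2 * r ^+ n) = (fun n => normc ((n%:R ^+ 2)%:C) * r ^+ n).
  by apply/funext => n; rewrite normc_real_ge0// exprn_ge0.
apply: (@bounded_coef_cvg _ (fun n => (n%:R ^+ 2)%:C) r (t ^+ 2) ((1 - t)^-1 ^+ 2)) => // k.
rewrite normc_real_ge0 ?exprn_ge0// -exprM mulnC exprM -exprMn.
rewrite lerXn2r ?nnegrE ?mulr_ge0 ?exprn_ge0 ?invr_ge0 ?subr_ge0 ?(ltW t1)//.
by apply: natr_mul_expr_le; rewrite t0.
Qed.

(** Induction on the identity E_(n+1) = (z + h) E_n + n z^(n-1) h^2 for the remainders. Both sides
    are multiplied by r^2 so that the exponent n - 2 does not occur. *)
Lemma taylor_pow_le z h r n : normc z <= r -> normc (z + h) <= r ->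
  normc ((z + h) ^+ n - z ^+ n - n%:R * z ^+ n.-1 * h) * r ^+ 2 <= n%:R ^+ 2 * normc h ^+ 2 * r ^+ n.
Proof.
move=> zr hr; have r0 : 0 <= r by exact: le_trans (normc_ge0 z) zr.
elim: n => [|n IH].
  by rewrite !expr0 !mul0r subrr subr0 normc0 mul0r expr0n !mul0r.
set E := _ - _ in IH.
have -> : (z + h) ^+ n.+1 - z ^+ n.+1 - n.+1%:R * z ^+ n.+1.-1 * h =
   (z + h) * E + n%:R * z ^+ n.-1 * h ^+ 2.
  rewrite /E; case: (n) => [|m] /=; last by rewrite !exprS -!natr1; ring.
  by rewrite !expr0 !expr1; ring.
apply: (@le_trans _ _ (r * (n%:R ^+ 2 * normc h ^+ 2 * r ^+ n) + n%:R * normc h ^+ 2 * r ^+ n.+1)).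
  apply: le_trans (ler_wpM2r _ (le_normcD _ _)) _; first exact: exprn_ge0.
  rewrite mulrDl; apply: lerD.
    rewrite normcM -[leLHS]mulrA; apply: ler_pM => //; try exact: normc_ge0.
    exact: mulr_ge0 (normc_ge0 _) (exprn_ge0 _ r0).
  rewrite normcM normcX.
  have : 0 <= normc h ^+ 2 by rewrite exprn_ge0 ?normc_ge0.
  move: (normc h ^+ 2) => H H0; rewrite normcM normcX.
  have -> : normc (n%:R : R[i]) = n%:R by rewrite -(rmorph_nat (real_complex R)) normc_real_ge0.
  case: (n) => [|m]; first by rewrite !mul0r.
  rewrite /= -!mulrA ler_wpM2l// mulrCA ler_wpM2l// -[m.+2]addn2 exprD ler_wpM2r ?exprn_ge0//.
  by rewrite lerXn2r ?nnegrE ?normc_ge0.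
have -> : n.+1%:R ^+ 2 * normc h ^+ 2 * r ^+ n.+1 =
  r * (n%:R ^+ 2 * normc h ^+ 2 * r ^+ n) + n%:R * normc h ^+ 2 * r ^+ n.+1 +
  (n%:R + 1) * normc h ^+ 2 * r ^+ n.+1 by rewrite -natr1 [r ^+ n.+1]exprS; ring.
rewrite lerDl; nneg.
Qed.

Variables (c : nat -> R[i]) (B : R).
Hypothesis cB : forall n, normc (c n) <= B.

Let B0 : 0 <= B. Proof. exact: le_trans (normc_ge0 _) (cB 0%N). Qed.

Lemma bounded_power_series_cvg z : disc 1 z -> cvgn (power_series c z).
Proof.
move=> z1; apply: abs_cvgc_series.
rewrite (_ : (fun k => normc (c k * z ^+ k)) = (fun k => normc (c k) * normc z ^+ k)); last first.
  by apply/funext => k; rewrite normcM normcX.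
by apply: (@bounded_coef_cvg _ c _ 1 B) => //; [exact: normc_ge0|move=> k; rewrite expr1n mulr1].
Qed.

(** The termwise quadratic remainders sum because n^2 r^n is summable; a quadratic remainder is
    differentiability with the termwise derivative. *)
Lemma bounded_power_series_taylor z r : normc z <= r -> 0 < r < 1 -> exists (L : R[i]) (K : R),
  0 <= K /\ forall h, normc (z + h) <= r ->
  normc (limn (power_series c (z + h)) - limn (power_series c z) - L * h) <= K * normc h ^+ 2.
Proof.
move=> zr /andP[r0 r1].
have cs : cvgn (series (fun n => n%:R ^+ 2 * r ^+ n)) by apply: cvg_sqr_mul_expr; rewrite (ltW r0).
set S := limn (series (fun n => n%:R ^+ 2 * r ^+ n)).
have S0 N : 0 <= series (fun n => n%:R ^+ 2 * r ^+ n) N <= S.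
  apply/andP; split; first by apply: sumr_ge0 => n _; rewrite mulr_ge0 ?exprn_ge0// ltW.
  apply: nondecreasing_cvgn_le => //; apply/nondecreasing_seqP => n.
  by rewrite /series/= big_nat_recr//= lerDl mulr_ge0 ?exprn_ge0// ltW.
pose d n := c n * (n%:R * z ^+ n.-1).
have cd : cvgn (series d).
  apply: abs_cvgc_series.
  have := is_cvg_seriesZ (k := B / r) cs.
  apply: series_le_cvg => n; first exact: normc_ge0.
    change (0 <= B / r * (n%:R ^+ 2 * r ^+ n)); nneg.
  rewrite /= /d !normcM normcX.
  have -> : normc (n%:R : R[i]) = n%:R by rewrite -(rmorph_nat (real_complex R)) normc_real_ge0.
  change (normc (c n) * (n%:R * normc z ^+ n.-1) <= B / r * (n%:R ^+ 2 * r ^+ n)).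
  case: n => [|n]; first by rewrite !mul0r mulr0 expr0n !mul0r mulr0.
  have -> : B / r * (n.+1%:R ^+ 2 * r ^+ n.+1) = B * (n.+1%:R ^+ 2 * r ^+ n).
    by rewrite [r ^+ n.+1]exprS [_ * (r * _)]mulrCA -[B / r * _]mulrA mulKf ?gt_eqF.
  rewrite ler_pM ?mulr_ge0 ?exprn_ge0 ?normc_ge0// ler_pM ?exprn_ge0 ?normc_ge0//.
    by rewrite expr2 ler_peMr// ler1n.
  by rewrite lerXn2r ?nnegrE ?normc_ge0// ltW.
exists (limn (series d)), (B * S / r ^+ 2); split.
  by have /andP[h1 h2] := S0 0%N; have h := le_trans h1 h2; nneg.
move=> h hr.
have z1 : disc 1 z by exact: le_lt_trans zr r1.
have h1 : disc 1 (z + h) by exact: le_lt_trans hr r1.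
have c1 := bounded_power_series_cvg z1; have c2 := bounded_power_series_cvg h1.
have cdh : series d N * h @[N --> \oo] --> limn (series d) * h.
  by apply: cvgMl; exact: cd.
apply: (normc_lim_le (cvgB (cvgB c2 c1) cdh) (cvg_cst _)).
apply: nearW => N.
rewrite /power_series /series !fctE /= mulr_suml -!sumrB.
apply: le_trans (normc_sum _ _ _) _.
have r20 : 0 < r ^+ 2 by rewrite exprn_gt0.
rewrite mulrAC ler_pdivlMr// mulr_suml.
have /andP[_ SN] := S0 N.
apply: le_trans (ler_wpM2r _ (ler_wpM2l B0 SN)); last by rewrite exprn_ge0 ?normc_ge0.
rewrite /series/= mulr_sumr mulr_suml; apply: ler_sum => n _.
have -> : c n * (z + h) ^+ n - c n * z ^+ n - d n * h = c n * ((z + h) ^+ n - z ^+ n - n%:R * z ^+ n.-1 * h).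
  by rewrite /d; ring.
rewrite normcM -[leLHS]mulrA -[leRHS]mulrA; apply: ler_pM; rewrite ?mulr_ge0 ?normc_ge0 ?exprn_ge0 ?(ltW r0)//.
by rewrite [leRHS]mulrAC; exact: taylor_pow_le.
Qed.

Lemma bounded_power_series_analytic : analytic (fun z => limn (power_series c z)).
Proof.
move=> z z1; set f := fun z => limn _.
pose r := (1 + normc z) / 2.
have n0 := normc_ge0 z.
have z1' : normc z < 1 by [].
have [r0 [r1 zr]] : 0 < r /\ r < 1 /\ normc z < r by rewrite /r; split; [|split]; lra.
have [|L [K [K0 H]]] := bounded_power_series_taylor (ltW zr); first by rewrite r0.
rewrite /derivable; apply/cvg_ex; exists L.
apply/cvgrPdist_lt => -[e ei]; rewrite ltcE/= => /andP[/eqP -> e0].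
pose dl := Num.min (r - normc z) (e / (K + 1)).
have dl0 : 0 < dl by rewrite lt_min subr_gt0 zr divr_gt0// ltr_wpDl.
exists (dl%:C) => /=; first by rewrite ltcR.
move=> h /=; rewrite /ball_/= sub0r normrN => hd h0.
have : normc h < dl by rewrite -ltcR.
rewrite lt_min => /andP[hd1 hd2].
change ((normc (L - h^-1 * (f (h * 1 + z) - f z)))%:C < e%:C); rewrite ltcR.
have hp : 0 < normc h.
  by rewrite lt_neqAle normc_ge0 andbT eq_sym; apply/eqP => /eq0_normc/eqP; rewrite (negbTE h0).
have -> : L - h^-1 * (f (h * 1 + z) - f z) = - (h^-1 * (f (z + h) - f z - L * h)).
  by rewrite mulr1 [h + z]addrC [in RHS]mulrBr opprB [L * h]mulrC mulKf.
rewrite normcN normcM normcV.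
have := H h; have -> : normc (z + h) <= r by rewrite (le_trans (le_normcD _ _))//; lra.
move=> /(_ isT) h1.
rewrite mulrC ltr_pdivrMr//; apply: le_lt_trans h1 _.
rewrite expr2 mulrA ltr_pM2r//.
apply: (@le_lt_trans _ _ ((K + 1) * normc h)); first by rewrite ler_wpM2r ?lerDl// ltW.
by rewrite mulrC -ltr_pdivlMr ?ltr_wpDl.
Qed.

End power_series_analytic.

(** * Test functions concentrated at a point b of the radius *)

Section test_function.
Local Open Scope complex_scope.
Variables (R : realType) (p q : R).
Hypotheses (p1 : 1 < p) (q1 : 1 < q) (s1 : p^-1 + q^-1 < 1).
Local Notation s := (p^-1 + q^-1).
Let q0 : 0 < q. Proof. exact: lt_trans ltr01 q1. Qed.

Definition test_coef (b : R) (k : nat) : R[i] := ((1 - b) `^ (1 - s) * b ^+ k)%:C.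

(** Taken as the sum of its series, so that expansion and analyticity come from the boundedness of
    the coefficients. *)
Definition test_fun (b : R) (z : R[i]) : R[i] := limn (power_series (test_coef b) z).

Lemma test_coef_le b k : 0 <= b < 1 -> normc (test_coef b k) <= (1 - b) `^ (1 - s).
Proof.
move=> /andP[b0 b1]; rewrite normc_real_ge0; last by nneg.
by rewrite ler_piMr ?powR_ge0// exprn_ile1// ltW.
Qed.

Lemma test_fun_expansion b : 0 <= b < 1 -> has_expansion (test_fun b) (test_coef b).
Proof.
by move=> b01 z z1; apply: bounded_power_series_cvg z1 => k; exact: test_coef_le.
Qed.

Lemma test_fun_analytic b : 0 <= b < 1 -> analytic (test_fun b).
Proof. by move=> b01; apply: bounded_power_series_analytic => k; exact: test_coef_le. Qed.

(** For the second bound, |1 - z| <= |1 - bz| + (1 - b) |z|, and the last term is at most 1 - b <=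
    |1 - bz|. *)
Lemma normc_one_sub_ge (b : R) (z : R[i]) : 0 <= b < 1 -> disc 1 z ->
  1 - b <= normc (1 - b%:C * z) /\ normc (1 - z) / 2 <= normc (1 - b%:C * z).
Proof.
move=> /andP[b0 b1] z1; have {}z1 : normc z < 1 by [].
have h1 : 1 - b <= normc (1 - b%:C * z).
  apply: le_trans (ler_normcB _ _); rewrite normc1 normcM normc_real_ge0// lerD2l lerN2.
  by rewrite ler_piMr// ltW.
split => //.
have := normc_tri (b%:C * z) (1 : R[i]) z.
have -> : b%:C * z - z = - ((1 - b)%:C * z) by rewrite rmorphB rmorph1 mulrBl mul1r opprB.
rewrite normcN normcM normc_real_ge0 ?subr_ge0 ?(ltW b1)// => h2.
have : (1 - b) * normc z <= 1 - b by rewrite ler_piMr ?subr_ge0 ?(ltW b1) ?(ltW z1).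
lra.
Qed.

Lemma test_fun_le b (z : R[i]) : 0 <= b < 1 -> disc 1 z ->
  normc (test_fun b z) * normc (1 - b%:C * z) <= 2 * (1 - b) `^ (1 - s).
Proof.
move=> b01 z1; have /andP[b0 b1] := b01; set A := _ `^ _.
have h : (1 - b%:C * z) * power_series (test_coef b) z n @[n --> \oo] --> (1 - b%:C * z) * test_fun b z.
  by apply: cvgM; [exact: cvg_cst|exact: test_fun_expansion].
rewrite mulrC -normcM; apply: (normc_lim_le h (cvg_cst _)); apply: nearW => n.
have -> : (1 - b%:C * z) * power_series (test_coef b) z n = A%:C * (1 - (b%:C * z) ^+ n).
  rewrite -one_sub_mul_sum mulrCA; congr (_ * _); rewrite /power_series /series/= big_mkord mulr_sumr.
  by apply: eq_bigr => k _; rewrite /test_coef rmorphM rmorphXn exprMn mulrA.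
rewrite normcM normc_real_ge0 ?powR_ge0// mulrC ler_wpM2r ?powR_ge0//.
apply: le_trans (le_normcD _ _) _; rewrite normcN normc1 normcX normcM normc_real_ge0//.
rewrite -[leRHS]/(1 + 1) lerD2l exprn_ile1 ?mulr_ge0 ?normc_ge0// mulr_ile1 ?normc_ge0 ?(ltW b1)//.
exact: ltW.
Qed.

Lemma test_fun_norm : exists2 M : R, 0 <= M &
  forall b, 0 <= b < 1 -> (AT_norm p q (test_fun b) `^ q <= M%:E)%E.
Proof.
have [C C0 HC] := AT_norm_majorant p1 q1 s1.
exists (C * 4 `^ q); first by nneg.
move=> b b01; have /andP[b0 b1] := b01.
have [||K /andP[K1 K2]] := @dy_scale R (1 - b); [lra|lra|].
set A := (1 - b) `^ (1 - s); have A0 : 0 <= A by exact: powR_ge0.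
have d0 := dy_gt0 R K.
(* One scale is enough: dy K is comparable to 1 - b, and 1 / |1 - bz| is at most 4 / max(dy K, |1 -
   z|). *)
pose c k := if k == K then 4 * A / dy K else 0.
have c0 k : 0 <= c k by rewrite /c; case: ifP => _ //; nneg.
apply: (le_trans (HC c (test_fun b) c0 _)).
  move=> z z1; apply: (@le_trans _ _ (4 * A / Num.max (dy K) (normc (1 - z)))%:E).
    rewrite lee_fin ler_pdivlMr ?lt_max ?d0//.
    apply: (@le_trans _ _ (normc (test_fun b z) * (2 * normc (1 - b%:C * z)))).
      have [h1 h2] := normc_one_sub_ge b01 z1.
      by rewrite ler_wpM2l ?normc_ge0// ge_max; rewrite dyS in K1; apply/andP; split; lra.
    by have := test_fun_le b01 z1; rewrite -/A; lra.
  have E : (4 * A / Num.max (dy K) (normc (1 - z)))%:E = (dy K * c K / Num.max (dy K) (normc (1 - z)))%:E.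
    by rewrite /c eqxx mulrCA divff ?gt_eqF// mulr1.
  rewrite E; apply: (le_nneseries_term (u := fun k => (dy k * c k / Num.max (dy k) (normc (1 - z)))%:E)) => k.
  by rewrite lee_fin divr_ge0 ?mulr_ge0 ?c0 ?(ltW (dy_gt0 R k))// le_max (ltW (dy_gt0 R k)).
rewrite EFinM lee_wpmul2l ?lee_fin//; apply: nneseries_le => [k|n].
  by rewrite lee_fin powR_ge0.
rewrite sumEFin lee_fin.
have cE k : (dy k `^ s * c k) `^ q <= if k == K then 4 `^ q else 0.
  rewrite /c; case: eqP => [->|_]; last by rewrite mulr0 powR0// gt_eqF.
  apply: ge0_ler_powR; rewrite ?nnegrE ?(ltW q0)//; first by nneg.
  rewrite mulrA ler_pdivrMr// mulrCA ler_wpM2l//.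
  apply: (@le_trans _ _ (dy K `^ s * dy K `^ (1 - s))).
    rewrite ler_wpM2l ?powR_ge0//; apply: ge0_ler_powR; rewrite ?nnegrE ?subr_ge0 ?(ltW s1) ?(ltW b1)//.
    exact: ltW.
  by rewrite -powRD ?(gt_eqF d0) ?implybT// addrC subrK powRr1// ltW.
apply: le_trans (ler_sum _ (fun (k : 'I_n) _ => cE k)) _.
rewrite -big_mkcond/=.
rewrite (big_ord1_eq _ (fun=> 4 `^ q)); case: ifP => _ //; exact: powR_ge0.
Qed.

End test_function.

(** * Combinations of moments as integrals of polynomials *)

Section moment_comb.
Local Open Scope complex_scope.
Variables (R : realType) (mu : {finite_measure set (measurableTypeR R) -> \bar R}).
Local Notation D := (`[0%R, 1%R[%classic : set (measurableTypeR R)).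

Let mD : measurable D. Proof. exact: measurable_itv. Qed.

Lemma integrable_expn n : mu.-integrable D (EFin \o (fun t : R => t ^+ n)).
Proof.
apply: measurable_bounded_integrable => //.
- by rewrite -ge0_fin_numE// fin_num_measure.
- exists 1; split; first exact: num_real.
  move=> M M1 t /=; rewrite in_itv/= => /andP[t0 t1].
  by rewrite ger0_norm ?exprn_ge0// (le_trans _ (ltW M1))// exprn_ile1// ltW.
Qed.

Lemma moment_ge0 n : 0 <= moment mu n.
Proof.
by apply: Rintegral_ge0 => t /=; rewrite in_itv/= => /andP[t0 _]; exact: exprn_ge0.
Qed.

Lemma moment_le n k : (n <= k)%N -> moment mu k <= moment mu n.
Proof.
move=> nk; apply: le_Rintegral => //; try exact: integrable_expn.
move=> t /=; rewrite in_itv/= => /andP[t0 t1]; apply: ler_wiXn2l => //; exact: ltW.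
Qed.

Lemma integrable_poly (I : finType) (b : I -> R) (e : I -> nat) :
  mu.-integrable D (EFin \o (fun t : R => \sum_i b i * t ^+ e i)).
Proof.
rewrite (_ : EFin \o _ = fun t => (\sum_i (b i * t ^+ e i)%:E)%E); last first.
  by apply/funext => t /=; rewrite sumEFin.
apply: integrable_sum => // i _.
rewrite (_ : (fun t => _) = fun t => ((b i)%:E * (t ^+ e i)%:E)%E); last by apply/funext.
apply: integrableZl => //; exact: integrable_expn.
Qed.

Lemma moment_comb (I : finType) (b : I -> R) (e : I -> nat) :
  ((\sum_i b i * moment mu (e i))%:E = \int[mu]_(t in D) (\sum_i b i * t ^+ e i)%:E)%E.
Proof.
under eq_integral do rewrite -sumEFin.
rewrite integral_sum//; last first.
  move=> i; rewrite (_ : (fun t => _) = fun t => ((b i)%:E * (t ^+ e i)%:E)%E); last by apply/funext.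
  by apply: integrableZl => //; exact: integrable_expn.
rewrite -sumEFin; apply: eq_bigr => i _.
under eq_integral do rewrite EFinM.
rewrite integralZl//; last exact: integrable_expn.
rewrite EFinM /moment /Rintegral fineK//.
by apply: integrable_fin_num => //; exact: integrable_expn.
Qed.

Lemma moment_comb_le (I : finType) (b : I -> R) (e : I -> nat) :
  (`|(\sum_i b i * moment mu (e i))%R|%:E <= \int[mu]_(t in D) `|(\sum_i b i * t ^+ e i)%R|%:E)%E.
Proof.
rewrite -abse_EFin moment_comb; apply: le_trans (le_abse_integral _ _ _) _ => //.
by have /integrableP[] := integrable_poly b e.
Qed.

Definition cpoly (I : finType) (b : I -> R[i]) (e : I -> nat) (t : R) : R[i] :=
  \sum_i b i * (t ^+ e i)%:C.

Lemma Re_mul_real (z : R[i]) (x : R) : Re (z * x%:C) = Re z * x.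
Proof. by case: z => u v /=; rewrite mulr0 subr0. Qed.

Lemma Im_mul_real (z : R[i]) (x : R) : Im (z * x%:C) = Im z * x.
Proof. by case: z => u v /=; rewrite mulr0 add0r. Qed.

Lemma Re_cpoly (I : finType) (b : I -> R[i]) (e : I -> nat) t :
  Re (cpoly b e t) = \sum_i Re (b i) * t ^+ e i.
Proof. by rewrite /cpoly Re_sum; apply: eq_bigr => i _; rewrite Re_mul_real. Qed.

Lemma Im_cpoly (I : finType) (b : I -> R[i]) (e : I -> nat) t :
  Im (cpoly b e t) = \sum_i Im (b i) * t ^+ e i.
Proof. by rewrite /cpoly Im_sum; apply: eq_bigr => i _; rewrite Im_mul_real. Qed.

Lemma measurable_normc_cpoly (I : finType) (b : I -> R[i]) (e : I -> nat) :
  measurable_fun D (fun t => (normc (cpoly b e t))%:E).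
Proof.
apply/measurable_EFinP.
rewrite (_ : (fun t => _) = (fun t => (Re (cpoly b e t) ^+ 2 + Im (cpoly b e t) ^+ 2) `^ 2^-1)); last first.
  by apply/funext => t; rewrite -sqr_normcE powR12_sqrt ?sqrtr_sqr ?exprn_ge0 ?normc_ge0// ger0_norm ?normc_ge0.
apply: (@measurableT_comp _ _ _ _ _ _ (@powR R ^~ 2^-1)); first exact: measurable_powR.
apply: measurable_funD; apply: measurable_funX.
- rewrite (_ : (fun t => _) = (fun t : R => \sum_i Re (b i) * t ^+ e i)); last first.
    by apply/funext => t; exact: Re_cpoly.
  by apply: measurable_sum => i; apply: measurable_funM => //; exact: measurable_funX.
- rewrite (_ : (fun t => _) = (fun t : R => \sum_i Im (b i) * t ^+ e i)); last first.
    by apply/funext => t; exact: Im_cpoly.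
  by apply: measurable_sum => i; apply: measurable_funM => //; exact: measurable_funX.
Qed.

(** Real and imaginary parts are bounded separately by the real triangle inequality; this is the
    origin of the factor 2 in the representation. *)
Lemma cmoment_comb_le (I : finType) (b : I -> R[i]) (e : I -> nat) :
  ((normc (\sum_i b i * (moment mu (e i))%:C)%R)%:E <= 2%:E * \int[mu]_(t in D) (normc (cpoly b e t))%:E)%E.
Proof.
apply: (@le_trans _ _ (\int[mu]_(t in D) (normc (cpoly b e t))%:E + \int[mu]_(t in D) (normc (cpoly b e t))%:E)%E); last first.
  by rewrite -[2]/(1 + 1)%R EFinD ge0_muleDl ?lee_fin// !mul1e.
apply: (@le_trans _ _ (`|Re (\sum_i b i * (moment mu (e i))%:C)|%:E + `|Im (\sum_i b i * (moment mu (e i))%:C)|%:E)%E).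
  by rewrite -EFinD lee_fin normc_le_ReIm.
apply: leeD.
- rewrite Re_sum; under eq_bigr do rewrite Re_mul_real.
  apply: le_trans (moment_comb_le _ _) _; apply: ge0_le_integral_nomeas => t Dt.
  + by rewrite lee_fin.
  + by rewrite lee_fin normc_ge0.
  + by split=> //; rewrite -Re_cpoly lee_fin normc_Re.
- rewrite Im_sum; under eq_bigr do rewrite Im_mul_real.
  apply: le_trans (moment_comb_le _ _) _; apply: ge0_le_integral_nomeas => t Dt.
  + by rewrite lee_fin.
  + by rewrite lee_fin normc_ge0.
  + by split=> //; rewrite -Im_cpoly lee_fin normc_Im.
Qed.

End moment_comb.

(** * From the matrix of moments to an integral bound and a majorant *)

Section hilbert_representation.
Local Open Scope complex_scope.
Variables (R : realType) (mu : {finite_measure set (measurableTypeR R) -> \bar R}).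
Local Notation D := (`[0%R, 1%R[%classic : set (measurableTypeR R)).
Variables (rho : nat -> R) (B : R).
Hypothesis rhoB : forall k, rho k <= B.
Hypothesis rhomu : forall k, (mu (dyadic k) <= (rho k * dy k)%:E)%E.

Let mD : measurable D. Proof. exact: measurable_itv. Qed.
Let d0 k : 0 < dy k :> R. Proof. exact: dy_gt0. Qed.

Lemma measurable_dyadic k : measurable (dyadic k : set (measurableTypeR R)).
Proof. exact: measurable_itv. Qed.

Lemma dyadic_sum_fin (al : R) : 0 < al -> (\sum_(k <oo) (dy k `^ al)%:E < +oo :> \bar R)%E.
Proof.
(* At n = 0 the denominator of the dyadic kernel is a power of dy 0 = 1. *)
move=> al0; have [|C C0 HC] := @dyadic_kernel_sum R al (al + 1) al0; first by rewrite ltrDl.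
apply: le_lt_trans (le_trans _ (HC 0%N)) (ltry _).
apply: lee_nneseries => k *; first by rewrite lee_fin powR_ge0.
by rewrite minn0 /dy expr0 powR1 divr1.
Qed.

Variable tau : R.
Hypothesis tau01 : 0 < tau < 1.

Lemma measurable_weight c : measurable_fun D (fun t : measurableTypeR R => (((1 - t) `^ c)%R)%:E).
Proof.
apply/measurable_EFinP; apply: (@measurableT_comp _ _ _ _ _ _ (@powR R ^~ c)).
  exact: measurable_powR.
by apply: measurable_funB => //; exact: measurable_cst.
Qed.

(** On the k-th interval the weight is of order dy k^(-tau) and the mass at most B dy k; the
    products are summable since tau < 1. *)
Lemma weight_integral_fin : (\int[mu]_(t in D) (((1 - t) `^ (- tau))%R)%:E < +oo)%E.
Proof.
have /andP[tau0 tau1] := tau01.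
apply: (@le_lt_trans _ _ (\sum_(k <oo) ((dy k / 2) `^ (- tau))%:E * mu (dyadic k))%E).
  apply: integral_le_step.
  - by move=> k; exact: measurable_dyadic.
  - by move=> k; rewrite lee_fin powR_ge0.
  - by move=> t _; rewrite lee_fin powR_ge0.
  - move=> t; rewrite /= in_itv/= => t01; have [k kt] := dyadic_cover t01.
    have [_ t1 h1 h2] := dyadic_bounds kt.
    have u0 j : (0 <= ((dy j / 2) `^ (- tau))%:E * (\1_(dyadic j) t)%:E)%E :> Prop.
      by rewrite mule_ge0 ?lee_fin ?powR_ge0.
    apply: le_trans (le_nneseries_term k u0).
    rewrite indicE mem_set// mule1 lee_fin !powRN lef_pV2 ?posrE ?powR_gt0 ?subr_gt0 ?divr_gt0//.
    by apply: ge0_ler_powR; rewrite ?nnegrE ?(ltW tau0) ?divr_ge0 ?subr_ge0 ?(ltW (d0 k)) ?(ltW t1) ?(ltW h1).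
have tau1' : 0 < 1 - tau by rewrite subr_gt0.
apply: (@le_lt_trans _ _ ((2 `^ tau * B)%:E * \sum_(k <oo) (dy k `^ (1 - tau))%:E)%E); last first.
  have := dyadic_sum_fin tau1'; rewrite -ge0_fin_numE; last first.
    by apply: nneseries_ge0 => k *; rewrite lee_fin powR_ge0.
  by move=> /fineK <-; rewrite -EFinM ltry.
rewrite -nneseriesZl; last by move=> k *; rewrite lee_fin powR_ge0.
apply: lee_nneseries => k *; first by rewrite mule_ge0 ?lee_fin ?powR_ge0.
apply: le_trans (lee_wpmul2l _ (rhomu k)) _; first by rewrite lee_fin powR_ge0.
rewrite -!EFinM lee_fin.
have -> : (dy k / 2) `^ (- tau) = 2 `^ tau * dy k `^ (- tau).
  rewrite powRM ?(ltW (d0 k)) ?invr_ge0// mulrC; congr (_ * _).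
  by rewrite -powR_inv1// -powRrM mulN1r opprK.
have -> : dy k `^ (1 - tau) = dy k * dy k `^ (- tau).
  by rewrite powRD ?(gt_eqF (d0 k)) ?implybT// powRr1// ltW.
rewrite -!mulrA ler_wpM2l ?powR_ge0//.
rewrite mulrCA [dy k * _]mulrC ler_wpM2r ?rhoB// mulr_ge0 ?powR_ge0//; exact: ltW.
Qed.

Variables (f : R[i] -> R[i]) (a : nat -> R[i]) (M : R).
Hypothesis fa : has_expansion f a.
Hypothesis aM : forall t K, 0 <= t < 1 -> \sum_(k < K) normc (a k) * t ^+ k <= M * (1 - t) `^ (- tau).

Let M0 : 0 <= M.
Proof.
have := aM 0%N (t := 0); rewrite lexx ltr01 big_ord0 subr0 powR1 mulr1; exact.
Qed.

(** The sum is the integral of the polynomial with coefficients |a_k|, which the growth hypothesis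
    bounds by M times the integrable weight. *)
Lemma abs_moment_bound : exists S : R, forall K, \sum_(k < K) moment mu k * normc (a k) <= S.
Proof.
have h := weight_integral_fin; set W := (\int[mu]_(t in _) _)%E in h.
have W0 : (0 <= W)%E by apply: integral_ge0 => t _; rewrite lee_fin powR_ge0.
have Wf : W \is a fin_num by rewrite ge0_fin_numE.
exists (M * fine W) => K.
rewrite -lee_fin EFinM fineK//.
under eq_bigr do rewrite mulrC.
rewrite moment_comb /W -ge0_integralZl_EFin//; last 2 first.
- by move=> t _; rewrite lee_fin powR_ge0.
- exact: measurable_weight.
apply: ge0_le_integral_nomeas => t Dt.
- rewrite lee_fin sumr_ge0// => i _; move: Dt; rewrite /= in_itv/= => /andP[t0 _].
  by rewrite mulr_ge0 ?normc_ge0 ?exprn_ge0.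
- by rewrite mule_ge0 ?lee_fin ?powR_ge0.
- by split=> //; rewrite -EFinM lee_fin; apply: aM; move: Dt; rewrite /= in_itv.
Qed.

Let bk k := moment mu k * normc (a k).

Let bk0 k : 0 <= bk k. Proof. by rewrite mulr_ge0 ?moment_ge0 ?normc_ge0. Qed.

Let cbk : cvgn (series bk).
Proof.
have [S HS] := abs_moment_bound.
apply: nondecreasing_is_cvgn.
  by apply/nondecreasing_seqP => n; rewrite /series/= big_nat_recr//= lerDl.
by exists S => _ [n _ <-]; rewrite /series/= big_mkord; exact: HS.
Qed.

(** Moments decrease, so the row n = 0 dominates all rows. This yields both the convergence of the
    inner series and a bound on the new coefficients that is uniform in n. *)
Let hilbert_term n k : normc ((moment mu (n + k))%:C * a k) <= bk k.
Proof.
rewrite normcM normc_real_ge0 ?moment_ge0//; apply: ler_wpM2r; first exact: normc_ge0.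
exact: moment_le (leq_addl _ _).
Qed.

Lemma hilbert_coef_cvg n : cvgn (hilbert_coef_series mu a n).
Proof.
apply: abs_cvgc_series; apply: series_le_cvg cbk => k //; exact: normc_ge0.
Qed.

Lemma hilbert_coef_tail n N :
  normc (hilbert_coef mu a n - hilbert_coef_series mu a n N) <= limn (series bk) - series bk N.
Proof.
apply: series_tail => //; exact: hilbert_coef_cvg.
Qed.

Lemma hilbert_coef_bound n : normc (hilbert_coef mu a n) <= limn (series bk).
Proof.
have := hilbert_coef_tail n 0.
by rewrite /hilbert_coef_series /series/= !big_geq// !subr0.
Qed.

Lemma hilbert_expansion : has_expansion (hilbert mu a) (hilbert_coef mu a).
Proof. by move=> z z1; exact: (bounded_power_series_cvg hilbert_coef_bound). Qed.

Lemma hilbert_analytic : analytic (hilbert mu a).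
Proof. exact: (bounded_power_series_analytic hilbert_coef_bound). Qed.

(** Truncating both sums at N leaves a finite combination of moments, hence the integral of a
    polynomial in t. *)
Definition hilbert_partial (z : R[i]) N : R[i] :=
  \sum_(i : 'I_N * 'I_N) (a i.2 * z ^+ i.1) * (moment mu (i.1 + i.2))%:C.

Lemma hilbert_partial_cvg z : disc 1 z -> hilbert_partial z @ \oo --> hilbert mu a z.
Proof.
move=> z1; apply/cvgcP.
have z1' : 0 < 1 - normc z by rewrite subr_gt0.
have h1 := hilbert_expansion z1; move/cvgcP in h1.
have h2 := cvg_series_tail cbk.
apply: (@squeeze_cvgr _ _ _ _ (fun=> 0) (fun N => normc (power_series (hilbert_coef mu a) z N - hilbert mu a z) +
   (limn (series bk) - series bk N) * (1 - normc z)^-1)).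
- apply: nearW => N; rewrite normc_ge0/=.
  apply: le_trans (normc_tri (power_series (hilbert_coef mu a) z N) _ _) _.
  rewrite addrC lerD2l normcBC.
  have -> : hilbert_partial z N = \sum_(n < N) hilbert_coef_series mu a n N * z ^+ n.
    rewrite /hilbert_partial -(pair_bigA _ (fun n k : 'I_N => a k * z ^+ n * (moment mu (n + k))%:C))/=.
    apply: eq_bigr => n _; rewrite /hilbert_coef_series /series/= big_mkord mulr_suml.
    by apply: eq_bigr => k _; ring.
  rewrite /power_series /series/= big_mkord -sumrB.
  apply: le_trans (normc_sum _ _ _) _.
  apply: (@le_trans _ _ ((limn (series bk) - series bk N) * \sum_(n < N) normc z ^+ n)).
    rewrite mulr_sumr; apply: ler_sum => n _; rewrite -mulrBl normcM normcX.
    by rewrite ler_wpM2r ?exprn_ge0 ?normc_ge0// hilbert_coef_tail.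
  apply: ler_wpM2l; first by apply: le_trans (hilbert_coef_tail 0 N); exact: normc_ge0.
  by apply: geometric_sum_le; rewrite normc_ge0.
- exact: cvg_cst.
- rewrite -[X in _ --> X]addr0; apply: cvgD => //.
  by rewrite -[X in _ --> X](mul0r (1 - normc z)^-1); apply: cvgM => //; exact: cvg_cst.
Qed.

Let kernel_poly N z t : R[i] :=
  cpoly (fun i : 'I_N * 'I_N => a i.2 * z ^+ i.1) (fun i => (i.1 + i.2)%N) t.

Let kernel_polyE N z t : kernel_poly N z t =
  power_series a t%:C N * \sum_(n < N) (t%:C * z) ^+ n.
Proof.
rewrite /kernel_poly /cpoly /power_series /series/= big_mkord mulrC big_distrlr/=.
rewrite pair_bigA; apply: eq_bigr => -[n k] _ /=.
by rewrite rmorphXn exprMn exprD; ring.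
Qed.

(** The truncated kernel factors into a partial Taylor sum at t and a partial geometric sum in tz.
    These converge to f(t) and 1 / (1 - tz), and are dominated by M (1 - t)^(-tau) / (1 - |z|), so
    dominated convergence applies. *)
Lemma hilbert_integral_le z : disc 1 z -> ((normc (hilbert mu a z))%:E <=
  2%:E * \int[mu]_(t in D) (normc (f t%:C) / normc (1 - t%:C * z)%R)%:E)%E.
Proof.
move=> z1; have z1' : 0 < 1 - normc z by rewrite subr_gt0.
have tz t : D t -> normc (t%:C * z) < 1.
  rewrite /= in_itv/= => /andP[t0 t1]; rewrite normcM normc_real_ge0//.
  by rewrite -[ltRHS]mulr1; apply: ltr_pM; rewrite ?normc_ge0.
pose G N (t : measurableTypeR R) := (normc (kernel_poly N z t))%:E.
pose G0 (t : measurableTypeR R) := (normc (f t%:C) / normc (1 - t%:C * z)%R)%:E.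
pose H (t : measurableTypeR R) := ((M / (1 - normc z))%:E * ((1 - t) `^ (- tau))%:E)%E.
have mG N : measurable_fun D (G N) by exact: measurable_normc_cpoly.
have GG0 t : D t -> G ^~ t @ \oo --> G0 t.
  move=> Dt; have := tz t Dt; set w := t%:C * z => w1.
  have nw : 0 < normc (1 - w).
    by apply: lt_le_trans (ler_normcB _ _); rewrite normc1 subr_gt0.
  have geo : \sum_(n < N) w ^+ n @[N --> \oo] --> (1 - w)^-1.
    apply/cvgcP.
    apply: (@squeeze_cvgr _ _ _ _ (fun=> 0) (fun N => normc w ^+ N * (normc (1 - w))^-1)).
    - apply: nearW => N; rewrite normc_ge0/=.
      have w0 : 1 - w != 0 by apply/eqP => e; move: nw; rewrite e normc0 ltxx.
      have -> : \sum_(n < N) w ^+ n - (1 - w)^-1 = - (w ^+ N * (1 - w)^-1).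
        apply: (mulfI w0); rewrite mulrBr one_sub_mul_sum mulrN mulrCA divff// mulr1.
        by rewrite addrAC subrr sub0r.
      by rewrite normcN normcM normcX normcV.
    - exact: cvg_cst.
    - rewrite -[X in _ --> X](mul0r (normc (1 - w))^-1); apply: cvgM; last exact: cvg_cst.
      by apply: cvg_expr; rewrite ger0_norm ?normc_ge0.
  have t1 : disc 1 t%:C.
    by move: Dt; rewrite /= in_itv/= /disc /mkset => /andP[t0 t1]; rewrite normc_real_ge0.
  have /cvgc_normc h : power_series a t%:C N * \sum_(n < N) w ^+ n @[N --> \oo] --> f t%:C / (1 - w).
    by apply: cvgM; [exact: fa t1|exact: geo].
  rewrite /G0 -normcV -normcM; apply: cvg_EFin; first by apply: nearW.
  rewrite (_ : fine \o _ = (fun N => normc (kernel_poly N z t))); last by apply/funext.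
  under eq_fun do rewrite kernel_polyE.
  exact: h.
have mG0 : measurable_fun D G0 by exact: emeasurable_fun_cvg GG0.
have M1 : 0 <= M / (1 - normc z) by rewrite divr_ge0// ltW.
have iH : mu.-integrable D H.
  apply: integrableZl => //; apply/integrableP; split; first exact: measurable_weight.
  under eq_integral do rewrite gee0_abs ?lee_fin ?powR_ge0//.
  exact: weight_integral_fin.
have GH t N : D t -> (`|G N t| <= H t)%E.
  move=> Dt; rewrite /G /H gee0_abs; last by rewrite lee_fin normc_ge0.
  rewrite -EFinM lee_fin kernel_polyE normcM.
  have t01 : 0 <= t < 1 by move: Dt; rewrite /= in_itv.
  have /andP[t0 t1] := t01.
  rewrite mulrAC; apply: ler_pM; rewrite ?normc_ge0//.
    apply: le_trans (aM N t01); rewrite /power_series/series/= big_mkord.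
    apply: le_trans (normc_sum _ _ _) _; apply: ler_sum => k _.
    by rewrite normcM normcX normc_real_ge0.
  apply: le_trans (normc_sum _ _ _) _.
  apply: (@le_trans _ _ (\sum_(n < N) normc z ^+ n)).
    apply: ler_sum => n _; rewrite normcX lerXn2r ?nnegrE ?normc_ge0//.
    by rewrite normcM normc_real_ge0// ler_piMl ?normc_ge0// ltW.
  by apply: geometric_sum_le; rewrite normc_ge0.
have [_ _ lim] := @dominated_convergence _ _ _ mu D mD G G0 H mG mG0 (aeW mu GG0) iH (aeW mu (fun t N => @GH t N)).
have c1 : (normc (hilbert_partial z N))%:E @[N --> \oo] --> (normc (hilbert mu a z))%:E.
  by apply: cvg_EFin; [exact: nearW|exact: cvgc_normc (hilbert_partial_cvg z1)].
have c2 : (2%:E * \int[mu]_(t in D) G N t)%E @[N --> \oo] --> (2%:E * \int[mu]_(t in D) G0 t)%E.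
  by apply: cvgeZl.
apply: (lee_cvg_to c1 c2); apply: nearW => N; exact: cmoment_comb_le.
Qed.

(** On the k-th interval |1 - tz| >= max(dy k, |1 - z|) / 2; this 2 and the 2 of the integral bound
    make the 4. *)
Lemma hilbert_majorant z : disc 1 z ->
  ((normc (hilbert mu a z))%:E <= majorant (fun k => 4 * (rho k * dysup f k))%R (normc (1 - z)%R))%E.
Proof.
move=> z1; apply: le_trans (hilbert_integral_le z1) _.
set x := normc (1 - z)%R.
have s0 k : 0 <= dysup f k := dysup_ge0 k fa.
have m0 k : 0 < Num.max (dy k) x by rewrite lt_max d0.
pose v k := (dysup f k * (2 / Num.max (dy k) x))%:E.
have v0 k : (0 <= v k)%E by rewrite lee_fin mulr_ge0// divr_ge0// ltW.
apply: (@le_trans _ _ (2%:E * \sum_(k <oo) v k * mu (dyadic k))%E).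
  apply: lee_wpmul2l; first by rewrite lee_fin.
  apply: integral_le_step => //.
  - by move=> k; exact: measurable_dyadic.
  - by move=> t _; rewrite lee_fin divr_ge0 ?normc_ge0.
  - move=> t; rewrite /= in_itv/= => t01; have [k kt] := dyadic_cover t01.
    have [_ t1 h1 h2] := dyadic_bounds kt.
    have u0 j : (0 <= v j * (\1_(dyadic j) t)%:E)%E by apply: mule_ge0 => //; rewrite lee_fin.
    apply: le_trans (le_nneseries_term k u0).
    rewrite indicE mem_set// mule1 lee_fin.
    have [g1 g2] := normc_one_sub_ge t01 z1; rewrite -/x in g2.
    have hm : Num.max (dy k) x / 2 <= normc (1 - t%:C * z).
      by case: (leP (dy k) x) => _ //; exact: le_trans (ltW h1) g1.
    apply: ler_pM; [exact: normc_ge0|by rewrite invr_ge0 normc_ge0|exact: dysup_ub fa kt|].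
    rewrite -[leRHS]invf_div lef_pV2 ?posrE ?divr_gt0//.
    by apply: lt_le_trans hm; rewrite divr_gt0.
rewrite /majorant -nneseriesZl; last by move=> k *; rewrite mule_ge0.
apply: lee_nneseries => k *; first by rewrite mule_ge0 ?lee_fin// mule_ge0.
apply: le_trans (lee_wpmul2l _ (lee_wpmul2l (v0 k) (rhomu k))) _; first by rewrite lee_fin.
by rewrite -!EFinM lee_fin; apply: eq_ler; ring.
Qed.

End hilbert_representation.

(** * Boundedness *)

Section ereal_null.
Variable R : realType.
Implicit Type u : nat -> \bar R.
Local Open Scope ereal_scope.

Lemma cvge0_le u : (forall n, 0 <= u n) ->
  (forall e : R, (0 < e)%R -> \forall n \near \oo, u n <= e%:E) -> u @ \oo --> 0.
Proof.
move=> u0 H; apply/fine_cvgP; split.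
  by have := H 1%R ltr01; apply: filterS => n h; rewrite ge0_fin_numE// (le_lt_trans h)// ltry.
apply/cvgrPdist_le => e e0; have := H e e0; apply: filterS => n h.
have fin : u n \is a fin_num by rewrite ge0_fin_numE// (le_lt_trans h)// ltry.
by rewrite sub0r normrN ger0_norm ?fine_ge0// -lee_fin fineK.
Qed.

Lemma le_cvge0 u (e : R) : (forall n, 0 <= u n) -> u @ \oo --> 0 -> (0 < e)%R ->
  \forall n \near \oo, u n <= e%:E.
Proof.
move=> u0 /fine_cvgP[fin /cvgrPdist_le/(_ e)] + e0 => /(_ e0) H.
near=> n; have f : u n \is a fin_num by near: n.
rewrite -(fineK f) lee_fin -[leLHS]ger0_norm ?fine_ge0// -normrN -[X in `|X|%R]add0r.
by near: n.
Unshelve. all: by end_near. Qed.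

End ereal_null.

(** * Carleson ratios and their dyadic values *)

Section carleson.
Variables (R : realType) (mu : {finite_measure set (measurableTypeR R) -> \bar R}).
Implicit Types t b : R.

Definition cratio t : R := fine (mu `[t, 1[%classic) / (1 - t).

Let fin t : mu `[t, 1[%classic \is a fin_num.
Proof. by apply: fin_num_measure; exact: measurable_itv. Qed.

Lemma carleson_ratioE t : carleson_ratio mu t = (cratio t)%:E.
Proof. by rewrite /carleson_ratio /cratio EFinM fineK. Qed.

Lemma cratio_ge0 t : t < 1 -> 0 <= cratio t.
Proof. by move=> t1; rewrite divr_ge0 ?fine_ge0// subr_ge0 ltW. Qed.

Lemma carleson1P : carleson1 mu <-> exists B, forall t, 0 <= t < 1 -> cratio t <= B.
Proof.
split=> [h|[B HB]].
  have : ereal_sup [set carleson_ratio mu t | t in `[0%R, 1%R[] \is a fin_num.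
    rewrite ge0_fin_numE//; apply: (@le_trans _ _ (carleson_ratio mu 0)).
      by rewrite carleson_ratioE lee_fin cratio_ge0.
    by apply: ereal_sup_ubound; exists 0 => //; rewrite /= in_itv/= lexx ltr01.
  move=> /fineK E; exists (fine (ereal_sup [set carleson_ratio mu t | t in `[0%R, 1%R[])) => t t01.
  by rewrite -lee_fin E -carleson_ratioE; apply: ereal_sup_ubound; exists t; rewrite //= in_itv.
apply: le_lt_trans (ltry B); apply: ge_ereal_sup => _ [t t01 <-].
by rewrite carleson_ratioE lee_fin HB//; move: t01; rewrite /= in_itv.
Qed.

Lemma vanishing_carleson1P : vanishing_carleson1 mu <->
  forall e, 0 < e -> exists N, forall t, 1 - dy N < t < 1 -> cratio t <= e.
Proof.
rewrite /vanishing_carleson1.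
have -> : carleson_ratio mu = EFin \o cratio by apply/funext => t; exact: carleson_ratioE.
split.
  move=> /fine_cvgP[_ /cvgrPdist_le h] e /h [d /= d0 H].
  have [N dN] := dy_small d0.
  exists N => t /andP[t0 t1]; have := H t; rewrite /= sub0r normrN => H1.
  rewrite (le_trans (ler_norm _))// H1// ger0_norm; lra.
move=> H; apply: cvg_EFin; first by apply: nearW.
apply/cvgrPdist_le => e e0; have [N HN] := H e e0.
exists (dy N) => /=; first exact: dy_gt0.
move=> t /= h t1; rewrite sub0r normrN ger0_norm ?cratio_ge0//.
by apply: HN; rewrite t1 andbT; move: h; rewrite ger0_norm; lra.
Qed.

Definition dyratio k : R := cratio (1 - dy k).

Lemma dyratio_ge0 k : 0 <= dyratio k.
Proof. by rewrite cratio_ge0// ltrBlDr ltrDl dy_gt0. Qed.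

Lemma dyratio_measure k : (mu (dyadic k) <= (dyratio k * dy k)%:E)%E.
Proof.
rewrite /dyratio /cratio subKr divfK ?gt_eqF ?dy_gt0// fineK//.
apply: le_measure; rewrite ?inE; try exact: measurable_itv.
by move=> t /dyadicE/andP[t0 t1]; rewrite /= in_itv/= t0 (lt_trans t1)// ltrBlDr ltrDl dy_gt0.
Qed.

Lemma vanishing_dyratio e : vanishing_carleson1 mu -> 0 < e ->
  exists N, forall k, (N <= k)%N -> dyratio k <= e.
Proof.
move=> /vanishing_carleson1P h e0; have [N HN] := h e e0.
exists N.+1 => k Nk; apply: HN; rewrite ltrD2l ltrN2 dy_lt// ltrBlDr ltrDl dy_gt0//.
Qed.

(** Away from 1 the ratio is at most the total mass divided by dy N. *)
Lemma vanishing_carleson1_carleson1 : vanishing_carleson1 mu -> carleson1 mu.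
Proof.
move=> /vanishing_carleson1P/(_ 1 ltr01)[N HN]; apply/carleson1P.
have d0 := dy_gt0 R N.
have m0 : 0 <= fine (mu `[0, 1[%classic) by rewrite fine_ge0.
exists (1 + fine (mu `[0, 1[%classic) / dy N) => t /andP[t0 t1].
have [h|h] := ltP (1 - dy N) t.
  by rewrite (le_trans (HN t _)) ?h// lerDl divr_ge0// ltW.
rewrite (@le_trans _ _ (fine (mu `[0, 1[%classic) / dy N)) ?lerDr//.
apply: ler_pM; rewrite ?invr_ge0 ?subr_ge0 ?(ltW t1) ?fine_ge0//.
  apply: fine_le => //; apply: le_measure; rewrite ?inE; try exact: measurable_itv.
  by move=> x; rewrite /= !in_itv/= => /andP[tx ->]; rewrite (le_trans t0 tx).
rewrite lef_pV2 ?posrE ?subr_gt0//; lra.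
Qed.

End carleson.

Section boundedness.
Local Open Scope complex_scope.
Variables (R : realType) (p q : R) (mu : {finite_measure set (measurableTypeR R) -> \bar R}).
Hypotheses (p1 : 1 < p) (q1 : 1 < q) (s1 : p^-1 + q^-1 < 1) (p2 : 2 < p).
Local Notation s := (p^-1 + q^-1).
Local Notation tau := (coef_exp p q).
Let q0 : 0 < q. Proof. exact: lt_trans ltr01 q1. Qed.
Let d0 k : 0 < dy k :> R. Proof. exact: dy_gt0. Qed.

Lemma AT_norm_le_powR f (M : R) : 0 <= M -> (AT_norm p q f `^ q <= M%:E)%E ->
  (AT_norm p q f <= (M `^ q^-1)%:E)%E.
Proof.
by move=> M0 h; rewrite -poweR_EFin; apply: lee_poweR_inv => //; exact: AT_norm_ge0.
Qed.

Lemma AT_norm_powR_le f (M : R) : (AT_norm p q f <= M%:E)%E -> (AT_norm p q f `^ q <= (M `^ q)%:E)%E.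
Proof.
by move=> h; rewrite -poweR_EFin; apply: lee_poweR => //; [exact: ltW|exact: AT_norm_ge0].
Qed.

Lemma AT_norm_fin f : (AT_norm p q f < +oo)%E -> exists2 M : R, 0 <= M & AT_norm p q f = M%:E.
Proof.
have f0 := AT_norm_ge0 p q f; move=> h; exists (fine (AT_norm p q f)); first exact: fine_ge0.
by rewrite fineK// ge0_fin_numE.
Qed.

Lemma AT_coef_growth f a : AT p q f -> has_expansion f a -> exists D : R,
  forall t K, 0 <= t < 1 -> \sum_(k < K) normc (a k) * t ^+ k <= D * (1 - t) `^ (- tau).
Proof.
move=> [af /AT_norm_fin[M M0 ME]] fa.
have [|D D0 HD] := coef_growth p1 q1 (M := M `^ q); first exact: powR_ge0.
by exists D => t K; apply: HD fa _ => //; apply: AT_norm_powR_le; rewrite ME.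
Qed.

(** C depends neither on B nor on M: the ratios stay inside the sum, where compactness exploits
    their decay. [g] need only agree with the image in the disc, because it will be a difference of
    two images. *)
Lemma hilbert_norm_le : exists2 C : R, 0 <= C & forall B f a M,
  (forall k, dyratio mu k <= B) -> has_expansion f a ->
  (forall t K, 0 <= t < 1 -> \sum_(k < K) normc (a k) * t ^+ k <= M * (1 - t) `^ (- tau)) ->
  forall g, (forall z, disc 1 z -> g z = hilbert mu a z) ->
  (AT_norm p q g `^ q <=
    C%:E * \sum_(k <oo) ((dyratio mu k * dytrace p q f k) `^ q)%:E)%E.
Proof.
have [C C0 HC] := AT_norm_majorant p1 q1 s1.
exists (C * 4 `^ q); first by nneg.
move=> B f a M rB fa aM g gE.
have D0 k : 0 <= dysup f k := dysup_ge0 k fa.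
have r0 k : 0 <= dyratio mu k := dyratio_ge0 mu k.
have t0 k : 0 <= dytrace p q f k by rewrite mulr_ge0 ?powR_ge0.
apply: (le_trans (HC (fun k => 4 * (dyratio mu k * dysup f k)) g _ _)).
- by move=> k; apply: mulr_ge0 => //; exact: mulr_ge0.
- move=> z z1; rewrite gE//.
  exact: (hilbert_majorant rB (@dyratio_measure _ mu) (coef_exp_bound p1 s1 p2) fa aM z1).
rewrite EFinM -muleA lee_wpmul2l ?lee_fin// -nneseriesZl; last by move=> k *; rewrite lee_fin powR_ge0.
apply: lee_nneseries => k *; first by rewrite lee_fin powR_ge0.
have -> : dy k `^ s * (4 * (dyratio mu k * dysup f k)) = 4 * (dyratio mu k * dytrace p q f k).
  by rewrite /dytrace; ring.
rewrite powRM; [by rewrite EFinM|by []|exact: mulr_ge0].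
Qed.

Lemma carleson1_bound : carleson1 mu -> exists2 B : R, 0 <= B & forall k, dyratio mu k <= B.
Proof.
move=> /carleson1P[B HB].
have h k : dyratio mu k <= B.
  by apply: HB; rewrite subr_ge0 dy_le1 ltrBlDr ltrDl d0.
by exists B => //; exact: le_trans (dyratio_ge0 mu 0) (h 0%N).
Qed.

Lemma carleson1_well_defined : carleson1 mu -> hilbert_well_defined mu p q.
Proof.
move=> /carleson1_bound[B B0 HB] f a fAT fa; have [D HD] := AT_coef_growth fAT fa.
have t01 := coef_exp_bound p1 s1 p2.
split.
- exact: (hilbert_coef_cvg HB (@dyratio_measure _ mu) t01 HD).
- move=> z z1; apply/cvg_ex; exists (hilbert mu a z).
  exact: (hilbert_expansion HB (@dyratio_measure _ mu) t01 HD z1).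
- exact: (hilbert_analytic HB (@dyratio_measure _ mu) t01 HD).
Qed.

Lemma carleson1_bounded : carleson1 mu -> hilbert_bounded mu p q.
Proof.
move=> cm; have [B B0 HB] := carleson1_bound cm; have [C C0 HC] := hilbert_norm_le.
pose K := C * (B `^ q * trace_const p q).
have K0 : 0 <= K by apply: mulr_ge0 => //; apply: mulr_ge0; [exact: powR_ge0|exact: ltW (trace_const_gt0 p q)].
have key f a : AT p q f -> has_expansion f a ->
    (AT_norm p q (hilbert mu a) <= (K `^ q^-1)%:E * AT_norm p q f)%E.
  move=> fAT fa; have [D HD] := AT_coef_growth fAT fa.
  have af := fAT.1.
  rewrite -[X in (_ <= _ * X)%E](poweRVK q0); last exact: AT_norm_ge0.
  rewrite -poweR_EFin -poweRM ?lee_fin//; last exact: poweR_ge0.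
  apply: lee_poweR_inv => //; [exact: AT_norm_ge0|by rewrite mule_ge0 ?poweR_ge0 ?lee_fin|].
  apply: le_trans (HC B f a D HB fa HD _ (fun z _ => erefl)) _.
  rewrite /K EFinM -muleA lee_wpmul2l ?lee_fin//.
  apply: nneseries_le => [k|n]; first by rewrite lee_fin powR_ge0.
  rewrite EFinM -muleA; apply: le_trans (_ : ((B `^ q)%:E * (\sum_(k < n) dytrace p q f k `^ q)%:E <= _)%E); last first.
    apply: lee_wpmul2l; [by rewrite lee_fin powR_ge0|exact: (trace_le p1 q1 n af fa)].
  rewrite sumEFin -EFinM lee_fin mulr_sumr; apply: ler_sum => k _.
  have T0 : 0 <= dytrace p q f k by rewrite mulr_ge0 ?powR_ge0// (dysup_ge0 k fa).
  by rewrite powRM ?dyratio_ge0// ler_wpM2r ?powR_ge0// ge0_ler_powR ?nnegrE ?dyratio_ge0// ltW.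
split; last by exists (K `^ q^-1).
move=> f a fAT fa; split.
  by have [_ _] := carleson1_well_defined cm fAT fa.
apply: le_lt_trans (key f a fAT fa) _.
by have [M M0 ->] := AT_norm_fin fAT.2; rewrite -EFinM ltry.
Qed.

End boundedness.

(** * Necessity of the Carleson condition *)

Section necessity_bounded.
Local Open Scope complex_scope.
Variables (R : realType) (p q : R) (mu : {finite_measure set (measurableTypeR R) -> \bar R}).
Hypotheses (p1 : 1 < p) (q1 : 1 < q) (s1 : p^-1 + q^-1 < 1).
Local Notation s := (p^-1 + q^-1).
Let q0 : 0 < q. Proof. exact: lt_trans ltr01 q1. Qed.
Let d0 k : 0 < dy k :> R. Proof. exact: dy_gt0. Qed.

Lemma Re_lim_ge (u : nat -> R[i]) (l : R[i]) (x : R) : u @ \oo --> l ->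
  (\forall n \near \oo, x <= Re (u n)) -> x <= Re l.
Proof.
move=> /cvgcP ul xu.
suff : 0 <= Re l - x by rewrite subr_ge0.
have h : Re l - x + normc (u n - l) @[n --> \oo] --> Re l - x + 0 by apply: cvgD => //; exact: cvg_cst.
rewrite addr0 in h; rewrite -(cvg_lim _ h)//.
apply: limr_ge; first by apply/cvg_ex; exists (Re l - x).
apply: filterS xu => n xn.
have := le_trans (ler_norm _) (normc_Re (u n - l)).
rewrite raddfB/=; lra.
Qed.

Lemma moment_ge b n : 0 <= b < 1 -> b ^+ n * fine (mu `[b, 1[%classic) <= moment mu n.
Proof.
move=> /andP[b0 b1].
have mb : measurable (`[b, 1[%classic : set (measurableTypeR R)) by exact: measurable_itv.
have fb : mu `[b, 1[%classic \is a fin_num by exact: fin_num_measure.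
rewrite -lee_fin EFinM fineK// /moment /Rintegral fineK; last first.
  by apply: integrable_fin_num; [exact: measurable_itv|exact: integrable_expn].
have := @step_le_integral _ _ R mu (`[0, 1[%classic) (fun t => (t ^+ n)%:E)
  (fun i : nat => if i == 0%N then `[b, 1[%classic else set0) (fun=> (b ^+ n)%:E) 1.
rewrite big_ord1/=; apply => //.
- by move=> i; case: ifP.
- by move=> i; rewrite lee_fin exprn_ge0.
- by move=> x; rewrite /= in_itv/= => /andP[x0 _]; rewrite lee_fin exprn_ge0.
- move=> i j _ _ [x []]; case: eqP => [->|//]; case: eqP => [->|//] //.
- move=> i x; rewrite ltnS leqn0 => /eqP ->; rewrite eqxx /= !in_itv/= => /andP[bx ->].
  by rewrite (le_trans b0 bx) lee_fin lerXn2r ?nnegrE ?(le_trans b0 bx).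
Qed.

(** All terms are nonnegative at b. Restricting the moments to [b, 1) gives H f(b) >= A m (sum
    b^(2k))^2, with A = (1 - b)^(1 - s) and m the mass of [b, 1), for every truncation of the
    geometric sum. *)
Lemma hilbert_test_ge b : 0 <= b < 1 ->
  (forall n, cvgn (hilbert_coef_series mu (test_coef p q b) n)) ->
  (forall z, disc 1 z -> cvgn (power_series (hilbert_coef mu (test_coef p q b)) z)) ->
  cratio mu b <= 16 * ((1 - b) `^ s * normc (hilbert mu (test_coef p q b) b%:C)).
Proof.
move=> b01 c1 c2; have /andP[b0 b1] := b01.
set a := test_coef p q b; set A := (1 - b) `^ (1 - s); set m := fine (mu `[b, 1[%classic).
have b1' : 0 < 1 - b by rewrite subr_gt0.
have A0 : 0 <= A by exact: powR_ge0.
have m0 : 0 <= m by rewrite fine_ge0.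
pose G N := \sum_(k < N) (b ^+ 2) ^+ k.
have G0 N : 0 <= G N by apply: sumr_ge0 => k _; rewrite !exprn_ge0.
have coef n K : A * m * b ^+ n * G K <= Re (hilbert_coef mu a n).
  apply: (Re_lim_ge (c1 n)); exists K => // N /= KN.
  rewrite /hilbert_coef_series /series/= Re_sum.
  apply: (@le_trans _ _ (\sum_(0 <= k < K) A * m * b ^+ n * (b ^+ 2) ^+ k)).
    by rewrite big_mkord mulr_sumr.
  rewrite (@big_cat_nat _ _ _ K 0%N N)//=.
  have term k : A * m * b ^+ n * (b ^+ 2) ^+ k <= Re ((moment mu (n + k))%:C * a k).
    rewrite /a /test_coef -rmorphM/= -/A.
    have := moment_ge (n + k) b01; rewrite -/m => h.
    have Ab : 0 <= A * b ^+ k by rewrite mulr_ge0 ?exprn_ge0.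
    have := ler_wpM2r Ab h; apply: le_trans; apply: eq_ler.
    by rewrite exprD [b ^+ 2]expr2 exprMn; ring.
  rewrite -[leLHS]addr0; apply: lerD; first by apply: ler_sum => k _.
  apply: sumr_ge0 => k _; apply: le_trans (term k).
  by rewrite !mulr_ge0 ?exprn_ge0.
have tot N : A * m * G N * G N <= Re (hilbert mu a b%:C).
  have db : disc 1 (b%:C : R[i]) by rewrite /disc /mkset normc_real_ge0.
  apply: (Re_lim_ge (c2 _ db)); exists N => // K /= NK.
  rewrite /power_series /series/= Re_sum.
  apply: (@le_trans _ _ (\sum_(0 <= n < N) A * m * G N * (b ^+ 2) ^+ n)).
    by rewrite big_mkord mulr_sumr.
  rewrite (@big_cat_nat _ _ _ N 0%N K)//=.
  have term n : A * m * G N * (b ^+ 2) ^+ n <= Re (hilbert_coef mu a n * b%:C ^+ n).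
    rewrite -rmorphXn Re_mul_real.
    have bn : 0 <= b ^+ n by rewrite exprn_ge0.
    have := ler_wpM2r bn (coef n N); apply: le_trans; apply: eq_ler.
    by rewrite [b ^+ 2]expr2 exprMn; ring.
  rewrite -[leLHS]addr0; apply: lerD; first by apply: ler_sum => k _.
  apply: sumr_ge0 => k _; apply: le_trans (term k).
  by rewrite !mulr_ge0 ?exprn_ge0.
(* Half of the geometric series suffices: 1 - b^(2N) >= 1/2 and 1 - b^2 <= 2 (1 - b) give a sum of
   at least 1 / (4 (1 - b)), whose square accounts for the 16. *)
have [N hN] : exists N, (b ^+ 2) ^+ N <= 2^-1.
  have hb : `|b ^+ 2| < 1 by rewrite ger0_norm ?exprn_ge0// expr_lt1.
  have /cvgrPdist_le/(_ 2^-1)[|N _ /(_ N (leqnn N))] := cvg_expr hb; first by rewrite invr_gt0.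
  by rewrite /= sub0r normrN ger0_norm ?exprn_ge0//; exists N.
have GN : (4 * (1 - b))^-1 <= G N.
  rewrite -[leLHS]mul1r ler_pdivrMr ?mulr_gt0//.
  have h := one_sub_mul_sum (b ^+ 2) N; rewrite -/(G N) in h.
  have h2 : (1 - b ^+ 2) * G N <= 2 * (1 - b) * G N.
    rewrite ler_wpM2r// -subr_ge0.
    have -> : 2 * (1 - b) - (1 - b ^+ 2) = (1 - b) ^+ 2 by ring.
    exact: exprn_ge0 (ltW b1').
  lra.
have h1 : A * m * (4 * (1 - b))^-1 * (4 * (1 - b))^-1 <= normc (hilbert mu a b%:C).
  apply: le_trans (le_trans (ler_norm _) (normc_Re _)); apply: le_trans (tot N).
  have g0 : 0 <= (4 * (1 - b))^-1 by rewrite invr_ge0 mulr_ge0// ltW.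
  by apply: ler_pM => //; rewrite ?mulr_ge0// ler_wpM2l// mulr_ge0.
have S0 : 0 <= (1 - b) `^ s by exact: powR_ge0.
rewrite mulrA; have := ler_wpM2l (mulr_ge0 (ler0n R 16) S0) h1; apply: le_trans.
have -> : 16 * (1 - b) `^ s * (A * m * (4 * (1 - b))^-1 * (4 * (1 - b))^-1) =
   (A * (1 - b) `^ s) * m * (16 * (4 * (1 - b))^-1 * (4 * (1 - b))^-1) by ring.
rewrite /A -powRD ?(gt_eqF b1') ?implybT// subrK powRr1 ?(ltW b1')//.
rewrite /cratio -/m; apply: eq_ler; field.
by rewrite subr_eq0 gt_eqF.
Qed.

Lemma bounded_carleson1 : hilbert_well_defined mu p q -> hilbert_bounded mu p q -> carleson1 mu.
Proof.
move=> wd [maps [C HC]].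
have [M M0 HM] := test_fun_norm p1 q1 s1.
apply/carleson1P.
(* The trace inequality for the image of the test function; the sign of C is unknown, hence its
   absolute value. *)
pose T := (trace_const p q * (`|C| * M `^ q^-1) `^ q) `^ q^-1.
exists (16 * T) => b b01; have /andP[b0 b1] := b01.
have Mb : (AT_norm p q (test_fun p q b) <= (M `^ q^-1)%:E)%E by exact: (AT_norm_le_powR q1 M0 (HM b b01)).
have fAT : AT p q (test_fun p q b).
  by split; [exact: test_fun_analytic|exact: le_lt_trans Mb (ltry _)].
have fe : has_expansion (test_fun p q b) (test_coef p q b) by exact: test_fun_expansion.
have [c1 c2 c3] := wd _ _ fAT fe.
apply: le_trans (hilbert_test_ge b01 c1 c2) _; rewrite ler_wpM2l//.
have [k kb] := dyadic_cover b01.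
have he : has_expansion (hilbert mu (test_coef p q b)) (hilbert_coef mu (test_coef p q b)) by move=> z; exact: c2.
set h := hilbert _ _ in c3 he *.
have n1 : (AT_norm p q h <= (`|C| * M `^ q^-1)%:E)%E.
  apply: le_trans (HC _ _ fAT fe) _; rewrite EFinM.
  apply: le_trans (_ : (`|C|%:E * AT_norm p q (test_fun p q b) <= _)%E).
    by apply: lee_wpmul2r; [exact: AT_norm_ge0|rewrite lee_fin ler_norm].
  by apply: lee_wpmul2l; [rewrite lee_fin|].
have n2 := AT_norm_powR_le q1 n1.
have := trace_term p1 q1 c3 he kb => n3.
have t0 : 0 <= trace_const p q := ltW (trace_const_gt0 p q).
have {}n3 := le_trans n3 (lee_wpmul2l (eqbRL (lee_fin _ _) t0) n2).
rewrite -EFinM lee_fin in n3.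
have x0 : 0 <= dy k `^ s * normc (h b%:C) by rewrite mulr_ge0 ?powR_ge0 ?normc_ge0.
have n4 : dy k `^ s * normc (h b%:C) <= T.
  apply: (powR_le_cancel q0 x0); first exact: powR_ge0.
  by rewrite /T -powRrM mulVf ?gt_eqF// powRr1// mulr_ge0 ?powR_ge0.
apply: le_trans n4.
rewrite ler_wpM2r ?normc_ge0//; apply: ge0_ler_powR; rewrite ?nnegrE ?subr_ge0 ?(ltW b1) ?(ltW (d0 k))//.
  by rewrite addr_ge0// invr_ge0 ltW// (lt_trans ltr01).
by have [] := dyadic_bounds kb.
Qed.

End necessity_bounded.

(** * Compactness *)

Section necessity_compact.
Local Open Scope complex_scope.
Variables (R : realType) (p q : R) (mu : {finite_measure set (measurableTypeR R) -> \bar R}).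
Hypotheses (p1 : 1 < p) (q1 : 1 < q) (s1 : p^-1 + q^-1 < 1).
Local Notation s := (p^-1 + q^-1).
Local Notation leb := (@lebesgue_measure R).
Local Notation leb2 := (leb \x leb)%E.
Let p0 : 0 < p. Proof. exact: lt_trans ltr01 p1. Qed.
Let q0 : 0 < q. Proof. exact: lt_trans ltr01 q1. Qed.
Let d0 k : 0 < dy k :> R. Proof. exact: dy_gt0. Qed.

Let disc_integral (f : R[i] -> R[i]) (b : R) : \bar R :=
  (\int[leb2]_(w in plane_disc b%:C ((1 - b) / 4)%R) (normc (f (w.1 +i* w.2)) `^ p)%:E)%E.

Let plane_disc_sub (b : R) (w : R[i]) : 0 <= b < 1 -> normc (w - b%:C) < (1 - b) / 4 -> disc 1 w.
Proof.
move=> /andP[b0 b1] h; rewrite /disc /mkset.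
by have := le_normcD (w - b%:C) b%:C; rewrite subrK (normc_real_ge0 b0); lra.
Qed.

(** In 32 * 4^p, 16 is the squared radius, one 2^p comes from the sub-mean inequality, the other
    from splitting u - v, and the last 2 from keeping the larger of two integrals. *)
Let kappa : R := 2 / (5 * pi) / (32 * 4 `^ p).

Let kappa0 : 0 < kappa.
Proof. by rewrite /kappa !divr_gt0// ?mulr_gt0 ?pi_gt0 ?powR_gt0. Qed.

Let disc_integral_AT (f : R[i] -> R[i]) (b y : R) : analytic f -> 0 <= b < 1 -> 0 <= y ->
  ((y `^ p * (1 - b) ^+ 2 / (32 * 4 `^ p))%:E <= disc_integral f b)%E ->
  ((kappa `^ (q / p) / 4 * ((1 - b) `^ s * y) `^ q)%:E <= AT_norm p q f `^ q)%E.
Proof.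
move=> af b01 y0 hy; have /andP[b0 b1] := b01; have b1' : 0 < 1 - b by rewrite subr_gt0.
pose v := kappa * y `^ p * (1 - b).
have pib : (1 - b) / 4 <= pi *+ 2 :> R by rewrite mulr2n; have := @pi_ge2 R; lra.
have ky0 : 0 <= kappa * y `^ p by exact: mulr_ge0 (ltW kappa0) (powR_ge0 _ _).
have v0 : 0 <= v by exact: mulr_ge0 ky0 (ltW b1').
pose E (i : nat) : set R := if i == 0%N then `[0, (1 - b) / 4[%classic else set0.
have := @AT_norm_step _ _ _ p1 q1 f E (fun=> v) 1.
rewrite big_ord1 /=; have -> : leb (E 0%N) = ((1 - b) / 4)%:E.
  by rewrite /E/= lebesgue_measure_itv/= lte_fin divr_gt0// sube0.
move=> h; apply: le_trans (h _ _ _ _).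
- rewrite -EFinM lee_fin; apply: eq_ler.
  rewrite /v [in RHS](powRM _ ky0 (ltW b1')) [in RHS](powRM _ (ltW kappa0) (powR_ge0 _ _)).
  rewrite [in LHS](powRM _ (powR_ge0 _ _) y0).
  rewrite -!powRrM.
  have -> : p * (q / p) = q by field; exact: lt0r_neq0.
  have -> : s * q = q / p + 1 by field; rewrite !lt0r_neq0.
  rewrite powRD ?(gt_eqF b1') ?implybT// powRr1 ?(ltW b1')//; ring.
- by move=> i; rewrite /E; case: ifP => // _; exact: measurable_itv.
- by [].
- by move=> i j _ _ [x []]; rewrite /E; case: eqP => [->|//]; case: eqP => [->|//].
- move=> i t; rewrite ltnS leqn0 => /eqP ->; rewrite /E /= in_itv/= => /andP[t0 t1].
  split; first by rewrite t0 (le_trans (ltW t1)).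
  have tt : `|t - 0| <= (1 - b) / 4 by rewrite subr0 ger0_norm// ltW.
  apply: le_trans (tent_integral_disc p1 af b01 tt); rewrite cis0 mulr1 -/(disc_integral f b).
  apply: le_trans (lee_wpmul2l _ hy); last first.
    by rewrite lee_fin !divr_ge0 ?mulr_ge0 ?pi_ge0 ?(ltW b1').
  have gen (P F Y C : R) : P != 0 -> F != 0 -> C != 0 ->
      2 / (5 * P) / (32 * F) * Y * C = 2 / (5 * P) / C * (Y * C ^+ 2 / (32 * F)).
    by move=> P0 F0 C0; field; rewrite P0 F0 C0.
  by rewrite -EFinM lee_fin; apply/eq_ler/gen; rewrite lt0r_neq0 ?powR_gt0 ?pi_gt0.
Qed.

(* Only [h] needs an expansion: the mean value inequality is applied to it, and
   the resulting disc integral is then split. *)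
Lemma difference_point : exists2 K : R, 0 < K & forall h a u v b e,
  analytic h -> has_expansion h a -> analytic u -> analytic v ->
  (forall z, disc 1 z -> h z = u z - v z) -> 0 <= b < 1 ->
  (AT_norm p q u `^ q <= e%:E)%E -> (AT_norm p q v `^ q <= e%:E)%E ->
  ((1 - b) `^ s * normc (h b%:C)) `^ q <= K * e.
Proof.
exists ((kappa `^ (q / p) / 4)^-1); first by rewrite invr_gt0 divr_gt0 ?powR_gt0.
move=> h a u v b e ah ha au av huv b01 hu hv.
have /andP[b0 b1] := b01; have b1' : 0 < 1 - b by rewrite subr_gt0.
set y := normc (h b%:C); have y0 : 0 <= y by exact: normc_ge0.
have k0 : 0 < kappa `^ (q / p) / 4 by rewrite divr_gt0 ?powR_gt0.
rewrite [leRHS]mulrC ler_pdivlMr// mulrC -lee_fin.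
set X := y `^ p * (1 - b) ^+ 2 / (32 * 4 `^ p).
have mean : ((2 * X)%:E <= disc_integral u b + disc_integral v b)%E.
  have r0 : 0 < (1 - b) / 4 by rewrite divr_gt0.
  have zr : normc (b%:C : R[i]) + (1 - b) / 4 < 1 by rewrite normc_real_ge0//; lra.
  have sm := submean p1 ah ha r0 zr; rewrite -/y in sm.
  have split_le : (\int[leb2]_(w in plane_disc b%:C ((1 - b) / 4)%R) (normc (h (w.1 +i* w.2)) `^ p)%:E <=
      (2 `^ p)%:E * (disc_integral u b + disc_integral v b))%E.
    have mf f : analytic f -> measurable_fun (plane_disc b%:C ((1 - b) / 4))
        (fun w : measurableTypeR R * measurableTypeR R => (normc (f (w.1 +i* w.2)) `^ p)%:E).
      by move=> af; apply: measurable_normc_pow => // w wb; exact: plane_disc_sub b01 wb.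
    have mD : measurable (plane_disc (b%:C : R[i]) ((1 - b) / 4)) by exact: measurable_plane_disc.
    rewrite /disc_integral -ge0_integralD//; last 4 first.
    - by move=> w _; rewrite lee_fin powR_ge0.
    - exact: mf.
    - by move=> w _; rewrite lee_fin powR_ge0.
    - exact: mf.
    rewrite -ge0_integralZl_EFin//; last 2 first.
    - by move=> w _; rewrite -EFinD lee_fin addr_ge0 ?powR_ge0.
    - by apply: emeasurable_funD; exact: mf.
    apply: ge0_le_integral_nomeas => w wD.
    - by rewrite lee_fin powR_ge0.
    - by apply: mule_ge0; [|apply: adde_ge0]; rewrite lee_fin powR_ge0.
    split=> //; rewrite -EFinD -EFinM lee_fin huv; last exact: plane_disc_sub b01 wD.
    apply: le_trans (powR_add_le p0 (normc_ge0 _) (normc_ge0 _)).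
    apply: ge0_ler_powR; rewrite ?nnegrE ?addr_ge0 ?normc_ge0 ?(ltW p0)//.
    by have := le_normcD (u (w.1 +i* w.2)) (- v (w.1 +i* w.2)); rewrite normcN.
  have {split_le}sm := le_trans sm (lee_wpmul2l (eqbRL (lee_fin _ _) (powR_ge0 2 p)) split_le).
  have p4 : 0 < 4 `^ p :> R by exact: powR_gt0.
  rewrite muleA -EFinM in sm.
  have E4 : 2 `^ p * 2 `^ p = 4 `^ p :> R by rewrite -powRM// -natrM.
  rewrite E4 in sm.
  have : ((2 * X * 4 `^ p)%:E <= (4 `^ p)%:E * (disc_integral u b + disc_integral v b))%E.
    apply: le_trans sm; rewrite lee_fin; apply: eq_ler; rewrite /X; field.
    by rewrite lt0r_neq0.
  by rewrite mulrC EFinM lee_pmul2l// ?lte_fin// .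
(* At least one of the two disc integrals reaches half of the bound on their sum. *)
have [hX|hX] := leP X%:E (disc_integral u b).
  exact: le_trans (disc_integral_AT au b01 y0 hX) hu.
have [hX'|hX'] := leP X%:E (disc_integral v b).
  exact: le_trans (disc_integral_AT av b01 y0 hX') hv.
by have := le_lt_trans mean (lteD hX hX'); rewrite -EFinD lte_fin mulr2n mulrDl !mul1r ltxx.
Qed.

(** If the ratio stays above e along points b_n tending to 1, take a subsequence of images h_i
    converging to g. No expansion of g is available, so h_i is compared with one fixed h_J, both
    being close to g: the trace of h_J at b_n tends to 0, while that of h_i does not. *)
Lemma compact_vanishing_carleson1 : hilbert_compact mu p q -> vanishing_carleson1 mu.
Proof.
move=> [wd maps cpt]; apply/vanishing_carleson1P => e e0.
apply: contrapT => /forallNP H.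
have {}H n : exists t, 1 - dy n < t < 1 /\ e < cratio mu t.
  have /existsNP[t /not_implyP[t1 /negP]] := H n; rewrite -ltNge => t2.
  by exists t.
have [b Hb] := choice H.
have b1 n : b n < 1 by have [/andP[]] := Hb n.
have bd n : 1 - dy n < b n by have [/andP[]] := Hb n.
have b01 n : 0 <= b n < 1.
  by rewrite b1 andbT; have := bd n; have := dy_le1 R n; lra.
have [M M0 HM] := test_fun_norm p1 q1 s1.
have fM n : (AT_norm p q (test_fun p q (b n)) <= (M `^ q^-1)%:E)%E.
  by apply: (AT_norm_le_powR q1 M0); exact: HM.
have fAT n : AT p q (test_fun p q (b n)).
  by split; [exact: test_fun_analytic|exact: le_lt_trans (fM n) (ltry _)].
have fe n : has_expansion (test_fun p q (b n)) (test_coef p q (b n)) by exact: test_fun_expansion.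
have [sg [g [sgi gAT lim]]] := cpt _ _ fAT fe (ex_intro _ _ fM).
pose h i := hilbert mu (test_coef p q (b (sg i))).
have WD i := wd _ _ (fAT (sg i)) (fe (sg i)).
have hAT i : AT p q (h i) by exact: maps (fAT _) (fe _).
have he i : has_expansion (h i) (hilbert_coef mu (test_coef p q (b (sg i)))).
  by move=> z z1; have [_ c _] := WD i; exact: c.
have [K K0 HK] := difference_point.
(* Two errors x and the factor 16 of [hilbert_test_ge] give e / 2 < e. *)
pose x := e / 64.
have x0 : 0 < x by rewrite divr_gt0.
pose dl := (x `^ q / K) `^ q^-1.
have dl0 : 0 < dl by rewrite powR_gt0// divr_gt0 ?powR_gt0.
have dlE : dl `^ q = x `^ q / K.
  by rewrite /dl -powRrM mulVf ?gt_eqF// powRr1// divr_ge0 ?powR_ge0// ltW.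
have := le_cvge0 (fun i => AT_norm_ge0 p q _) lim dl0 => -[J _ HJ].
have hgb i : (J <= i)%N -> (AT_norm p q (fun z => h i z - g z)%R `^ q <= (dl `^ q)%:E)%E.
  by move=> Ji; apply: AT_norm_powR_le => //; exact: HJ.
have hJ := trace_cvg0 p1 q1 (hAT J).1 (he J) (hAT J).2.
have /cvgrPdist_le/(_ x x0)[N _ HN] := hJ.
pose i := maxn J N.
have Ji : (J <= i)%N by exact: leq_maxl.
have si : (i <= sg i)%N.
  elim: (i) => // m IH; exact: leq_ltn_trans IH (sgi _ _ (ltnSn m)).
have Ni : (N <= sg i)%N by apply: leq_trans si; exact: leq_maxr.
set B := b (sg i).
have [B0 B1] := andP (b01 (sg i)); rewrite -/B in B0 B1.
have S0 : 0 <= (1 - B) `^ s by exact: powR_ge0.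
have e1 : (1 - B) `^ s * normc (h J B%:C) <= x.
  have [k kB] := dyadic_cover (b01 (sg i)); rewrite -/B in kB.
  have [_ _ k1 k2] := dyadic_bounds kB.
  have Nk : (N <= k)%N.
    rewrite leqNgt; apply/negP => kN.
    have := bd (sg i); rewrite -/B => hB.
    have : dy (sg i) <= dy k.+1 :> R by apply: dy_le; exact: leq_trans kN Ni.
    rewrite dyS; lra.
  have := HN k Nk; rewrite /= sub0r normrN => /(le_trans (ler_norm _)); apply: le_trans.
  rewrite /dytrace; apply: ler_pM; rewrite ?normc_ge0//; last exact: dysup_ub (he J) kB.
  apply: ge0_ler_powR; rewrite ?nnegrE ?subr_ge0 ?(ltW B1) ?(ltW (d0 k))//.
  by rewrite addr_ge0// invr_ge0 ltW.
(* Write h_i - h_J = (h_i - g) - (h_J - g) and use the point estimate for such differences. *)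
have e2 : (1 - B) `^ s * normc (h i B%:C - h J B%:C) <= x.
  have aH : analytic (fun z => h i z - h J z) by apply: analyticB; [exact: (hAT i).1|exact: (hAT J).1].
  have aD j : analytic (fun z => h j z - g z) by apply: analyticB; [exact: (hAT j).1|exact: gAT.1].
  have := HK _ _ _ _ B _ aH (expansionB (he i) (he J)) (aD i) (aD J) _ (b01 _) (hgb i Ji) (hgb J (leqnn J)).
  rewrite dlE [K * _]mulrC divfK ?gt_eqF// => e3.
  apply: (powR_le_cancel q0 (mulr_ge0 S0 (normc_ge0 _)) (ltW x0)).
  by apply: e3 => z _; rewrite opprB addrA subrK.
have [c1 c2 _] := WD i.
have [_] := Hb (sg i); rewrite -/B => eB.
have := hilbert_test_ge (b01 (sg i)) c1 c2; rewrite -/B -/(h i) => lo.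
have tri : (1 - B) `^ s * normc (h i B%:C) <= x + x.
  apply: le_trans (lerD e2 e1); rewrite -mulrDr ler_wpM2l//.
  by have := le_normcD (h i B%:C - h J B%:C) (h J B%:C); rewrite subrK.
rewrite /x in tri; lra.
Qed.

End necessity_compact.

(** * Extraction of convergent coefficients and uniform convergence on compact sets *)

Section subsequence.
Local Open Scope complex_scope.
Variable R : realType.

Lemma product_near (I : eqType) (J : seq I) (a : forall _ : I, R) (e : R) : 0 < e ->
  nbhs (a : prod_topology (fun=> R)) [set f : forall _ : I, R | forall i, i \in J -> `|f i - a i| < e].
Proof.
move=> e0; have FF : Filter (nbhs (a : prod_topology (fun=> R))) by exact: nbhs_filter.
elim: J => [|i J IH]; first by apply: (@filterS _ _ FF _ _ _ (@filterT _ _ FF)) => f _ i.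
have h : nbhs (a : prod_topology (fun=> R)) [set f : forall _ : I, R | `|f i - a i| < e].
  have := @proj_continuous I (fun=> R) i a.
  move=> /(_ [set x : R | `|x - a i| < e]); apply.
  by exists e => //= x; rewrite /ball_/= distrC.
apply: filterS (filterI h IH) => f [fi fJ] j; rewrite inE => /predU1P[->|]//; exact: fJ.
Qed.

(** The sequence lives in a product of segments, compact by Tychonoff; a is a cluster point, and a
    finite set of coordinates within dy m is a neighbourhood. *)
Lemma cluster_index (I : eqType) (J : nat -> seq I) (y : nat -> I -> R) (c : I -> R) :
  (forall j i, `|y j i| <= c i) -> exists a : I -> R, forall m j0, exists j, (j0 < j)%N /\
    forall i, i \in J m -> `|y j i - a i| < dy m.
Proof.
move=> yc.
pose F : set_system (prod_topology (fun _ : I => R)) := (y : nat -> prod_topology (fun _ : I => R)) @ \oo.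
have PF : ProperFilter F by exact: fmap_proper_filter.
have := @tychonoff I (fun=> R) (fun i => `[- c i, c i]%classic) (fun i => @segment_compact R _ _) F PF.
case.
  exists 0%N => // j _ i; rewrite /= in_itv/=; have := yc j i; rewrite ler_norml; exact.
move=> a [_ cl]; exists a => m j0.
have FA : F [set f | exists2 j, (j0 < j)%N & f = y j].
  by exists j0.+1 => // j /= jj; exists j.
have [f [[j jj ->] fa]] := cl _ _ FA (@product_near I (J m) a (dy m) (dy_gt0 R m)).
by exists j; split => // i iJ; exact: fa.
Qed.

Lemma diagonal_subsequence (x : nat -> nat -> R[i]) (c : nat -> R) :
  (forall j n, normc (x j n) <= c n) -> exists (s : nat -> nat) (a : nat -> R[i]),
  {homo s : i j / (i < j)%N} /\ forall n j, (n < j)%N -> normc (x (s j) n - a n) <= 2 * dy j.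
Proof.
move=> xc.
pose y j (i : nat * bool) := if i.2 then Re (x j i.1) else Im (x j i.1).
pose J m : seq (nat * bool) := [seq (n, b) | n <- iota 0 m, b <- [:: true; false]].
have yc j i : `|y j i| <= c i.1.
  by apply: le_trans (xc j i.1); rewrite /y; case: ifP => _; [exact: normc_Re|exact: normc_Im].
have [a Ha] := cluster_index J yc.
have Ha' (mj : nat * nat) : exists j, (mj.2 < j)%N /\ forall i, i \in J mj.1 -> `|y j i - a i| < dy mj.1.
  exact: Ha.
have [pick Hpick] := choice Ha'.
(* Step j + 1 picks an index beyond the previous one at which the first j + 1 coefficients, real and
   imaginary parts, are within dy (j + 1) of the cluster point. *)
pose s := fix s j := if j is k.+1 then pick (k.+1, s k) else pick (0, 0)%N.
exists s, (fun n => a (n, true) +i* a (n, false)); split.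
  apply: homo_ltn; first exact: ltn_trans.
  by move=> j; have [] := Hpick (j.+1, s j).
move=> n j nj.
have H b : `|y (s j) (n, b) - a (n, b)| < dy j.
  case: j nj => // j nj; have [_] := Hpick (j.+1, s j); apply.
  by apply/allpairsP; exists (n, b); split; [rewrite /= -/(iota 0 j.+1) mem_iota|case: (b)|].
apply: le_trans (normc_le_ReIm _) _.
have h1 := H true; have h2 := H false; rewrite /y/= in h1 h2.
have -> : Re (x (s j) n - (a (n, true) +i* a (n, false))) = Re (x (s j) n) - a (n, true) by case: (x _ _).
have -> : Im (x (s j) n - (a (n, true) +i* a (n, false))) = Im (x (s j) n) - a (n, false) by case: (x _ _).
lra.
Qed.

Lemma coef_term_le (a : nat -> R[i]) (t : R) k : 0 <= t ->
  normc (a k) * t ^+ k <= \sum_(i < k.+1) normc (a i) * t ^+ i.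
Proof.
move=> t0; rewrite big_ord_recr/= lerDr sumr_ge0// => i _.
by rewrite mulr_ge0 ?normc_ge0 ?exprn_ge0.
Qed.

Lemma growth_expansion (a : nat -> R[i]) (D tau : R) :
  (forall t K, 0 <= t < 1 -> \sum_(k < K) normc (a k) * t ^+ k <= D * (1 - t) `^ (- tau)) ->
  has_expansion (fun z => limn (power_series a z)) a.
Proof.
move=> aD z z1.
suff : cvgn (power_series a z) by [].
apply: abs_cvgc_series.
rewrite (_ : (fun k => normc (a k * z ^+ k)) = (fun k => normc (a k) * normc z ^+ k)); last first.
  by apply/funext => k; rewrite normcM normcX.
have z1' : normc z < 1 by [].
have z0 := normc_ge0 z.
pose t := (1 + normc z) / 2.
have t01 : 0 <= t < 1 by rewrite /t; apply/andP; split; lra.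
apply: (@bounded_coef_cvg _ a _ t (D * (1 - t) `^ (- tau))) => //; first by rewrite /t; lra.
move=> k; apply: le_trans (coef_term_le a k _) (aD _ _ t01); by case/andP: t01.
Qed.

(** Separates what coefficientwise convergence makes small, the head, from what a bound at the
    larger radius r' makes small uniformly, the tail. *)
Lemma power_series_head_tail (f : R[i] -> R[i]) (a : nat -> R[i]) (r r' E : R) (z : R[i]) K :
  has_expansion f a -> 0 <= r -> r < r' -> r' < 1 -> (forall k, normc (a k) * r' ^+ k <= E) -> normc z <= r ->
  normc (f z) <= \sum_(k < K) normc (a k) + E * (r / r') ^+ K / (1 - r / r').
Proof.
move=> fa r0 rr r1 aE zr.
have r'0 : 0 < r' by exact: le_lt_trans r0 rr.
set ro := r / r'.
have ro0 : 0 <= ro by rewrite divr_ge0// ltW.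
have ro1 : 0 < 1 - ro by rewrite subr_gt0 /ro ltr_pdivrMr// mul1r.
have E0 : 0 <= E by apply: le_trans (aE 0%N); rewrite mulr_ge0 ?normc_ge0 ?exprn_ge0 ?(ltW r'0).
have z1 : disc 1 z by exact: le_lt_trans zr (lt_trans rr r1).
apply: (normc_lim_le (fa z z1) (cvg_cst _)); exists K => // n /= Kn.
rewrite /power_series/series/= (@big_cat_nat _ _ _ K 0%N n)//=.
apply: le_trans (le_normcD _ _) _; apply: lerD.
  rewrite big_mkord; apply: le_trans (normc_sum _ _ _) _; apply: ler_sum => k _.
  rewrite normcM normcX ler_piMr ?normc_ge0// exprn_ile1 ?normc_ge0//.
  exact: ltW.
apply: le_trans (normc_sum _ _ _) _.
rewrite -{1}[K]add0n big_addn big_mkord.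
apply: (@le_trans _ _ (\sum_(i < n - K) E * ro ^+ K * ro ^+ i)).
  apply: ler_sum => i _; rewrite -mulrA -exprD addnC.
  apply: le_trans (normc_term_le _ _ zr) _.
  rewrite /ro expr_div_n mulrA ler_pdivlMr ?exprn_gt0// mulrAC.
  by rewrite ler_wpM2r ?exprn_ge0.
rewrite -mulr_sumr ler_wpM2l ?mulr_ge0 ?exprn_ge0//.
by apply: geometric_sum_le; rewrite ro0 -subr_gt0.
Qed.

End subsequence.

(** * Sufficiency of the vanishing Carleson condition *)

Section sufficiency_compact.
Local Open Scope complex_scope.
Variables (R : realType) (p q : R) (mu : {finite_measure set (measurableTypeR R) -> \bar R}).
Hypotheses (p1 : 1 < p) (q1 : 1 < q) (s1 : p^-1 + q^-1 < 1) (p2 : 2 < p).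
Local Notation s := (p^-1 + q^-1).
Local Notation tau := (coef_exp p q).
Let q0 : 0 < q. Proof. exact: lt_trans ltr01 q1. Qed.
Let d0 k : 0 < dy k :> R. Proof. exact: dy_gt0. Qed.
Let tau01 : 0 < tau < 1. Proof. exact: coef_exp_bound. Qed.

Lemma small_sum (T : nat -> nat -> R) (w : R) : 0 <= w -> (forall j k, 0 <= T j k) ->
  (forall k e, 0 < e -> \forall j \near \oo, T j k <= e) ->
  forall N e, 0 < e -> \forall j \near \oo, \sum_(k < N) (w * T j k) `^ q <= e.
Proof.
move=> w0 T0 HT; elim=> [|N IH] e e0.
  by apply: nearW => j; rewrite big_ord0 ltW.
(* Dividing by w + 1 rather than w covers w = 0. *)
pose th := (e / 2) `^ q^-1 / (w + 1).
have w1 : 0 < w + 1 by rewrite ltr_wpDl.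
have e2 : 0 < e / 2 by rewrite divr_gt0.
have th0 : 0 < th by rewrite divr_gt0// powR_gt0.
apply: filterS2 (IH _ e2) (HT N th th0) => j h1 h2.
rewrite big_ord_recr/= [e]splitr; apply: lerD => //.
have -> : e / 2 = ((e / 2) `^ q^-1) `^ q by rewrite -powRrM mulVf ?gt_eqF// powRr1// ltW.
apply: ge0_ler_powR; rewrite ?nnegrE ?mulr_ge0 ?powR_ge0 ?(ltW q0)//.
apply: (@le_trans _ _ ((w + 1) * th)).
  by apply: ler_pM => //; rewrite lerDl.
by rewrite /th mulrC divfK// gt_eqF.
Qed.

Let has_growth (a : nat -> R[i]) (D : R) :=
  forall t K, 0 <= t < 1 -> \sum_(k < K) normc (a k) * t ^+ k <= D * (1 - t) `^ (- tau).

Let has_growthB a b D E : has_growth a D -> has_growth b E -> has_growth (fun k => a k - b k) (D + E).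
Proof.
move=> aD bE t K t01; have /andP[t0 _] := t01.
rewrite mulrDl; apply: le_trans (lerD (aD t K t01) (bE t K t01)); rewrite -big_split/=.
apply: ler_sum => k _; rewrite -mulrDl ler_wpM2r ?exprn_ge0//.
by have := le_normcD (a k) (- b k); rewrite normcN.
Qed.

Let growth_limit (a : nat -> nat -> R[i]) (b : nat -> R[i]) D :
  (forall j, has_growth (a j) D) -> (forall n j, (n < j)%N -> normc (a j n - b n) <= 2 * dy j) ->
  has_growth b D.
Proof.
move=> aD ab t K t01; have /andP[t0 t1] := t01.
apply/ler_addgt0Pr => e e0.
have [j0 hj0] : exists j, dy j < e / (2 * K.+1%:R) by apply: dy_small; rewrite divr_gt0// mulr_gt0.
pose j := maxn j0 K.
have hj : dy j <= e / (2 * K.+1%:R) by apply: le_trans (ltW hj0); apply: dy_le; exact: leq_maxl.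
apply: le_trans (lerD (aD j t K t01) (lexx e)).
apply: (@le_trans _ _ (\sum_(k < K) (normc (a j k) * t ^+ k + 2 * dy j))).
  apply: ler_sum => k _.
  have kj : (k < j)%N by apply: leq_trans (ltn_ord k) _; exact: leq_maxr.
  have h := ler_normcB (b k) (a j k); rewrite normcBC in h.
  have {}h : normc (b k) <= normc (a j k) + 2 * dy j by have := ab k j kj; lra.
  apply: le_trans (ler_wpM2r (exprn_ge0 k t0) h) _; rewrite mulrDl lerD2l.
  by rewrite ler_piMr ?mulr_ge0 ?(ltW (d0 _))// exprn_ile1// ltW.
rewrite big_split/= lerD2l sumr_const card_ord -[leLHS]mulr_natr.
rewrite ler_pdivlMr ?mulr_gt0// in hj; apply: le_trans hj.
by rewrite [2 * _]mulrC -mulrA ler_wpM2l ?(ltW (d0 _))// ler_wpM2l// ler_nat.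
Qed.

(** A Montel argument: the common growth bound at r' controls all tails on the k-th interval, and
    the finitely many remaining coefficients tend to 0. *)
Let dysup_null (f : nat -> R[i] -> R[i]) (c : nat -> nat -> R[i]) D k :
  (forall j, has_expansion (f j) (c j)) -> (forall j, has_growth (c j) D) ->
  (forall n j, (n < j)%N -> normc (c j n) <= 2 * dy j) ->
  forall e, 0 < e -> \forall j \near \oo, dysup (f j) k <= e.
Proof.
move=> fc cD c0 e e0.
pose r : R := 1 - dy k.+1; pose r' : R := 1 - dy k.+2.
have dk := d0 k.+2; have dk1 := dy_le1 R k.+2; have dk2 := dy_le1 R k.+1.
have r0 : 0 <= r by rewrite subr_ge0.
have rr : r < r' by rewrite ltrD2l ltrN2 dy_lt.
have r1 : r' < 1 by rewrite ltrBlDr ltrDl.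
have r'0 : 0 < r' by exact: le_lt_trans rr.
pose E := D * (1 - r') `^ (- tau).
have cE j i : normc (c j i) * r' ^+ i <= E.
  apply: le_trans (coef_term_le (c j) i (ltW r'0)) _; apply: cD; by rewrite (ltW r'0).
set ro := r / r'.
have ro0 : 0 <= ro by rewrite divr_ge0// ltW.
have ro1 : ro < 1 by rewrite /ro ltr_pdivrMr// mul1r.
have : E * ro ^+ K / (1 - ro) @[K --> \oo] --> E * 0 / (1 - ro).
  apply: cvgM; last exact: cvg_cst.
  by apply: cvgM; [exact: cvg_cst|apply: cvg_expr; rewrite ger0_norm].
rewrite mulr0 mul0r => /cvgrPdist_le/(_ (e / 2))[|K _ /(_ K (leqnn K))]; first by rewrite divr_gt0.
rewrite /= sub0r normrN => /(le_trans (ler_norm _)) HK.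
have [j0 hj0] : exists j, dy j < e / 2 / (2 * K.+1%:R) by apply: dy_small; rewrite !divr_gt0// mulr_gt0.
exists (maxn j0 K) => // j /= jm.
apply: dysup_le => t kt; have [t0 t1 _ _] := dyadic_bounds kt.
have tr : normc (t%:C : R[i]) <= r.
  by rewrite normc_real_ge0//; move/dyadicE : kt => /andP[_ /ltW].
apply: le_trans (power_series_head_tail K (fc j) r0 rr r1 (cE j) tr) _.
rewrite -/ro [e]splitr; apply: lerD => //.
apply: (@le_trans _ _ (\sum_(i < K) 2 * dy j)).
  apply: ler_sum => i _; apply: c0; apply: leq_trans (ltn_ord i) _.
  by apply: leq_trans jm; exact: leq_maxr.
have hj : dy j <= e / 2 / (2 * K.+1%:R).
  by apply: le_trans (ltW hj0); apply: dy_le; apply: leq_trans jm; exact: leq_maxl.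
rewrite sumr_const card_ord -[leLHS]mulr_natr.
rewrite ler_pdivlMr ?mulr_gt0// in hj; apply: le_trans hj.
by rewrite [2 * _]mulrC -mulrA ler_wpM2l ?(ltW (d0 _))// ler_wpM2l// ler_nat.
Qed.

Let growth_wd a D : vanishing_carleson1 mu -> has_growth a D ->
  [/\ forall n, cvgn (hilbert_coef_series mu a n),
      has_expansion (hilbert mu a) (hilbert_coef mu a) & analytic (hilbert mu a)].
Proof.
move=> vm aD; have [B B0 HB] := carleson1_bound (vanishing_carleson1_carleson1 vm).
split.
- exact: (hilbert_coef_cvg HB (@dyratio_measure _ mu) tau01 aD).
- exact: (hilbert_expansion HB (@dyratio_measure _ mu) tau01 aD).
- exact: (hilbert_analytic HB (@dyratio_measure _ mu) tau01 aD).
Qed.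

Lemma hilbertB a b z :
  (forall n, cvgn (hilbert_coef_series mu a n)) -> (forall n, cvgn (hilbert_coef_series mu b n)) ->
  has_expansion (hilbert mu a) (hilbert_coef mu a) -> has_expansion (hilbert mu b) (hilbert_coef mu b) ->
  disc 1 z -> hilbert mu (fun k => a k - b k) z = hilbert mu a z - hilbert mu b z.
Proof.
move=> ca cb ea eb z1.
have E : hilbert_coef mu (fun k => a k - b k) = (fun n => hilbert_coef mu a n - hilbert_coef mu b n).
  apply/funext => n; apply: cvgc_lim.
  rewrite (_ : hilbert_coef_series mu _ n = hilbert_coef_series mu a n - hilbert_coef_series mu b n).
    by apply: cvgB; [exact: ca|exact: cb].
  apply/funext => m; rewrite /hilbert_coef_series/series !fctE/= -sumrB.
  by apply: eq_bigr => k _; rewrite mulrBr.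
rewrite /hilbert E; apply: cvgc_lim; exact: expansionB ea eb z z1.
Qed.

Let dytrace_ge0 f a k : has_expansion f a -> 0 <= dytrace p q f k.
Proof. by move=> fa; rewrite mulr_ge0 ?powR_ge0// (dysup_ge0 k fa). Qed.

Let dytraceD f g h a b c k : has_expansion f a -> has_expansion g b -> has_expansion h c ->
  (forall z, normc (f z) <= normc (g z) + normc (h z)) ->
  dytrace p q f k `^ q <= 2 `^ q * (dytrace p q g k `^ q + dytrace p q h k `^ q).
Proof.
move=> fa gb hc H.
have [f0 [g0 h0]] := (dytrace_ge0 k fa, (dytrace_ge0 k gb, dytrace_ge0 k hc)).
apply: le_trans (powR_add_le q0 g0 h0).
apply: ge0_ler_powR; rewrite ?nnegrE ?addr_ge0 ?(ltW q0)//.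
rewrite /dytrace -mulrDr ler_wpM2l ?powR_ge0//.
apply: dysup_le => t kt; apply: le_trans (H _) _.
by apply: lerD; [exact: dysup_ub gb kt|exact: dysup_ub hc kt].
Qed.

Lemma vanishing_carleson1_compact : vanishing_carleson1 mu -> hilbert_compact mu p q.
Proof.
move=> vm; have cm := vanishing_carleson1_carleson1 vm.
split; [exact: carleson1_well_defined|exact: (carleson1_bounded p1 q1 s1 p2 cm).1|].
move=> f a fAT fe [M0 HM0].
pose M := `|M0|.
have HM j : (AT_norm p q (f j) `^ q <= (M `^ q)%:E)%E.
  by apply: AT_norm_powR_le => //; apply: le_trans (HM0 j) _; rewrite lee_fin ler_norm.
have [D D0 HD] := coef_growth p1 q1 (powR_ge0 M q).
have aD j : has_growth (a j) D by move=> t K; exact: HD (fAT j).1 (fe j) (HM j).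
have h01 : 0 <= (2^-1 : R) < 1 by rewrite invr_ge0 ler0n/= invf_lt1// ltr1n.
(* The growth bound at t = 1/2 bounds each coefficient independently of j. *)
have ac j n : normc (a j n) <= D * (1 - 2^-1) `^ (- tau) / 2^-1 ^+ n.
  rewrite ler_pdivlMr ?exprn_gt0//.
  by apply: le_trans (coef_term_le (a j) n _) (aD j _ _ h01).
have [sg [b [sgi Hb]]] := diagonal_subsequence ac.
have bD : has_growth b D by exact: growth_limit (fun j => aD (sg j)) Hb.
(* The limit function is not shown to lie in the space. The growth of its coefficients and the
   summability of its trace are all that the norm estimate for its image requires. *)
pose phi z := limn (power_series b z).
have phie : has_expansion phi b by exact: growth_expansion bD.
pose c j k := a (sg j) k - b k.
pose F j z := f (sg j) z - phi z.
have Fe j : has_expansion (F j) (c j) by exact: (expansionB (fe (sg j)) phie).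
have cD j : has_growth (c j) (D + D) by exact: has_growthB.
pose T j k := dytrace p q (F j) k.
have T0 j k : 0 <= T j k by exact: dytrace_ge0 (Fe j).
have Tnull k e : 0 < e -> \forall j \near \oo, T j k <= e.
  move=> e0; have d := dysup_null k Fe cD Hb (divr_gt0 e0 (powR_gt0 s (d0 k))).
  by apply: filterS d => j; rewrite ler_pdivlMr ?powR_gt0// mulrC.
have tc0 : 0 <= trace_const p q := ltW (trace_const_gt0 p q).
pose L := trace_const p q * M `^ q.
have L0 : 0 <= L by exact: mulr_ge0 tc0 (powR_ge0 _ _).
have fL j n : \sum_(k < n) dytrace p q (f j) k `^ q <= L.
  rewrite -lee_fin; apply: le_trans (trace_le p1 q1 n (fAT j).1 (fe j)) _.
  by apply: le_trans (lee_wpmul2l (eqbRL (lee_fin _ _) tc0) (HM j)) _; rewrite -EFinM.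
have q20 : 0 <= 2 `^ q :> R by exact: powR_ge0.
pose L1 := 2 `^ q * (L + 1).
(* For a fixed n, [phi] is compared with an f_j so advanced that the first n traces of the
   difference sum to at most 1. *)
have phiL n : \sum_(k < n) dytrace p q phi k `^ q <= L1.
  have [j _ /(_ j (leqnn j)) Hj] := small_sum ler01 T0 Tnull n ltr01.
  apply: (@le_trans _ _ (\sum_(k < n) 2 `^ q * (dytrace p q (f (sg j)) k `^ q + T j k `^ q))).
    apply: ler_sum => k _; apply: (dytraceD k phie (fe (sg j)) (Fe j)) => z.
    by have := ler_normcB (phi z) (f (sg j) z); rewrite normcBC lerBlDl.
  rewrite -mulr_sumr ler_wpM2l// big_split/=; apply: lerD; first exact: fL.
  by apply: le_trans Hj; apply: ler_sum => k _; rewrite mul1r.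
have L10 : 0 <= L1 by rewrite mulr_ge0// addr_ge0.
pose L2 := 2 `^ q * (L + L1).
have L20 : 0 <= L2 by rewrite mulr_ge0// addr_ge0.
have TL j n : \sum_(k < n) T j k `^ q <= L2.
  apply: (@le_trans _ _ (\sum_(k < n) 2 `^ q * (dytrace p q (f (sg j)) k `^ q + dytrace p q phi k `^ q))).
    apply: ler_sum => k _; apply: (dytraceD k (Fe j) (fe (sg j)) phie) => z.
    by have := le_normcD (f (sg j) z) (- phi z); rewrite normcN.
  rewrite -mulr_sumr ler_wpM2l// big_split/=; exact: lerD (fL _ _) (phiL _).
have [B B0 HB] := carleson1_bound cm.
have [C C0 HC] := hilbert_norm_le mu p1 q1 s1 p2.
have r0 k : 0 <= dyratio mu k := dyratio_ge0 mu k.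
exists sg, (hilbert mu b); split; first exact: sgi.
  have [_ _ ab] := growth_wd vm bD; split; first exact: ab.
  have h : (AT_norm p q (hilbert mu b) `^ q <= (C * (B `^ q * L1))%:E)%E.
    apply: le_trans (HC B phi b D HB phie bD _ (fun z _ => erefl)) _.
    rewrite EFinM lee_wpmul2l ?lee_fin//; apply: nneseries_le => [k|n].
      by rewrite lee_fin powR_ge0.
    rewrite sumEFin lee_fin; apply: le_trans (ler_wpM2l (powR_ge0 B q) (phiL n)).
    rewrite mulr_sumr; apply: ler_sum => k _.
    have P0 := dytrace_ge0 k phie.
    by rewrite powRM// ler_wpM2r ?powR_ge0// ge0_ler_powR ?nnegrE// ltW.
  apply: le_lt_trans (AT_norm_le_powR q1 _ h) (ltry _).
  by rewrite mulr_ge0// mulr_ge0// powR_ge0.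
apply: cvge0_le => [j|e e0]; first exact: AT_norm_ge0.
have C1 : 0 < C + 1 by rewrite ltr_wpDl.
have L21 : 0 < L2 + 1 by rewrite ltr_wpDl.
(* Chosen so that (C + 1) (eta + eta) = e^q: one eta for the scales below N, where the traces of the
   differences vanish, and one for the scales from N on, where the ratios are at most [ep] and ep^q
   L2 <= eta. *)
pose eta := e `^ q / (C + 1) / 2.
have eta0 : 0 < eta by rewrite !divr_gt0// powR_gt0.
pose ep := (eta / (L2 + 1)) `^ q^-1.
have ep0 : 0 < ep by rewrite powR_gt0// divr_gt0.
have epE : ep `^ q = eta / (L2 + 1).
  by rewrite /ep -powRrM mulVf ?gt_eqF// powRr1// divr_ge0// ltW.
have [N HN] := vanishing_dyratio vm ep0.
apply: filterS (small_sum B0 T0 Tnull N eta0) => j Hj.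
have part n : \sum_(k < n) (dyratio mu k * T j k) `^ q <= eta + eta.
  (* Enlarging the range to N + n allows the split at N for every n. *)
  apply: (@le_trans _ _ (\sum_(k < N + n) (dyratio mu k * T j k) `^ q)).
    by rewrite addnC big_split_ord/= lerDl sumr_ge0// => k _; exact: powR_ge0.
  rewrite big_split_ord/=; apply: lerD.
    apply: le_trans Hj; apply: ler_sum => k _.
    apply: ge0_ler_powR; rewrite ?nnegrE ?(ltW q0)//.
    - exact: mulr_ge0 (r0 _) (T0 _ _).
    - exact: mulr_ge0 B0 (T0 _ _).
    - by apply: ler_wpM2r; [exact: T0|exact: HB].
  apply: (@le_trans _ _ (ep `^ q * \sum_(k < N + n) T j k `^ q)).
    rewrite big_split_ord/= mulrDr -[leLHS]add0r; apply: lerD.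
      by rewrite mulr_ge0 ?powR_ge0// sumr_ge0// => k _; exact: powR_ge0.
    rewrite mulr_sumr; apply: ler_sum => k _.
    rewrite -(powRM _ (ltW ep0) (T0 _ _)); apply: ge0_ler_powR; rewrite ?nnegrE ?(ltW q0)//.
    - exact: mulr_ge0 (r0 _) (T0 _ _).
    - exact: mulr_ge0 (ltW ep0) (T0 _ _).
    - by apply: ler_wpM2r; [exact: T0|apply: HN; exact: leq_addr].
  rewrite epE mulrAC ler_pdivrMr// ler_wpM2l ?(ltW eta0)//.
  by apply: le_trans (TL j _) _; rewrite lerDl.
have fin : (AT_norm p q (fun z => hilbert mu (a (sg j)) z - hilbert mu b z)%R `^ q <= (e `^ q)%:E)%E.
  apply: le_trans (HC B (F j) (c j) (D + D) HB (Fe j) (cD j) _ _) _.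
    move=> z z1; have [ca ea _] := growth_wd vm (aD (sg j)); have [cb eb _] := growth_wd vm bD.
    by rewrite hilbertB.
  apply: (@le_trans _ _ (C%:E * (eta + eta)%:E)%E).
    apply: lee_wpmul2l; first by rewrite lee_fin.
    by apply: nneseries_le => [k|n]; [rewrite lee_fin powR_ge0|rewrite sumEFin lee_fin; exact: part].
  rewrite -EFinM lee_fin; apply: (@le_trans _ _ ((C + 1) * (eta + eta))).
    by rewrite ler_wpM2r ?lerDl// addr_ge0// ltW.
  by apply: eq_ler; rewrite /eta -splitr mulrC divfK// gt_eqF.
have := AT_norm_le_powR q1 (powR_ge0 e q) fin.
by rewrite -powRrM divff ?gt_eqF// powRr1// ltW.
Qed.

End sufficiency_compact.

(* A Borel measure on [0, 1) is a Borel measure on R null outside [0, 1). *)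
Theorem theorem1p6 (R : realType) (p q : R)
    (mu : {finite_measure set (measurableTypeR R) -> \bar R}) :
  1 < p -> 1 < q -> p^-1 + q^-1 < 1 -> 2 < p ->
  mu (~` `[0, 1[) = 0%E ->
  (hilbert_well_defined mu p q /\ hilbert_bounded mu p q <-> carleson1 mu) /\
  (hilbert_compact mu p q <-> vanishing_carleson1 mu).
Proof.
move=> p1 q1 s1 p2 _; split; split.
- by move=> [wd bd]; exact: (bounded_carleson1 p1 q1 s1 wd bd).
- move=> cm; split; first exact: (carleson1_well_defined p1 q1 s1 p2 cm).
  exact: (carleson1_bounded p1 q1 s1 p2 cm).
- exact: compact_vanishing_carleson1 p1 q1 s1.
- exact: vanishing_carleson1_compact p1 q1 s1 p2.
Qed.
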